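(* Let $n\ge2$ be an integer. For each $\delta>0$, $p\in(2,p_{2n})$ and each integer $k\ge 1$, let $$\lambda_{k,\delta,p}:=\frac{k(k+n-1)}{p-2}\left(1+\frac1\delta\right).$$ If $\lambda\in(\lambda_{k,\delta,p},\lambda_{k+1,\delta,p}]$, then the subcritical equation on the Riemannian product $(\mathbf S^n\times\mathbf S^n,\ g_0^n+\delta g_0^n)$, $$-\Delta_{g_0^n+\delta g_0^n}u+\lambda u=\lambda u^{p-1},$$ has at least $k$ positive solutions which are invariant by the diagonal action of $O(n+1)$.
   Context: $\mathbf S^n\subset\mathbb R^{n+1}$ is the unit sphere and $g_0^n$ is its metric of constant curvature $1$. For $\delta>0$, $g_0^n+\delta g_0^n$ denotes the Riemannian product metric on $\mathbf S^n\times\mathbf S^n$ ($g_0^n$ on the first factor, $\delta g_0^n$ on the second). $\Delta_g$ is the Laplace-Beltrami operator of $g$ (with the sign convention that it has nonpositive spectrum). $p_m=\frac{2m}{m-2}$, so $p_{2n}=\frac{4n}{2n-2}$. Solutions are classical ($C^2$). The diagonal action of $O(n+1)$ on $\mathbf S^n\times\mathbf S^n$ is $A\cdot(x,y)=(Ax,Ay)$; $u$ is invariant if $u(Ax,Ay)=u(x,y)$ for all $A\in O(n+1)$ and all $(x,y)$. *)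

(* Defs.v *)
From mathcomp Require Import all_boot all_order all_algebra.
From mathcomp Require Import all_classical all_reals all_analysis.
From mathcomp Require Import ring lra.

Set Implicit Arguments.
Unset Strict Implicit.
Unset Printing Implicit Defensive.

Import Order.TTheory GRing.Theory Num.Theory.
Import numFieldNormedType.Exports.

Local Open Scope classical_set_scope.
Local Open Scope ring_scope.

Section LocalCoordinates.
Context {R : realType} {m : nat}.
Implicit Types (f : 'rV[R]_m -> R) (g : 'rV[R]_m -> 'M[R]_m).

(* Codomain-polymorphic: also used for charts, which are vector valued. *)
Definition pderive {V : normedModType R} (i : 'I_m) (f : 'rV[R]_m -> V)
    (xi : 'rV[R]_m) : V :=
  'D_(delta_mx 0 i) f xi.

Definition classC1 f : Prop :=
  continuous f /\
  forall i : 'I_m, (forall xi, derivable f xi (delta_mx 0 i)) /\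
                   continuous (pderive i f).

Definition classC2 f : Prop :=
  classC1 f /\ forall i : 'I_m, classC1 (pderive i f).

(* |g|^(-1/2) * sum_i d_i (|g|^(1/2) * sum_j g^(ij) d_j f) *)
Definition laplace_beltrami g f (xi : 'rV[R]_m) : R :=
  (Num.sqrt (\det (g xi)))^-1 *
  \sum_(i < m)
     pderive i (fun z => Num.sqrt (\det (g z)) *
                         \sum_(j < m) invmx (g z) i j * pderive j f z) xi.

End LocalCoordinates.

Section ProductOfSpheres.
Context {R : realType}.

Definition dotv {d : nat} (v w : 'rV[R]_d) : R := \sum_(i < d) v 0 i * w 0 i.

Definition sphere (n : nat) : set 'rV[R]_n.+1 := [set x | dotv x x = 1].

Arguments sphere n : clear implicits.

(* Inverse stereographic projection from the pole (e, 0, ..., 0), where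
   e = (-1) ^+ s; it parametrizes the sphere minus that pole. *)
Definition stereo_inv (n : nat) (s : bool) (xi : 'rV[R]_n) : 'rV[R]_n.+1 :=
  (1 + dotv xi xi)^-1 *:
  row_mx ((-1) ^+ s * (dotv xi xi - 1))%:M (2 *: xi).

Lemma dotv_row_mx (n : nat) (a b : R) (v w : 'rV[R]_n) :
  @dotv n.+1 (row_mx a%:M v) (row_mx b%:M w) = a * b + dotv v w.
Proof.
have -> : dotv v w = \sum_(i < n) v 0 i * w 0 i by [].
rewrite /dotv big_ord_recl; congr (_ + _).
  by rewrite !mxE; case: splitP => // j _; rewrite !ord1 !mxE eqxx !mulr1n.
apply: eq_bigr => i _; have -> : lift ord0 i = rshift 1 i by apply/val_inj.
by rewrite (row_mxEr a%:M) (row_mxEr b%:M).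
Qed.

Lemma dotvZ (d : nat) (a b : R) (v w : 'rV[R]_d) :
  dotv (a *: v) (b *: w) = a * b * dotv v w.
Proof.
by rewrite /dotv mulr_sumr; apply: eq_bigr => i _; rewrite !mxE; ring.
Qed.

Lemma dotv_ge0 (d : nat) (v : 'rV[R]_d) : 0 <= dotv v v.
Proof. by apply: sumr_ge0 => i _; rewrite -expr2 sqr_ge0. Qed.

Lemma stereo_inv_sphere (n : nat) (s : bool) (xi : 'rV[R]_n) :
  sphere n (stereo_inv s xi).
Proof.
rewrite /sphere /= /stereo_inv dotvZ dotv_row_mx dotvZ.
have := dotv_ge0 xi; set q := dotv xi xi => q0.
have q1 : 1 + q != 0 by rewrite gt_eqF// ltr_wpDr.
have -> : (-1) ^+ s * (q - 1) * ((-1) ^+ s * (q - 1)) = (q - 1) ^+ 2 :> R.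
  by case: s; rewrite ?expr1 ?expr0; ring.
by field.
Qed.

Lemma stereo_inv_cover (n : nat) (x : 'rV[R]_n.+1) :
  sphere n x -> exists s xi, stereo_inv s xi = x.
Proof.
rewrite /sphere /=; rewrite -[x](@hsubmxK _ 1 1 n) (mx11_scalar (lsubmx _)).
set a := lsubmx _ 0 0; set v := rsubmx _; rewrite dotv_row_mx => av1.
have main (e : R) : e * e = 1 -> 1 - e * a != 0 ->
    let xi := (1 - e * a)^-1 *: v in
    (1 + dotv xi xi)^-1 *: row_mx (e * (dotv xi xi - 1))%:M (2 *: xi) =
    row_mx a%:M v.
  move=> ee1 ea /=; rewrite dotvZ.
  have -> : dotv v v = (1 - e * a) * (1 + e * a).
    have -> : (1 - e * a) * (1 + e * a) = 1 - (e * e) * (a * a) by ring.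
    by rewrite ee1 mul1r -av1 addrAC subrr add0r.
  have qE : (1 - e * a)^-1 / (1 - e * a) * ((1 - e * a) * (1 + e * a)) =
    (1 + e * a) / (1 - e * a) by field.
  have dE : 1 + (1 + e * a) / (1 - e * a) = 2 / (1 - e * a) by field.
  rewrite qE dE scale_row_mx scale_scalar_mx !scalerA; congr (row_mx _%:M _).
    have -> : e * ((1 + e * a) / (1 - e * a) - 1) =
      2 * (e * e) * a / (1 - e * a) by field.
    by rewrite ee1; field.
  by rewrite -[RHS]scale1r; congr (_ *: _); field.
have [a0|a0] := leP a 0.
  exists false, ((1 - 1 * a)^-1 *: v); rewrite /stereo_inv expr0.
  by apply: main; [rewrite mulr1 | rewrite gt_eqF//; lra].
exists true, ((1 - (-1) * a)^-1 *: v); rewrite /stereo_inv expr1.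
by apply: main; [rewrite mulrNN mulr1 | rewrite gt_eqF//; lra].
Qed.

(* The four maps [prod_chart s t] parametrize open sets covering S^n x S^n and
   their inverses form an atlas of its standard smooth structure. *)
Definition prod_chart (n : nat) (s t : bool) (xi : 'rV[R]_(n + n)) :
    'rV[R]_n.+1 * 'rV[R]_n.+1 :=
  (stereo_inv s (lsubmx xi), stereo_inv t (rsubmx xi)).

Definition prod_metric (n : nat) (delta : R)
    (v w : 'rV[R]_n.+1 * 'rV[R]_n.+1) : R :=
  dotv v.1 w.1 + delta * dotv v.2 w.2.

(* Coefficients g_ij of g_0 + delta g_0 in a chart; g_0 is the metric induced
   on the unit sphere by the Euclidean inner product. *)
Definition chart_metric (n : nat) (delta : R) (s t : bool)
    (xi : 'rV[R]_(n + n)) : 'M[R]_(n + n) :=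
  \matrix_(i, j) prod_metric delta (pderive i (@prod_chart n s t) xi)
                                   (pderive j (@prod_chart n s t) xi).

(* Functions on S^n x S^n are represented by functions on the ambient space;
   all the predicates below only depend on their values on S^n x S^n. *)

Definition sphere2_C2 (n : nat) (u : 'rV[R]_n.+1 * 'rV[R]_n.+1 -> R) : Prop :=
  forall s t : bool, classC2 (u \o @prod_chart n s t).

Definition sphere2_positive (n : nat) (u : 'rV[R]_n.+1 * 'rV[R]_n.+1 -> R) :
    Prop :=
  forall x y, sphere n x -> sphere n y -> 0 < u (x, y).

(* - Lap u + lambda u = lambda u^(p-1), expressed in the charts, whose images
   cover S^n x S^n. *)
Definition solves_subcritical (n : nat) (delta p lambda : R)
    (u : 'rV[R]_n.+1 * 'rV[R]_n.+1 -> R) : Prop :=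
  forall (s t : bool) (xi : 'rV[R]_(n + n)),
    let v := u \o @prod_chart n s t in
    - laplace_beltrami (@chart_metric n delta s t) v xi + lambda * v xi =
    lambda * (v xi) `^ (p - 1).

Definition orthogonal_mx (d : nat) (A : 'M[R]_d) : Prop := A *m A^T = 1%:M.

(* Points are row vectors, so that A x is written x *m A^T. *)
Definition diag_invariant (n : nat) (u : 'rV[R]_n.+1 * 'rV[R]_n.+1 -> R) :
    Prop :=
  forall A : 'M[R]_n.+1, orthogonal_mx A ->
  forall x y, sphere n x -> sphere n y ->
    u (x *m A^T, y *m A^T) = u (x, y).

Definition sphere2_distinct (n : nat)
    (u v : 'rV[R]_n.+1 * 'rV[R]_n.+1 -> R) : Prop :=
  exists x y, [/\ sphere n x, sphere n y & u (x, y) <> v (x, y)].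

Definition crit_exp (m : nat) : R := 2 * m%:R / (m%:R - 2).

Definition lambda_bif (n k : nat) (delta p : R) : R :=
  k%:R * (k%:R + n%:R - 1) / (p - 2) * (1 + delta^-1).

End ProductOfSpheres.

Arguments crit_exp R m : clear implicits.

(* Main.v *)
Require Import Defs.
From mathcomp Require Import all_boot all_order all_algebra.
From mathcomp Require Import all_classical all_reals all_analysis.
From mathcomp Require Import ring lra.

Set Implicit Arguments.
Unset Strict Implicit.
Unset Printing Implicit Defensive.

Import Order.TTheory GRing.Theory Num.Theory.
Import numFieldNormedType.Exports.

Local Open Scope classical_set_scope.
Local Open Scope ring_scope.

(** A function u (x, y) = f (<x, y>) is invariant under the diagonal action, and
    on the product metric the Laplacian acts on it as 1 + 1 / delta times the
    zonal Laplacian of one sphere, since <x, y> is a height function of each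
    variable ([laplace_zonal], computed in stereographic coordinates, where the
    metric is diagonal). With mu = lambda / (1 + 1 / delta) and q = p - 1 the
    equation becomes the ordinary differential equation
      (1 - t^2) f'' - n t f' + mu (f^q - f) = 0 on [-1, 1],
    regular at both ends. The constant 1 is a solution; the others are sought
    among the even functions of t. In the variable s = 1 - t this is a singular
    Cauchy problem on [0, 1] with the value f = 1 + e at the pole s = 0 and the
    Neumann condition f' = 0 at the equator s = 1.

    The Cauchy problem is solved by Picard iteration and is stable under
    perturbations ([radial_sol_exists], [radial_stability]) once the
    nonlinearity is truncated at a large height M. Writing f = 1 + e g, the
    plane curve (g, - s g') never meets the origin and has a continuous phase
    ([polar]); the Neumann condition says that the phase at the equator is a
    multiple of pi, and this phase depends continuously on e
    ([angle_family_cont]), also through e = 0, where the equation for g is the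
    linear one with parameter mu (p - 2).

    For e = 0 Sturm comparison with the even Gegenbauer polynomials, whose phase
    increases by at least pi at each step, shows that the phase exceeds m pi as
    soon as mu (p - 2) is larger than the eigenvalue of degree 2 m
    ([angle_linear_gt]); by the hypothesis on lambda this holds for m = k / 2
    rounded down. For e = - 1 the function f is 0 and the phase is 0. For
    e = M - 1 the flux that leaves a small ball around the pole is so large that
    f decreases up to the equator, and the phase is below pi
    ([large_decreasing]); here the exponent has to be subcritical. By the
    intermediate value theorem each of the levels pi, ..., m pi is attained for
    some e < 0 and some e > 0, which makes 2 m + 1 >= k solutions with the
    constant one. They are positive and remain below M, so that the truncation
    is immaterial ([neumann_gt0], [below_truncation]), they are of class C^2 at
    the poles ([zonal_profile]), and they are distinct because their values at
    the pole are. *)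

(** * Differential calculus in pointwise form *)

Section DirectionalRules.
Context {R : realType} {V : normedModType R}.
Implicit Types (f g : V -> R) (x v : V).

(** Transfers the chain rule, available in one variable, to directional
    derivatives. *)
Lemma is_derive_restrict f x v d :
  is_derive x v f d <-> is_derive (0 : R) 1 (fun h => f (h *: v + x)) d.
Proof.
have e : 'D_v f x = 'D_1 (fun h : R => f (h *: v + x)) 0.
  rewrite /derive; set g1 := (fun h => h^-1 *: _); set g2 := (fun h => h^-1 *: _).
  suff -> : g1 = g2 by []; apply/funext => h; rewrite /g1 /g2 /=.
  by rewrite addr0 scale0r add0r [_%:A]mulr1.
split=> -[d1 d2]; split.
- exact: (iffLR (derivable1P f x v) d1).
- by rewrite -e.
- exact: (iffRL (derivable1P f x v) d1).
- by rewrite e.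
Qed.

Lemma dfun_cst (c : R) x v : is_derive x v (fun=> c) 0.
Proof. exact: is_derive_cst. Qed.

Lemma dfun_eq f x v (d d' : R) : is_derive x v f d' -> d' = d ->
  is_derive x v f d.
Proof. by move=> h <-. Qed.

Lemma dfunD f g x v df dg : is_derive x v f df -> is_derive x v g dg ->
  is_derive x v (fun z => f z + g z) (df + dg).
Proof. exact: is_deriveD. Qed.

Lemma dfunB f g x v df dg : is_derive x v f df -> is_derive x v g dg ->
  is_derive x v (fun z => f z - g z) (df - dg).
Proof. exact: is_deriveB. Qed.

Lemma dfunN f x v df : is_derive x v f df ->
  is_derive x v (fun z => - f z) (- df).
Proof. exact: is_deriveN. Qed.

Lemma dfunM f g x v df dg : is_derive x v f df -> is_derive x v g dg ->
  is_derive x v (fun z => f z * g z) (f x * dg + g x * df).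
Proof. exact: is_deriveM. Qed.

Lemma dfunX f k x v df : is_derive x v f df ->
  is_derive x v (fun z => f z ^+ k) (k%:R * f x ^+ k.-1 * df).
Proof.
move=> h; have -> : (fun z => f z ^+ k) = f ^+ k by rewrite exprfctE.
exact: is_deriveX.
Qed.

Lemma dfunV f x v df : f x != 0 -> is_derive x v f df ->
  is_derive x v (fun z => (f z)^-1) (- (f x) ^- 2 * df).
Proof.
move=> fx0 [fd <-]; split; first exact: derivableV.
by rewrite deriveV.
Qed.

Lemma dfun_sum k (f : 'I_k -> V -> R) x v (df : 'I_k -> R) :
  (forall i, is_derive x v (f i) (df i)) ->
  is_derive x v (fun z => \sum_(i < k) f i z) (\sum_(i < k) df i).
Proof.
move=> h; have -> : (fun z => \sum_(i < k) f i z) = \sum_(i < k) f i.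
  by apply/funext => z; rewrite fct_sumE.
exact: is_derive_sum.
Qed.

Lemma dfun_comp (f : R -> R) g x v a b : is_derive (g x) 1 f a ->
  is_derive x v g b -> is_derive x v (fun z => f (g z)) (a * b).
Proof.
move=> hf /is_derive_restrict hg; apply/is_derive_restrict.
have h : is_derive (g (0 *: v + x)) 1 f a by rewrite scale0r add0r.
exact: (@is_derive1_comp R f (fun h : R => g (h *: v + x)) 0 a b h hg).
Qed.

End DirectionalRules.

Section ContinuityRules.
Context {R : realType} {T : topologicalType}.
Implicit Types (f g : T -> R) (x : T).

Lemma cfun_cst (c : R) x : continuous_at x (fun _ : T => c).
Proof. exact: cst_continuous. Qed.

Lemma cfun_id (x : R) : continuous_at x (fun z : R => z).
Proof. exact: cvg_id. Qed.

Lemma cfunD f g x : continuous_at x f -> continuous_at x g ->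
  continuous_at x (fun z => f z + g z).
Proof. by move=> cf cg; apply: cvgD. Qed.

Lemma cfunB f g x : continuous_at x f -> continuous_at x g ->
  continuous_at x (fun z => f z - g z).
Proof. by move=> cf cg; apply: cvgB. Qed.

Lemma cfunN f x : continuous_at x f -> continuous_at x (fun z => - f z).
Proof. by move=> cf; apply: cvgN. Qed.

Lemma cfunM f g x : continuous_at x f -> continuous_at x g ->
  continuous_at x (fun z => f z * g z).
Proof. by move=> cf cg; apply: cvgM. Qed.

Lemma cfunX f k x : continuous_at x f ->
  continuous_at x (fun z => f z ^+ k).
Proof.
move=> cf; apply: (@continuous_comp _ _ _ f (fun y : R => y ^+ k)) => //.
exact: exprn_continuous.
Qed.

Lemma cfunV f x : f x != 0 -> continuous_at x f ->
  continuous_at x (fun z => (f z)^-1).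
Proof. by move=> fx0 cf; apply: cvgV. Qed.

Lemma cfun_comp (h : R -> R) f x : continuous_at (f x) h ->
  continuous_at x f -> continuous_at x (fun z => h (f z)).
Proof. by move=> ch cf; apply: (@continuous_comp _ _ _ f h). Qed.

Lemma cfun_max f g x : continuous_at x f -> continuous_at x g ->
  continuous_at x (fun z => Num.max (f z) (g z)).
Proof. by move=> cf cg; apply: continuous_max. Qed.

Lemma cfun_min f g x : continuous_at x f -> continuous_at x g ->
  continuous_at x (fun z => Num.min (f z) (g z)).
Proof. by move=> cf cg; apply: continuous_min. Qed.

End ContinuityRules.

Section RealCalculus.
Context {R : realType}.
Implicit Types (f g : R -> R) (a b x : R).

Lemma dfun_id x : is_derive x 1 (fun z : R => z) 1.
Proof. exact: is_derive_id. Qed.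

Lemma near_gt a x : a < x -> \forall y \near x, a < y.
Proof.
move=> ax; apply/nbhs_ballP; exists (x - a); first by rewrite /= subr_gt0.
by move=> y; rewrite /ball /= ltr_norml => /andP[]; lra.
Qed.

Lemma near_lt a x : x < a -> \forall y \near x, y < a.
Proof.
move=> ax; apply/nbhs_ballP; exists (a - x); first by rewrite /= subr_gt0.
by move=> y; rewrite /ball /= ltr_norml => /andP[]; lra.
Qed.

Lemma cont_epsP f x : continuous_at x f <->
  forall e, 0 < e -> exists2 d, 0 < d &
    forall y, `|y - x| < d -> `|f y - f x| < e.
Proof.
split=> [/cvgrPdist_lt h e /h /nbhs_ballP[d /= d0 hd]|h].
  by exists d => // y xy; rewrite distrC; apply: hd; rewrite /ball /= distrC.
apply/cvgrPdist_lt => e /h[d d0 hd]; apply/nbhs_ballP; exists d => // y.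
by rewrite /ball /= => xy; rewrite distrC; apply: hd; rewrite distrC.
Qed.

Lemma is_derive_cont f x d : is_derive x 1 f d -> continuous_at x f.
Proof. by case=> h _; exact/differentiable_continuous/derivable1_diffP. Qed.

Lemma dfun_near f g x d : (\forall z \near x, f z = g z) ->
  is_derive x 1 f d -> is_derive x 1 g d.
Proof. exact: near_eq_is_derive. Qed.

Lemma dfun_compR f g x a b : is_derive (g x) 1 f a -> is_derive x 1 g b ->
  is_derive x 1 (fun z => f (g z)) (a * b).
Proof. exact: dfun_comp. Qed.

Lemma cont_within f a b : (forall x, a <= x <= b -> continuous_at x f) ->
  {within `[a, b], continuous f}.
Proof.
move=> h; apply: continuous_in_subspaceT => x.
by rewrite inE /= in_itv /= => /h.
Qed.

Lemma mean_value f df a b : a < b ->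
  (forall x, a <= x <= b -> continuous_at x f) ->
  (forall x, a < x < b -> is_derive x 1 f (df x)) ->
  exists2 c, a < c < b & f b - f a = df c * (b - a).
Proof.
move=> ab cf hf; have h x : x \in `]a, b[ -> is_derive x 1 f (df x).
  by rewrite in_itv; exact: hf.
by have [c cab e] := MVT ab h (cont_within cf); exists c.
Qed.

Lemma cauchy_mean_value f df g dg a b : a < b ->
  (forall x, a <= x <= b -> continuous_at x f) ->
  (forall x, a <= x <= b -> continuous_at x g) ->
  (forall x, a < x < b -> is_derive x 1 f (df x)) ->
  (forall x, a < x < b -> is_derive x 1 g (dg x)) ->
  (forall x, a < x < b -> dg x != 0) ->
  exists2 c, a < c < b & df c / dg c = (f b - f a) / (g b - g a).
Proof.
move=> ab cf cg hf hg h0.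
have kf x : x \in `]a, b[ -> is_derive x 1 f (df x).
  by rewrite in_itv; exact: hf.
have kg x : x \in `]a, b[ -> is_derive x 1 g (dg x).
  by rewrite in_itv; exact: hg.
have k0 x : x \in `]a, b[ -> dg x != 0 by rewrite in_itv; exact: h0.
by have [c cab e] := cauchy_MVT ab (cont_within cf) (cont_within cg) kf kg k0;
  exists c.
Qed.

Lemma derive_ge0_le f df a b : a <= b ->
  (forall x, a <= x <= b -> continuous_at x f) ->
  (forall x, a < x < b -> is_derive x 1 f (df x)) ->
  (forall x, a < x < b -> 0 <= df x) -> f a <= f b.
Proof.
rewrite le_eqVlt => /predU1P[->//|ab] cf hf h0.
have [c cab e] := mean_value ab cf hf.
by rewrite -subr_ge0 e mulr_ge0 ?h0// subr_ge0 ltW.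
Qed.

Lemma derive_gt0_lt f df a b : a < b ->
  (forall x, a <= x <= b -> continuous_at x f) ->
  (forall x, a < x < b -> is_derive x 1 f (df x)) ->
  (forall x, a < x < b -> 0 < df x) -> f a < f b.
Proof.
move=> ab cf hf h0.
have [c cab e] := mean_value ab cf hf.
by rewrite -subr_gt0 e mulr_gt0 ?h0// subr_gt0.
Qed.

Lemma derive_eq0_eq f df a b : a <= b ->
  (forall x, a <= x <= b -> continuous_at x f) ->
  (forall x, a < x < b -> is_derive x 1 f (df x)) ->
  (forall x, a < x < b -> df x = 0) -> f a = f b.
Proof.
rewrite le_eqVlt => /predU1P[->//|ab] cf hf h0.
have [c cab e] := mean_value ab cf hf.
by apply/eqP; rewrite eq_sym -subr_eq0 e h0// mul0r.
Qed.

(** A derivative cannot have a removable discontinuity; this turns one-sided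
    information on both sides of a point into a two-sided derivative. *)
Lemma is_derive_removable f (z : R -> R) a r : 0 < r ->
  continuous_at a f -> continuous_at a z ->
  (forall x, `|x - a| < r -> x != a -> is_derive x 1 f (z x)) ->
  is_derive a 1 f (z a).
Proof.
move=> r0 cf cz hf.
suff h : (fun h => h^-1 *: ((f \o shift a) (h *: 1) - f a)) @ (0:R)^' --> z a.
  by split; [apply/cvg_ex; exists (z a)|apply: cvg_lim].
apply/cvgrPdist_lt => e e0.
have /cvgrPdist_lt/(_ e e0)/nbhs_ballP[d /= d0 hd] := cz.
exists (Num.min r d); first by rewrite /= lt_min r0.
move=> h /=; rewrite sub0r normrN lt_min => /andP[hr hhd] h0.
have [h1|h1|h1] := ltgtP 0 h; last by move: h0; rewrite h1 eqxx.
- have ah : a < a + h by rewrite ltrDl.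
  have [x xah|x xah|c cah E] := @mean_value f z _ _ ah.
  + have [->//|xa] := eqVneq x a; apply: is_derive_cont (hf x _ xa).
    by rewrite ger0_norm; move: hr; rewrite ?gtr0_norm //; lra.
  + by apply: hf; [rewrite ger0_norm; move: hr; rewrite ?gtr0_norm //; lra|lra].
  + rewrite /= [h *: 1]mulr1 (addrC h) E (_ : a + h - a = h); last by ring.
    rewrite [_ *: _]mulrC mulfK//; apply: hd; rewrite /ball /=.
    by rewrite distrC ger0_norm; move: hhd; rewrite ?gtr0_norm //; lra.
- have ah : a + h < a by rewrite gtrDl.
  have [x xah|x xah|c cah E] := @mean_value f z _ _ ah.
  + have [->//|xa] := eqVneq x a; apply: is_derive_cont (hf x _ xa).
    by rewrite ler0_norm; move: hr; rewrite ?ltr0_norm //; lra.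
  + by apply: hf; [rewrite ler0_norm; move: hr; rewrite ?ltr0_norm //; lra|lra].
  + rewrite /= [h *: 1]mulr1 (addrC h) -[f _ - f _]opprB E.
    rewrite (_ : a - (a + h) = - h); last by ring.
    rewrite [_ *: _]mulrC mulrN opprK mulfK//; apply: hd; rewrite /ball /=.
    by rewrite ger0_norm; move: hhd; rewrite ?ltr0_norm //; lra.
Qed.

(** On the right half line the primitive is an integral, to which the
    fundamental theorem of calculus applies; the left half line is obtained by
    reflection, and the two are glued at 0. *)
Lemma antiderivative_exists g : continuous g ->
  exists G : R -> R, G 0 = 0 /\ forall x, is_derive x 1 G (g x).
Proof.
have right (k : R -> R) : continuous k ->
    exists K : R -> R, [/\ forall x, x <= 0 -> K x = 0, continuous K
       & forall x, 0 < x -> is_derive x 1 K (k x)].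
  move=> ck; pose K x := (\int[lebesgue_measure]_(t in `[-1, x]) k t)%R.
  have dK x : -1 < x -> is_derive x 1 K (k x).
    move=> x1; have xu : x < x + 1 by rewrite ltrDl.
    have [|dk e] := continuous_FTC1_closed xu _ x1 (ck x).
      apply: continuous_compact_integrable; first exact: segment_compact.
      exact: continuous_subspaceT.
    by apply: (DeriveDef dk); rewrite -derive1E; exact: e.
  exists (fun x => K (Num.max x 0) - K 0); split.
  - by move=> x x0; rewrite max_r// subrr.
  - move=> x; apply: (@cfunB _ _ _ (fun=> K 0)); last exact: cfun_cst.
    apply: cfun_comp; last by apply: cfun_max; [exact: cvg_id|exact: cfun_cst].
    by apply: is_derive_cont (dK _ _); rewrite lt_max ltrN10 orbT.
  - move=> x x0; apply: (@near_eq_is_derive _ _ _ (fun y => K y - K 0)).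
      by apply: filterS (near_gt x0) => y y0; rewrite max_l// ltW.
    apply: (@is_derive_eq _ _ _ _ _ _ _ (k x - 0)); last exact: subr0.
    apply: dfunB.
    by apply: dK; rewrite (lt_trans _ x0)// ltrN10.
move=> cg; have [K [K0 cK dK]] := right g cg.
have [|L [L0 cL dL]] := right (fun x => g (- x)).
  by move=> x; apply: cfun_comp; [exact: cg|exact: opp_continuous].
pose G x := K x - L (- x).
have cG x : continuous_at x G.
  apply: (@cfunB _ _ K (fun y => L (- y))); first exact: cK.
  by apply: cfun_comp; [exact: cL|exact: opp_continuous].
exists G; split; first by rewrite /G oppr0 K0// L0// subr0.
have dG x : x != 0 -> is_derive x 1 G (g x).
  case: ltgtP => // x0 _; last first.
    apply: (@near_eq_is_derive _ _ _ K); last exact: dK.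
    by apply: filterS (near_gt x0) => y y0; rewrite /G [L _]L0 ?subr0// oppr_le0 ltW.
  apply: (@near_eq_is_derive _ _ _ (fun y => - L (- y))).
    by apply: filterS (near_lt x0) => y y0; rewrite /G [K _]K0 ?sub0r// ltW.
  have -> : g x = - (g (- - x) * - 1) by rewrite opprK; ring.
  apply: dfunN; apply: (@dfun_comp _ _ L -%R); first by apply: dL; rewrite oppr_gt0.
move=> x; have [->|] := eqVneq x 0; last exact: dG.
by apply: (@is_derive_removable _ _ _ 1) => // y _; exact: dG.
Qed.

End RealCalculus.

(** Differentiation and continuity of composite expressions by structural
    recursion; the atoms are left as goals. *)
Ltac der := repeat lazymatch goal with
  | |- is_derive _ _ (fun _ => ?c) _ => notypeclasses refine (@dfun_cst _ _ c _ _)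
  | |- is_derive _ _ (fun z => z) _ => notypeclasses refine (@dfun_id _ _)
  | |- is_derive _ _ (fun z => @?f z + @?g z) _ =>
      notypeclasses refine (@dfunD _ _ f g _ _ _ _ _ _)
  | |- is_derive _ _ (fun z => - @?f z) _ =>
      notypeclasses refine (@dfunN _ _ f _ _ _ _)
  | |- is_derive _ _ (fun z => @?f z * @?g z) _ =>
      notypeclasses refine (@dfunM _ _ f g _ _ _ _ _ _)
  | |- is_derive _ _ (fun z => @?f z ^+ ?k) _ =>
      notypeclasses refine (@dfunX _ _ f k _ _ _ _)
  | |- is_derive _ _ (fun z => (@?f z)^-1) _ =>
      notypeclasses refine (@dfunV _ _ f _ _ _ _ _)
  | |- is_derive _ _ _ _ => eassumption
  end.
Ltac der_to := notypeclasses refine (@dfun_eq _ _ _ _ _ _ _ _ _); [der|cbv beta].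
Ltac cont := repeat lazymatch goal with
  | |- continuous_at _ (fun _ => ?c) => exact: (@cfun_cst _ _ c _)
  | |- continuous_at _ (fun z => z) => exact: (@cfun_id _ _)
  | |- continuous_at _ (fun z => @?f z + @?g z) =>
      notypeclasses refine (@cfunD _ _ f g _ _ _)
  | |- continuous_at _ (fun z => - @?f z) =>
      notypeclasses refine (@cfunN _ _ f _ _)
  | |- continuous_at _ (fun z => @?f z * @?g z) =>
      notypeclasses refine (@cfunM _ _ f g _ _ _)
  | |- continuous_at _ (fun z => @?f z ^+ ?k) =>
      notypeclasses refine (@cfunX _ _ f k _ _)
  | |- continuous_at _ (fun z => (@?f z)^-1) =>
      notypeclasses refine (@cfunV _ _ f _ _ _)
  | |- continuous_at _ (fun z => Num.max (@?f z) (@?g z)) =>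
      notypeclasses refine (@cfun_max _ _ f g _ _ _)
  | |- continuous_at _ (fun z => Num.min (@?f z) (@?g z)) =>
      notypeclasses refine (@cfun_min _ _ f g _ _ _)
  | |- continuous_at _ _ => eassumption
  end.

(** * The singular Cauchy problem *)

Section Primitive.
Context {R : realType}.
Implicit Types (g h : R -> R) (s : R).

(** Total in g, so that expressions containing primitives carry no proof of
    continuity. *)
Definition primitive g : R -> R :=
  if pselect (continuous g) is left cg then projT1 (cid (antiderivative_exists cg))
  else fun=> 0.

Lemma primitive0 g : primitive g 0 = 0.
Proof. by rewrite /primitive; case: pselect => // cg; case: cid => G []. Qed.

Lemma is_derive_primitive g s : continuous g ->
  is_derive s 1 (primitive g) (g s).
Proof. by move=> cg; rewrite /primitive; case: pselect => // c; case: cid => G []. Qed.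

Lemma primitive_cont g : continuous g -> continuous (primitive g).
Proof. by move=> cg s; exact: is_derive_cont (is_derive_primitive s cg). Qed.

Lemma primitiveB g h s : continuous g -> continuous h -> 0 <= s ->
  primitive (fun z => g z - h z) s = primitive g s - primitive h s.
Proof.
move=> cg ch s0; have cgh : continuous (fun z => g z - h z).
  by move=> x; move: (cg x) (ch x) => ? ?; cont.
have d (x : R) : is_derive x 1 (fun z => primitive (fun z => g z - h z) z -
    (primitive g z - primitive h z)) 0.
  move: (is_derive_primitive x cg) (is_derive_primitive x ch)
    (is_derive_primitive x cgh) => ? ? ?.
  by der_to; ring.
have := @derive_eq0_eq R _ (fun=> 0) 0 s s0 (fun x _ => is_derive_cont (d x))
  (fun x _ => d x) (fun _ _ => erefl).
by rewrite !primitive0 subrr subrr => /esym/eqP; rewrite subr_eq0 => /eqP.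
Qed.

(** Bounds proved on an open interval extend to its left end, where the
    differential equation says nothing. *)
Lemma le_cont_right g s r B : continuous_at s g -> s < r ->
  (forall x, s < x < r -> `|g x| <= B) -> `|g s| <= B.
Proof.
move=> cg sr h; rewrite leNgt; apply/negP => hB.
have /cont_epsP/(_ (`|g s| - B))[|d d0 hd] := cg; first by rewrite subr_gt0.
pose x := s + Num.min (d / 2) ((r - s) / 2).
have m0 : 0 < Num.min (d / 2) ((r - s) / 2).
  by rewrite lt_min !divr_gt0// subr_gt0.
have m1 : Num.min (d / 2) ((r - s) / 2) <= d / 2 by rewrite ge_min lexx.
have m2 : Num.min (d / 2) ((r - s) / 2) <= (r - s) / 2 by rewrite ge_min lexx orbT.
have xs : `|x - s| < d by rewrite /x addrAC subrr add0r gtr0_norm//; lra.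
have hx : `|g x| <= B by apply: h; rewrite /x; apply/andP; split; lra.
have := hd x xs; have : `|g s| <= `|g x - g s| + `|g x|.
  by rewrite distrC -[X in `|X| <= _](subrK (g x)) ler_normD.
by lra.
Qed.

End Primitive.
Arguments primitive_cont {R g} cg s : rename.

Section Weighted.
Context {R : realType} (n : nat) (hn : (2 <= n)%N).
Implicit Types (f g h y : R -> R) (s : R).

Let n0 : 0 < n%:R :> R. Proof. by rewrite ltr0n (ltn_trans _ hn). Qed.

Lemma is_derive_sqrtX s : 0 < s ->
  is_derive s 1 (fun x => Num.sqrt x ^+ n) (n%:R / 2 * Num.sqrt s ^+ n.-2).
Proof.
move=> s0; have := is_derive1_sqrt s0 => ?; der_to.
have r0 : Num.sqrt s != 0 by rewrite gt_eqF// sqrtr_gt0.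
case: n hn => [//|[//|k]] _ /=; rewrite [Num.sqrt s ^+ k.+1]exprS.
by field.
Qed.

(** Solution operator of the Euler equation s z' + (n/2) z = h, singled out
    among the solutions, which differ by multiples of s^(- n/2), by its
    continuity at the singular point s = 0. *)
Definition euler h s : R :=
  if 0 < s then (Num.sqrt s ^+ n)^-1 *
                primitive (fun x => Num.sqrt x ^+ n.-2 * h x) s
  else 2 / n%:R * h 0.

Let cweight h : continuous h ->
  continuous (fun x => Num.sqrt x ^+ n.-2 * h x).
Proof. by move=> ch x; move: (ch x) (@sqrt_continuous R x) => ? ?; cont. Qed.

(** Cauchy's mean value theorem for the two primitives of s^(n/2 - 1) h and
    s^(n/2 - 1): it gives continuity at 0 and bounds by the supremum of h. *)
Lemma euler_mean h s : continuous h -> 0 < s ->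
  exists2 x, 0 < x < s & euler h s = 2 / n%:R * h x.
Proof.
move=> ch s0; rewrite /euler s0; have cw := cweight ch.
have [|||x /andP[x0 xs]] := @cauchy_mean_value R
    (primitive (fun x => Num.sqrt x ^+ n.-2 * h x))
    (fun x => Num.sqrt x ^+ n.-2 * h x)
    (fun x => Num.sqrt x ^+ n) (fun x => n%:R / 2 * Num.sqrt x ^+ n.-2) 0 s s0
    (fun x _ => primitive_cont cw x) _ (fun x _ => is_derive_primitive x cw).
- by move=> x _; move: (@sqrt_continuous R x) => ?; cont.
- by move=> x /andP[x0 _]; exact: is_derive_sqrtX.
- move=> x /andP[x0 _]; rewrite mulf_neq0 ?expf_neq0 ?gt_eqF ?sqrtr_gt0//.
  by rewrite divr_gt0.
- rewrite primitive0 sqrtr0 expr0n; case: eqP hn => [->//|_ _]; rewrite !subr0.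
  rewrite [RHS]mulrC => <-; exists x; first by rewrite x0.
  have r0 : Num.sqrt x ^+ n.-2 != 0 by rewrite expf_neq0 ?gt_eqF ?sqrtr_gt0.
  by field; rewrite r0 gt_eqF.
Qed.

Lemma euler_cont h : continuous h -> continuous (euler h).
Proof.
move=> ch s; have cw := cweight ch; case: (ltgtP 0 s) => s0.
- have c : continuous_at s (fun x => (Num.sqrt x ^+ n)^-1 *
                primitive (fun x => Num.sqrt x ^+ n.-2 * h x) x).
    move: (@sqrt_continuous R s) (primitive_cont cw s) => ? ?; cont.
    by rewrite expf_neq0 ?gt_eqF ?sqrtr_gt0.
  rewrite /continuous_at [X in _ --> X](_ : _ =
    (fun x => (Num.sqrt x ^+ n)^-1 *
      primitive (fun x => Num.sqrt x ^+ n.-2 * h x) x) s); last by rewrite /euler s0.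
  apply: cvg_trans c; apply: near_eq_cvg.
  by apply: filterS (near_gt s0) => y y0; rewrite /euler y0.
- rewrite /continuous_at {2}/euler ltNge (ltW s0) /=.
  apply: cvg_near_cst; apply: filterS (near_lt s0) => y y0.
  by rewrite /euler ltNge (ltW y0).
- rewrite -s0; apply/cont_epsP => e e0.
  have /cont_epsP/(_ (e * (n%:R / 2)))[|d d0 hd] := ch 0.
    by rewrite mulr_gt0// divr_gt0.
  exists d => // y; rewrite subr0 => yd.
  have -> : euler h 0 = 2 / n%:R * h 0 by rewrite /euler ltxx.
  have [y0|y0] := ltP 0 y; last by rewrite /euler (ltNge 0) y0 subrr normr0.
  have [x /andP[x0 xy] ->] := euler_mean ch y0.
  rewrite -mulrBr normrM gtr0_norm ?divr_gt0//.
  rewrite mulrC -ltr_pdivlMr ?divr_gt0// invf_div; apply: hd.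
  by rewrite subr0 gtr0_norm//; move: yd; rewrite gtr0_norm//; lra.
Qed.

Lemma is_derive_euler h s : continuous h -> 0 < s ->
  is_derive s 1 (euler h) ((h s - n%:R / 2 * euler h s) / s).
Proof.
move=> ch s0; have cw := cweight ch.
apply: (@near_eq_is_derive _ _ _ (fun x => (Num.sqrt x ^+ n)^-1 *
                primitive (fun x => Num.sqrt x ^+ n.-2 * h x) x)).
  by apply: filterS (near_gt s0) => y y0; rewrite /euler y0.
move: (is_derive1_sqrt s0) (is_derive_primitive s cw) => d1 d2.
have r0 : Num.sqrt s != 0 by rewrite gt_eqF// sqrtr_gt0.
der_to; first by rewrite expf_neq0.
rewrite /euler s0; set p := primitive _ s; set r := Num.sqrt s in r0 *.
have -> : s = r ^+ 2 by rewrite sqr_sqrtr// ltW.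
by case: n hn => [//|[//|k]] _ /=; rewrite !exprS; field; rewrite r0 ?expf_neq0.
Qed.

End Weighted.
Arguments euler_cont {R n} hn {h} ch s : rename.

Section Resolvent.
Context {R : realType} (n : nat) (hn : (2 <= n)%N).
Implicit Types (f g h y z : R -> R) (s : R).

Let n0 : 0 < n%:R :> R. Proof. by rewrite ltr0n (ltn_trans _ hn). Qed.

(** The factor 2 - s, frozen before its zero, the antipode s = 2: the equation
    is only used on the hemisphere s <= 1 and a little beyond. *)
Definition gap s : R := Num.max (2 - s) 2^-1.

Lemma gapE s : s <= 3 / 2 -> gap s = 2 - s.
Proof. by move=> h; rewrite /gap max_l//; lra. Qed.

Lemma gap_ge s : 2^-1 <= gap s.
Proof. by rewrite /gap le_max lexx orbT. Qed.

Lemma gap_le s : 0 <= s -> gap s <= 2.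
Proof. by move=> s0; rewrite /gap ge_max; apply/andP; split; lra. Qed.

Lemma gap_gt0 s : 0 < gap s.
Proof. by apply: lt_le_trans (gap_ge s); rewrite invr_gt0. Qed.

Lemma sqrt_gap_cont s : continuous_at s (fun x => Num.sqrt (gap x)).
Proof.
apply: cfun_comp; first exact: sqrt_continuous.
by rewrite /gap; cont.
Qed.

(** Solution operator of the linear first order equation
    s (2 - s) z' + n (1 - s) z = h that is regular at s = 0. The substitution
    z = (2 - s)^(- n/2) w turns it into an Euler equation for w. *)
Definition resolvent h s : R :=
  (Num.sqrt (gap s) ^+ n)^-1 *
  euler n (fun x => Num.sqrt (gap x) ^+ n.-2 * h x) s.

Let cgap h : continuous h ->
  continuous (fun x => Num.sqrt (gap x) ^+ n.-2 * h x).
Proof. by move=> ch x; move: (ch x) (@sqrt_gap_cont x) => ? ?; cont. Qed.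

Lemma resolvent_cont h : continuous h -> continuous (resolvent h).
Proof.
move=> ch s; rewrite /resolvent.
move: (@sqrt_gap_cont s) (euler_cont hn (cgap ch) s) => ? ?; cont.
by rewrite expf_neq0// gt_eqF// sqrtr_gt0 gap_gt0.
Qed.

(** Bound for the norm of the solution operator given by the mean value
    formula, as gap takes its values between 1/2 and 2. *)
Definition fluxC : R := (Num.sqrt 2^-1 ^+ n)^-1 * (2 / n%:R * Num.sqrt 2 ^+ n.-2).

Lemma fluxC_gt0 : 0 < fluxC.
Proof.
by rewrite /fluxC mulr_gt0 ?invr_gt0 ?exprn_gt0 ?sqrtr_gt0 ?invr_gt0// mulr_gt0
  ?divr_gt0// exprn_gt0// sqrtr_gt0.
Qed.

Lemma weight_bound s x : 0 <= s -> 0 <= x ->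
  0 <= (Num.sqrt (gap s) ^+ n)^-1 * (2 / n%:R * Num.sqrt (gap x) ^+ n.-2)
    <= fluxC.
Proof.
move=> s0 x0; have gs := gap_gt0 s; have gx := gap_gt0 x.
have p1 : 0 <= (Num.sqrt (gap s) ^+ n)^-1 by rewrite invr_ge0 exprn_ge0 ?sqrtr_ge0.
have p2 : 0 <= Num.sqrt (gap x) ^+ n.-2 by rewrite exprn_ge0 ?sqrtr_ge0.
have p3 : 0 <= 2 / n%:R :> R by rewrite divr_ge0 ?ltW.
apply/andP; split; first by rewrite !mulr_ge0.
apply: ler_pM => //.
- rewrite lef_pV2 ?posrE ?exprn_gt0 ?sqrtr_gt0 ?invr_gt0//.
  by rewrite lerXn2r ?nnegrE ?sqrtr_ge0// ler_sqrt ?gap_ge// ltW.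
- by rewrite ler_wpM2l// lerXn2r ?nnegrE ?sqrtr_ge0// ler_sqrt ?gap_le.
Qed.

Lemma resolvent_le h s B : continuous h -> 0 <= s ->
  (forall x, 0 <= x <= s -> `|h x| <= B) -> `|resolvent h s| <= fluxC * B.
Proof.
move=> ch s0 hB; have B0 : 0 <= B.
  by apply: le_trans (hB 0 _); rewrite ?normr_ge0// lexx.
suff [x x0s ->] : exists2 x, 0 <= x <= s & resolvent h s =
   (Num.sqrt (gap s) ^+ n)^-1 * (2 / n%:R * Num.sqrt (gap x) ^+ n.-2) * h x.
  have /andP[x0 _] := x0s; have /andP[w0 w1] := weight_bound s0 x0.
  by rewrite normrM (ger0_norm w0) ler_pM// hB.
rewrite /resolvent; move: s0; rewrite le_eqVlt => /predU1P[<-|s0].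
  by exists 0; rewrite ?lexx// /euler ltxx !mulrA.
have [x /andP[x0 xs] ->] := euler_mean hn (cgap ch) s0.
by exists x; rewrite ?(ltW x0) ?(ltW xs)// !mulrA.
Qed.

Lemma resolventB g h s : continuous g -> continuous h ->
  resolvent (fun x => g x - h x) s = resolvent g s - resolvent h s.
Proof.
move=> cg ch; rewrite /resolvent -mulrBr; congr (_ * _); rewrite /euler.
case: ifP => s0; last by ring.
rewrite -mulrBr -primitiveB ?ltW//.
- congr (_ * primitive _ _); apply/funext => x; ring.
- by move=> x; move: (cg x) (@sqrt_gap_cont x) (@sqrt_continuous R x) => ? ? ?; cont.
- by move=> x; move: (ch x) (@sqrt_gap_cont x) (@sqrt_continuous R x) => ? ? ?; cont.
Qed.

Lemma is_derive_resolvent h s : continuous h -> 0 < s < 3 / 2 ->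
  is_derive s 1 (resolvent h)
    ((h s - n%:R * (1 - s) * resolvent h s) / (s * (2 - s))).
Proof.
move=> ch /andP[s0 s1]; have s2 : 0 < 2 - s by lra.
have g0 : 0 < Num.sqrt (2 - s) by rewrite sqrtr_gt0.
have de : is_derive s 1 (fun x => Num.sqrt (2 - x)) ((2 * Num.sqrt (2 - s))^-1 * (0 - 1)).
  notypeclasses refine (@dfun_compR R Num.sqrt (fun x => 2 - x) _ _ _ _ _).
    exact: is_derive1_sqrt.
  by der.
apply: (@dfun_near _ (fun x : R => (Num.sqrt (2 - x) ^+ n)^-1 *
  euler n (fun x => Num.sqrt (gap x) ^+ n.-2 * h x) x)).
  by apply: filterS (near_lt s1) => x x1; rewrite /resolvent gapE// ltW.
have := is_derive_euler hn (cgap ch) s0 => dh.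
der_to; first by rewrite expf_neq0// gt_eqF.
rewrite /resolvent gapE; last by lra.
set e := euler _ _ s; set r := Num.sqrt (2 - s) in g0 *.
have rE : s = 2 - r ^+ 2 by rewrite sqr_sqrtr; [ring|exact: ltW].
have r0 : r != 0 by rewrite gt_eqF.
have s00 : 2 - r ^+ 2 != 0 by rewrite -rE gt_eqF.
rewrite rE; case: n hn => [//|[//|k]] _ /=; rewrite -!natr1 !exprS; field.
by rewrite opprB addrC subrK mulf_neq0 ?r0 ?expf_neq0 ?andbT /= -?expr2.
Qed.

End Resolvent.

Section Picard.
Context {R : realType}.
Implicit Types (f g h y z N : R -> R) (s : R).

Lemma ltn_expr2 j : j%:R < 2 ^+ j :> R.
Proof. by rewrite -natrX ltr_nat ltn_expl. Qed.

(** Geometric error bounds replace uniform convergence: they are stable under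
    the operations needed for a fixed point argument with real sequences
    only. *)
Lemma eq0_of_geometric (x C : R) : (forall j, `|x| <= C / 2 ^+ j) -> x = 0.
Proof.
move=> h; apply/eqP; apply/negP => /negP x0.
have xp : 0 < `|x| by rewrite normr_gt0.
have C0 : 0 <= C by move: (h 0%N); rewrite expr0 divr1; apply: le_trans.
have := archi_boundP (divr_ge0 C0 (ltW xp)); set j := Num.bound _ => hj.
have := h j; rewrite ler_pdivlMr ?exprn_gt0// => h1.
have := lt_trans hj (ltn_expr2 j); rewrite ltr_pdivrMr// mulrC => h2.
by move: (lt_le_trans h2 h1); rewrite ltxx.
Qed.

Lemma geometric_limit (u : nat -> R) (B : R) :
  (forall j, `|u j.+1 - u j| <= B / 2 ^+ j) ->
  exists l, forall j, `|u j - l| <= 2 * B / 2 ^+ j.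
Proof.
move=> h; pose v j := u j - 2 * B / 2 ^+ j; pose w j := u j + 2 * B / 2 ^+ j.
have E j : 2 * B / 2 ^+ j.+1 = B / 2 ^+ j.
  by rewrite exprS; field; rewrite expf_neq0.
have E' j : 2 * B / 2 ^+ j = 2 * (B / 2 ^+ j) by rewrite mulrA.
have hv i j : (i <= j)%N -> v i <= v j.
  elim: j => [|j IH]; first by rewrite leqn0 => /eqP->.
  rewrite leq_eqVlt => /predU1P[->//|]; rewrite ltnS => /IH /le_trans; apply.
  by rewrite /v E E'; have := h j; rewrite ler_norml => /andP[]; lra.
have hw i j : (i <= j)%N -> w j <= w i.
  elim: j => [|j IH]; first by rewrite leqn0 => /eqP->.
  rewrite leq_eqVlt => /predU1P[->//|]; rewrite ltnS => /IH; apply: le_trans.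
  by rewrite /w E E'; have := h j; rewrite ler_norml => /andP[]; lra.
have B0 j : 0 <= B / 2 ^+ j by apply: le_trans (h j).
have vw i j : v i <= w j.
  apply: (@le_trans _ _ (v (maxn i j))); first by rewrite hv// leq_maxl.
  apply: (@le_trans _ _ (w (maxn i j))); last by rewrite hw// leq_maxr.
  by rewrite /v /w E'; have := B0 (maxn i j); lra.
have ne : range v !=set0 by exists (v 0%N), 0%N.
have ub : has_ubound (range v) by exists (w 0%N) => _ [i _ <-].
exists (sup (range v)) => j.
have h1 : v j <= sup (range v) by apply: ub_le_sup => //; exists j.
have h2 : sup (range v) <= w j by apply: ge_sup => // _ [i _ <-].
by rewrite ler_norml; rewrite /v /w in h1 h2; apply/andP; split; lra.
Qed.

Lemma is_derive_expRM (c s : R) :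
  is_derive s 1 (fun x => expR (c * x)) (expR (c * s) * c).
Proof.
notypeclasses refine (@dfun_compR R expR (fun x => c * x) s _ _ _ _).
  exact: is_derive_expR.
by der_to; ring.
Qed.

(** Integrated form of the bound |P'| <= K M e^(2 K s) + c: the weight
    e^(2 K s) gains the factor 1/2 that makes Picard's operator contracting. *)
Lemma exp_growth (P D : R -> R) (K M c r : R) : 0 < K ->
  (forall x, 0 <= x <= r -> continuous_at x P) ->
  (forall x, 0 < x < r -> is_derive x 1 P (D x)) ->
  (forall x, 0 < x < r -> `|D x| <= K * M * expR (2 * K * x) + c) ->
  0 <= r -> `|P r - P 0| <= M / 2 * (expR (2 * K * r) - 1) + c * r.
Proof.
move=> K0 cP dP bD r0.
pose G x : R := M / 2 * expR (2 * K * x) + c * x.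
have dG (x : R) : is_derive x 1 G (K * M * expR (2 * K * x) + c).
  by have := is_derive_expRM (2 * K) x => ?; rewrite /G; der_to; lra.
have cG x := is_derive_cont (dG x).
have h1 : G 0 - P 0 <= G r - P r.
  refine (@derive_ge0_le _ (fun x => G x - P x)
    (fun x => K * M * expR (2 * K * x) + c - D x) _ _ r0 _ _ _) => x xr.
  - by move: (cG x) (cP x xr) => ? ?; cont.
  - by move: (dG x) (dP x xr) => ? ?; der.
  - by have := bD x xr; rewrite ler_norml => /andP[]; lra.
have h2 : G 0 + P 0 <= G r + P r.
  refine (@derive_ge0_le _ (fun x => G x + P x)
    (fun x => K * M * expR (2 * K * x) + c + D x) _ _ r0 _ _ _) => x xr.
  - by move: (cG x) (cP x xr) => ? ?; cont.
  - by move: (dG x) (dP x xr) => ? ?; der.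
  - by have := bD x xr; rewrite ler_norml => /andP[]; lra.
have E : G r - G 0 = M / 2 * (expR (2 * K * r) - 1) + c * r.
  by rewrite /G !mulr0 expR0; ring.
by rewrite -E ler_norml; apply/andP; split; lra.
Qed.

End Picard.

Section SingularIVP.
Context {R : realType} (n : nat) (hn : (2 <= n)%N).
Implicit Types (f g h y z N : R -> R) (s : R).

(** With t = 1 - s the height of a point on the sphere of dimension n, the
    Laplacian of a function of t is s (2 - s) g'' + n (1 - s) g'; thus y = g'
    solves the equation Laplacian + N (g) = 0, regularly at the pole s = 0. The
    range reaches beyond the equator s = 1 in order to have two-sided
    derivatives there. *)
Definition radial_sol N g y : Prop :=
  [/\ continuous g, continuous y,
      forall s, 0 < s < 3 / 2 -> is_derive s 1 g (y s)
    & forall s, 0 < s < 3 / 2 -> is_derive s 1 y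
        ((- N (g s) - n%:R * (1 - s) * y s) / (s * (2 - s)))].

Definition lipschitz_with (L : R) N := forall a b, `|N a - N b| <= L * `|a - b|.

Lemma lipschitz_with_cont (L : R) N : 0 < L -> lipschitz_with L N -> continuous N.
Proof.
move=> L0 hN x; apply/cont_epsP => e e0; exists (e / L); first exact: divr_gt0.
by move=> y yx; apply: le_lt_trans (hN _ _) _; rewrite mulrC -ltr_pdivlMr.
Qed.

Definition clamp s : R := Num.min (Num.max s 0) (3 / 2).

Lemma clamp_itv s : 0 <= clamp s <= 3 / 2.
Proof. by rewrite /clamp le_min ge_min lexx orbT le_max lexx orbT /= andbT; lra. Qed.

Lemma clampE s : 0 <= s <= 3 / 2 -> clamp s = s.
Proof. by move=> /andP[? ?]; rewrite /clamp max_l// min_l. Qed.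

Lemma clamp_cont s : continuous_at s clamp.
Proof. by rewrite /clamp; cont. Qed.

Section PicardIteration.
Variables (N : R -> R) (L a : R).
Hypotheses (L0 : 0 < L) (hN : lipschitz_with L N).

Let cN := lipschitz_with_cont L0 hN.
Let K : R := fluxC n * L.
Let K0 : 0 < K. Proof. by rewrite mulr_gt0// fluxC_gt0. Qed.
Let source f x := - N (f x).
Let picard f s := a + primitive (resolvent n (source f)) (clamp s).

Let csource f : continuous f -> continuous (source f).
Proof.
move=> cf x; apply: cfunN; apply: cfun_comp; [exact: cN|exact: cf].
Qed.

Let cresolvent f : continuous f -> continuous (resolvent n (source f)).
Proof. by move=> cf; apply: resolvent_cont => //; exact: csource. Qed.

Let cpicard f : continuous f -> continuous (picard f).
Proof.
move=> cf s; apply: cfunD; first exact: cfun_cst.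
apply: cfun_comp; last exact: clamp_cont.
exact: primitive_cont (cresolvent cf) _.
Qed.

Let contracting f1 f2 M s : continuous f1 -> continuous f2 ->
  (forall x, 0 <= x <= 3 / 2 -> `|f1 x - f2 x| <= M * expR (2 * K * x)) ->
  0 <= s <= 3 / 2 -> `|picard f1 s - picard f2 s| <= M / 2 * expR (2 * K * s).
Proof.
move=> c1 c2 h12 hs; have /andP[s0 s1] := hs; rewrite /picard clampE//.
set P1 := primitive _; set P2 := primitive _.
have M0 : 0 <= M.
  have := h12 0; rewrite mulr0 expR0 mulr1 lexx /= => /(_ _)h.
  by apply: le_trans (h _) => //; lra.
have d1 x := is_derive_primitive x (cresolvent c1).
have d2 x := is_derive_primitive x (cresolvent c2).
have /= := @exp_growth R (fun x => P1 x - P2 x)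
  (fun x => resolvent n (source f1) x - resolvent n (source f2) x) K M 0 s K0.
rewrite /P1 /P2 !primitive0 -/P1 -/P2 mul0r !subr0 addr0 => H.
rewrite (_ : a + P1 s - (a + P2 s) = P1 s - P2 s); last by ring.
apply: le_trans (H _ _ _ _) _ => //.
- move=> x _; move: (primitive_cont (cresolvent c1) x)
    (primitive_cont (cresolvent c2) x) => ? ?; cont.
- move=> x /andP[x0 xs]; rewrite addr0 -resolventB//; try exact: csource.
  rewrite (_ : K * M * _ = fluxC n * (L * (M * expR (2 * K * x)))); last first.
    by rewrite /K; ring.
  apply: resolvent_le => //.
  + by move=> z; move: (@csource f1 c1 z) (@csource f2 c2 z) => ? ?; cont.
  + exact: ltW.
  + move=> z /andP[z0 zx]; rewrite /source opprK addrC.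
    apply: le_trans (hN _ _) _; rewrite ler_wpM2l ?(ltW L0)// distrC.
    apply: le_trans (h12 z _) _; first by apply/andP; split; lra.
    by rewrite ler_wpM2l// ler_expR ler_wpM2l// mulr_ge0// ltW.
- by rewrite ler_wpM2l ?divr_ge0// gerBl.
Qed.

(** Picard iteration for g = a + primitive of the resolvent of - N (g), in the
    norm weighted by e^(- 2 K s), for which it contracts by 1/2. *)
Lemma radial_sol_exists : exists g y, radial_sol N g y /\ g 0 = a.
Proof.
pose f_ j := iter j picard (fun=> a).
have cf j : continuous (f_ j).
  by elim: j => [|j IH]; [exact: cst_continuous|exact: cpicard].
have fclamp j s : f_ j s = f_ j (clamp s).
  case: j => [//|j]; rewrite /f_ /= /picard; congr (_ + primitive _ _).
  by rewrite [RHS]clampE// clamp_itv.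
pose M := 2 * (fluxC n * `|N a|); have M0 : 0 <= M.
  by rewrite !mulr_ge0// ltW// fluxC_gt0.
have step j : forall s, 0 <= s <= 3 / 2 ->
    `|f_ j.+1 s - f_ j s| <= M / 2 ^+ j * expR (2 * K * s).
  elim: j => [|j IH] s hs.
    rewrite /f_ /= expr0 divr1 /picard clampE// addrAC subrr add0r.
    have := @exp_growth R (primitive (resolvent n (source (fun=> a))))
      (resolvent n (source (fun=> a))) K 0 (M / 2) s K0.
    rewrite primitive0 subr0 mul0r mul0r add0r => H.
    have /andP[s0 s1] := hs; apply: le_trans (H _ _ _ s0) _.
    + move=> x _; exact: primitive_cont (cresolvent (cf 0%N)) x.
    + by move=> x _; apply: is_derive_primitive; exact: cresolvent (cf 0%N).
    + move=> x /andP[x0 _]; rewrite mulr0 mul0r add0r /M mulrC mulKf//.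
      apply: resolvent_le => //; [exact: csource (cf 0%N)|exact: ltW|].
      by move=> z _; rewrite /source normrN.
    + apply: (@le_trans _ _ M); first by rewrite -mulrA ler_piMr//; lra.
      rewrite ler_peMr// -expR0 ler_expR mulr_ge0// mulr_ge0// ltW//.
  rewrite (_ : M / 2 ^+ j.+1 = M / 2 ^+ j / 2).
    exact: (contracting (cf j.+1) (cf j) IH hs).
  by rewrite exprSr invfM mulrA.
pose B := M * expR (2 * K * 2).
have Bs s : 0 <= s <= 3 / 2 -> expR (2 * K * s) <= expR (2 * K * 2).
  move=> /andP[s0 s1]; rewrite ler_expR ler_wpM2l//; last by lra.
  by rewrite mulr_ge0// ltW.
have stepB s j : `|f_ j.+1 s - f_ j s| <= B / 2 ^+ j.
  rewrite fclamp [f_ j s]fclamp; apply: le_trans (step j _ (clamp_itv s)) _.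
  rewrite /B mulrAC ler_wpM2r ?invr_ge0 ?exprn_ge0// ler_wpM2l// Bs//.
  exact: clamp_itv.
have /choice[f hf] : forall s, exists l, forall j, `|f_ j s - l| <= 2 * B / 2 ^+ j.
  by move=> s; exact: (@geometric_limit _ (f_ ^~ s) B (stepB s)).
have B0 : 0 <= B by rewrite mulr_ge0// expR_ge0.
have cfl : continuous f.
  move=> s; apply/cont_epsP => e e0.
  have [j hj] : exists j, 2 * B / 2 ^+ j < e / 3.
    have e3 : 0 < e / 3 by rewrite divr_gt0.
    have := archi_boundP (divr_ge0 (mulr_ge0 (ler0n _ 2) B0) (ltW e3)).
    set j := Num.bound _ => hj; exists j.
    rewrite ltr_pdivrMr ?exprn_gt0// (mulrC (e / 3)) -ltr_pdivrMr//.
    exact: lt_trans hj (ltn_expr2 j).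
  have /cont_epsP/(_ (e / 3))[|d d0 hd] := cf j s; first exact: divr_gt0.
  exists d => // x xs; have := hd x xs; have := hf s j; have := hf x j.
  rewrite !ler_norml !ltr_norml => /andP[? ?] /andP[? ?] /andP[? ?].
  by apply/andP; split; lra.
have fix_f s : 0 <= s <= 3 / 2 -> f s = picard f s.
  move=> hs; apply/eqP; rewrite -subr_eq0; apply/eqP.
  apply: (@eq0_of_geometric _ _ (B + B * expR (2 * K * 2))) => j.
  have h1 := hf s j.+1.
  have h2 : `|picard (f_ j) s - picard f s| <=
      2 * B / 2 ^+ j / 2 * expR (2 * K * s).
    apply: contracting => // x /andP[x0 x1]; apply: le_trans (hf x j) _.
    rewrite ler_peMr ?divr_ge0 ?exprn_ge0 ?mulr_ge0// -expR0 ler_expR.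
    by rewrite !mulr_ge0// ltW.
  have h3 : 2 * B / 2 ^+ j / 2 * expR (2 * K * s) <= B * expR (2 * K * 2) / 2 ^+ j.
    rewrite (_ : 2 * B / 2 ^+ j / 2 = B / 2 ^+ j); last first.
      by field; rewrite expf_neq0.
    by rewrite mulrAC ler_wpM2r ?invr_ge0 ?exprn_ge0// ler_wpM2l// Bs.
  have h4 : 2 * B / 2 ^+ j.+1 = B / 2 ^+ j.
    by rewrite exprS; field; rewrite expf_neq0.
  have : `|f s - picard f s| <= `|f_ j.+1 s - f s| + `|picard (f_ j) s - picard f s|.
    by rewrite [`|f_ j.+1 s - _|]distrC -[X in `|X| <= _](subrKA (f_ j.+1 s)) ler_normD.
  rewrite (mulrDl B) -h4; move: h1 h2 h3.
  set u := `|f_ j.+1 s - _|; set v := `|picard (f_ j) s - _|; set w := `|f s - _|.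
  lra.
exists f, (resolvent n (source f)); split; last first.
  have h0 : 0 <= (0 : R) <= 3 / 2 by apply/andP; split; lra.
  by rewrite fix_f// /picard clampE// primitive0 addr0.
split=> //; first exact: cresolvent.
- move=> s /andP[s0 s1]; apply: (@dfun_near _ (fun x => a + primitive (resolvent n (source f)) x)).
    apply: filterS2 (near_gt s0) (near_lt s1) => x x0 x1.
    have hx : 0 <= x <= 3 / 2 by rewrite (ltW x0) (ltW x1).
    by rewrite fix_f// /picard clampE.
  by have := is_derive_primitive s (cresolvent cfl) => ?; der_to; ring.
- by move=> s hs; apply: is_derive_resolvent => //; exact: csource.
Qed.

End PicardIteration.
End SingularIVP.

(** * Flux identities and stability *)

Section Flux.
Context {R : realType} (n : nat) (hn : (2 <= n)%N).
Implicit Types (f g h y z N : R -> R) (s : R).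

Let n0 : 0 < n%:R :> R. Proof. by rewrite ltr0n (ltn_trans _ hn). Qed.

(** Its n-th power is the density of the zonal Laplacian: the equation is
    the balance law (weight^n g')' = - weight^(n - 2) N (g). *)
Definition weight s : R := Num.sqrt (s * (2 - s)).

Lemma weight_gt0 s : 0 < s < 2 -> 0 < weight s.
Proof. by move=> /andP[? ?]; rewrite sqrtr_gt0 mulr_gt0// subr_gt0. Qed.

Lemma weight_sqr s : 0 < s < 2 -> weight s ^+ 2 = s * (2 - s).
Proof. by move=> /andP[? ?]; rewrite sqr_sqrtr// mulr_ge0 ?ltW// subr_gt0. Qed.

Lemma weight_cont s : continuous_at s weight.
Proof. by apply: cfun_comp; [exact: sqrt_continuous|cont]. Qed.

Lemma is_derive_weight s : 0 < s < 2 ->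
  is_derive s 1 weight ((1 - s) / weight s).
Proof.
move=> hs; have w0 := weight_gt0 hs; have /andP[s0 s2] := hs.
have := @dfun_compR R Num.sqrt (fun x => x * (2 - x)) s
  (2 * Num.sqrt (s * (2 - s)))^-1 (2 * (1 - s)) _ _ => H.
apply: dfun_eq; first apply: H.
- by apply: is_derive1_sqrt; rewrite mulr_gt0// subr_gt0.
- by der_to; ring.
- by rewrite -/(weight s); field; rewrite gt_eqF.
Qed.

Lemma is_derive_flux z h s : 0 < s < 2 ->
  is_derive s 1 z ((h s - n%:R * (1 - s) * z s) / (s * (2 - s))) ->
  is_derive s 1 (fun x => weight x ^+ n * z x) (weight s ^+ n.-2 * h s).
Proof.
move=> hs dz; have w0 := weight_gt0 hs; have dw := is_derive_weight hs.
have w1 : weight s != 0 by rewrite gt_eqF.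
der_to; rewrite -weight_sqr//; move: w1; set w := weight s => w1.
case: n hn => [//|[//|k]] _ /=; rewrite !exprS; field.
by rewrite w1 /= ?expf_neq0.
Qed.

(** The flux vanishes at the pole, so that Cauchy's mean value theorem against
    s^(n/2) expresses y without the singular factor. *)
Lemma flux_mean z h s : continuous z ->
  (forall x : R, 0 < x < 3 / 2 ->
    is_derive x 1 z ((h x - n%:R * (1 - x) * z x) / (x * (2 - x)))) ->
  0 < s < 3 / 2 ->
  exists2 x, 0 < x < s &
    Num.sqrt (2 - s) ^+ n * z s = 2 / n%:R * (Num.sqrt (2 - x) ^+ n.-2 * h x).
Proof.
move=> cz dz /andP[s0 s1].
have i2 (x : R) : 0 < x < s -> 0 < x < 2 by lra.
have cf (x : R) : 0 <= x <= s -> continuous_at x (fun x => weight x ^+ n * z x).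
  by move=> _; move: (cz x) (@weight_cont x) => ? ?; cont.
have cg (x : R) : 0 <= x <= s -> continuous_at x (fun x => Num.sqrt x ^+ n).
  by move=> _; move: (@sqrt_continuous R x) => ?; cont.
have df (x : R) : 0 < x < s ->
    is_derive x 1 (fun x => weight x ^+ n * z x) (weight x ^+ n.-2 * h x).
  by move=> hx; apply: is_derive_flux; [exact: i2|apply: dz; lra].
have dg (x : R) : 0 < x < s ->
    is_derive x 1 (fun x => Num.sqrt x ^+ n) (n%:R / 2 * Num.sqrt x ^+ n.-2).
  by move=> /andP[x0 _]; exact: is_derive_sqrtX.
have g0 (x : R) : 0 < x < s -> n%:R / 2 * Num.sqrt x ^+ n.-2 != 0.
  move=> /andP[x0 _]; rewrite mulf_neq0 ?expf_neq0 ?gt_eqF ?sqrtr_gt0//.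
  by rewrite divr_gt0.
have [x /andP[x0 xs]] := cauchy_mean_value s0 cf cg df dg g0.
have en : (0 : R) ^+ n = 0 by rewrite expr0n; case: eqP hn => [->|].
rewrite /weight mul0r sqrtr0 en mul0r !subr0 !sqrtrM ?ltW// !exprMn => E.
exists x; first by rewrite x0.
have r1 : Num.sqrt s ^+ n != 0 by rewrite expf_neq0// gt_eqF ?sqrtr_gt0.
have r2 : Num.sqrt x ^+ n.-2 != 0 by rewrite expf_neq0// gt_eqF ?sqrtr_gt0.
move: E => /(congr1 (fun u => u * Num.sqrt s ^+ n)); rewrite (divfK r1) => E.
apply: (mulfI r1); rewrite mulrA -E.
by field; rewrite r2 gt_eqF.
Qed.

Lemma flux_le z h s B : continuous z ->
  (forall x : R, 0 < x < 3 / 2 ->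
    is_derive x 1 z ((h x - n%:R * (1 - x) * z x) / (x * (2 - x)))) ->
  0 < s < 3 / 2 -> (forall x, 0 < x < s -> `|h x| <= B) ->
  `|z s| <= fluxC n * B.
Proof.
move=> cz dz hs hB; have [x hx E] := flux_mean cz dz hs.
have /andP[s0 s1] := hs; have /andP[x0 xs] := hx.
have r0 : 0 < Num.sqrt (2 - s) ^+ n by rewrite exprn_gt0// sqrtr_gt0; lra.
have /andP[w0 w1] := weight_bound (R := R) hn (ltW s0) (ltW x0).
rewrite !gapE in w0 w1; try lra.
have -> : z s = (Num.sqrt (2 - s) ^+ n)^-1 *
    (2 / n%:R * Num.sqrt (2 - x) ^+ n.-2) * h x.
  have r1 := lt0r_neq0 r0; apply: (mulfI r1); rewrite E !mulrA mulfV// mul1r//.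
by rewrite normrM (ger0_norm w0) ler_pM// hB.
Qed.

(** Stability of the singular Cauchy problem: at a maximum of
    e^(- 2 K s) |g1 - g2| the growth estimate absorbs half of the maximum. *)
Lemma radial_stability (L : R) : 0 < L -> exists2 C : R, 0 < C &
  forall N1 N2 g1 y1 g2 y2 (c : R), lipschitz_with L N1 ->
    radial_sol n N1 g1 y1 -> radial_sol n N2 g2 y2 ->
    (forall s, 0 <= s <= 3 / 2 -> `|N1 (g2 s) - N2 (g2 s)| <= c) ->
    forall s, 0 <= s < 3 / 2 ->
      `|g1 s - g2 s| <= C * (`|g1 0 - g2 0| + c) /\
      `|y1 s - y2 s| <= C * (`|g1 0 - g2 0| + c).
Proof.
move=> L0; pose K : R := fluxC n * L; have F0 := @fluxC_gt0 R n hn.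
have K0 : 0 < K by rewrite mulr_gt0.
pose E := expR (2 * K * 2); have E1 : 1 <= E.
  by rewrite -expR0 ler_expR !mulr_ge0// ltW.
have E0 : 0 < E := lt_le_trans ltr01 E1.
pose A : R := 2 * (1 + 2 * fluxC n).
have A0 : 0 < A by rewrite /A; lra.
exists (A * E * (1 + K) + fluxC n).
  by rewrite addr_gt0// !mulr_gt0//; lra.
move=> N1 N2 g1 y1 g2 y2 c lN [cg1 cy1 dg1 dy1] [cg2 cy2 dg2 dy2] hc.
have c0 : 0 <= c by apply: le_trans (hc 0 _); rewrite ?normr_ge0//; lra.
pose e s := g1 s - g2 s; pose z s := y1 s - y2 s.
have ce : continuous e.
  by move=> x; move: (cg1 x) (cg2 x) => ? ?; rewrite /e; cont.
have cz : continuous z.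
  by move=> x; move: (cy1 x) (cy2 x) => ? ?; rewrite /z; cont.
have de s : 0 < s < 3 / 2 -> is_derive s 1 e (z s).
  by move=> hs; move: (dg1 s hs) (dg2 s hs) => ? ?; rewrite /e; der.
pose h s := - N1 (g1 s) + N2 (g2 s).
have dz s : 0 < s < 3 / 2 ->
    is_derive s 1 z ((h s - n%:R * (1 - s) * z s) / (s * (2 - s))).
  move=> hs; move: (dy1 s hs) (dy2 s hs) => ? ?; rewrite /z /h; der_to.
  by field; apply/andP; split; rewrite gt_eqF//; lra.
have hh s : 0 <= s <= 3 / 2 -> `|h s| <= L * `|e s| + c.
  move=> hs; rewrite /h (_ : - N1 (g1 s) + N2 (g2 s) =
    - (N1 (g1 s) - N1 (g2 s) + (N1 (g2 s) - N2 (g2 s)))); last by ring.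
  rewrite normrN; apply: le_trans (ler_normD _ _) _; apply: lerD; last exact: hc.
  exact: lN.
pose q s := expR (- (2 * K) * s) * `|e s|.
have cq : continuous q.
  move=> x; rewrite /q; apply: cfunM.
    exact: is_derive_cont (is_derive_expRM _ _).
  by apply: cfun_comp; [exact: norm_continuous|exact: ce].
have s32 : 0 <= (3 / 2 : R) by lra.
have [t ht hmax] := EVT_max s32 (@cont_within _ q _ _ (fun x _ => cq x)).
rewrite in_itv /= in ht.
pose M := q t; have M0 : 0 <= M by rewrite mulr_ge0// expR_ge0.
have qE s : expR (2 * K * s) * q s = `|e s|.
  by rewrite /q mulrA -expRD mulNr subrr expR0 mul1r.
have eM s : 0 <= s <= 3 / 2 -> `|e s| <= M * expR (2 * K * s).
  move=> hs; rewrite -qE mulrC ler_wpM2r ?expR_ge0//; apply: hmax.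
  by rewrite in_itv.
have zM s : 0 < s < 3 / 2 -> `|z s| <= K * M * expR (2 * K * s) + fluxC n * c.
  move=> hs; rewrite (_ : _ + _ = fluxC n * (L * (M * expR (2 * K * s)) + c)).
    apply: (flux_le cz dz hs) => x hx; apply: le_trans (hh x _) _; first by lra.
    rewrite lerD2r ler_wpM2l ?(ltW L0)//; apply: le_trans (eM x _) _; first by lra.
    by rewrite ler_wpM2l// ler_expR ler_wpM2l ?mulr_ge0 ?(ltW K0)//; lra.
  by rewrite /K; ring.
have MA : M <= A * (`|e 0| + c).
  have /andP[t0 t1] := ht.
  have := exp_growth K0 (fun x _ => ce x) (P := e) (D := z) (M := M)
    (c := fluxC n * c) (r := t).
  move=> /(_ _ _ t0)G; have {G} : `|e t - e 0| <=
      M / 2 * (expR (2 * K * t) - 1) + fluxC n * c * t.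
    by apply: G => x hx; [apply: de|apply: zM]; lra.
  rewrite mulrBr mulr1 => G.
  have h1 : `|e t| <= `|e t - e 0| + `|e 0|.
    by rewrite -[X in `|X| <= _](subrK (e 0)) ler_normD.
  have h2 : `|e t| = M * expR (2 * K * t) by rewrite -qE mulrC.
  have h3 : fluxC n * c * t <= fluxC n * c * 2.
    by rewrite ler_wpM2l ?mulr_ge0 ?(ltW F0)//; lra.
  have h4 : M <= M * expR (2 * K * t).
    by rewrite ler_peMr// -expR0 ler_expR !mulr_ge0// ltW.
  have h5 : 0 <= fluxC n * `|e 0| by rewrite mulr_ge0// ltW.
  rewrite /A; have h6 := normr_ge0 (e 0).
  rewrite (_ : 2 * _ * _ = 2 * `|e 0| + 2 * c
    + 4 * (fluxC n * `|e 0|) + 4 * (fluxC n * c)); last by ring.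
  by lra.
have EE s : 0 <= s <= 3 / 2 -> expR (2 * K * s) <= E.
  by move=> hs; rewrite ler_expR ler_wpM2l ?mulr_ge0 ?(ltW K0)//; lra.
set d := `|g1 0 - g2 0| + c; have dE : `|e 0| + c = d by [].
have d0 : 0 <= d by rewrite addr_ge0.
have cd : c <= d by rewrite lerDr.
have ME : M * E <= A * E * d.
  by rewrite (_ : A * E * d = A * d * E); [rewrite ler_pM2r// -dE|ring].
have AEd : 0 <= A * E * d by apply: mulr_ge0 => //; apply: mulr_ge0; exact: ltW.
have Kd : 0 <= K * (A * E * d) by rewrite mulr_ge0// ltW.
have Fd : fluxC n * c <= fluxC n * d by rewrite ler_wpM2l// ltW.
have Fd0 : 0 <= fluxC n * d by rewrite mulr_ge0// ltW.
have CE : (A * E * (1 + K) + fluxC n) * d =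
  A * E * d + K * (A * E * d) + fluxC n * d by ring.
have gb s : 0 <= s <= 3 / 2 -> `|g1 s - g2 s| <= (A * E * (1 + K) + fluxC n) * d.
  move=> hs; rewrite CE; have h1 := eM s hs.
  have h2 : M * expR (2 * K * s) <= M * E by rewrite ler_wpM2l// EE.
  by rewrite -/(e s); lra.
have zb s : 0 < s < 3 / 2 -> `|z s| <= (A * E * (1 + K) + fluxC n) * d.
  move=> hs; rewrite CE; have h1 := zM s hs.
  have h2 : K * (M * expR (2 * K * s)) <= K * (A * E * d).
    rewrite ler_wpM2l ?(ltW K0)//; apply: le_trans ME.
    by rewrite ler_wpM2l// EE//; lra.
  by move: h1 h2; rewrite mulrA; lra.
move=> s /andP[]; rewrite le_eqVlt => /predU1P[<-|s0] s1; split.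
- by apply: gb; lra.
- by apply: (le_cont_right (g := z) (r := 3 / 2)) => //; lra.
- by apply: gb; lra.
- by apply: zb; rewrite s0.
Qed.

End Flux.

(** * Regularity at the pole *)

Section Pole.
Context {R : realType} (n : nat) (hn : (2 <= n)%N).
Implicit Types (f g h y z N : R -> R) (s t : R).

Lemma cont_glue (w v u : R -> R) (r : R) : 0 < r ->
  continuous_at 0 u -> continuous_at 0 v -> v 0 = u 0 ->
  (forall s, 0 < s < r -> exists2 x, 0 <= x <= s & w s = u x) ->
  continuous_at 0 (fun s => if 0 < s then w s else v s).
Proof.
move=> r0 cu cv uv h; apply/cont_epsP => e e0.
have /cont_epsP/(_ e e0)[d d0 hd] := cu.
have /cont_epsP/(_ e e0)[d' d'0 hd'] := cv.
exists (Num.min r (Num.min d d')); first by rewrite !lt_min r0 d0.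
move=> s; rewrite subr0 ltxx !lt_min => /and3P[sr sd sd'].
case: ifP => s0; last by apply: hd'; rewrite subr0.
have [|x /andP[x0 xs] ->] := h s.
  by rewrite s0 /=; move: sr; rewrite gtr0_norm.
rewrite uv; apply: hd; rewrite subr0 ger0_norm//.
by apply: le_lt_trans xs _; move: sd; rewrite gtr0_norm.
Qed.

Section Profile.
Variables (N g y dN : R -> R) (r : R).
Hypotheses (sol : radial_sol n N g y) (cN : continuous N) (r0 : 0 < r <= 1).
Hypotheses (dNg : forall s, 0 < s < r -> is_derive s 1 (fun x => N (g x)) (dN s))
           (cdN : continuous_at 0 dN).

Let k s := - N (g s) - n%:R * (1 - s) * y s.
Let H s := - dN s + n%:R * y s.
Let u s : R := H s / ((n%:R + 2) * (1 - s)).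

Let cg : continuous g. Proof. by case: sol. Qed.
Let cy : continuous y. Proof. by case: sol. Qed.

Let ck : continuous k.
Proof.
move=> s; move: (@cg s) (@cy s) => ? ?.
have ? : continuous_at s (fun x => N (g x)) by apply: cfun_comp; [exact: cN|].
by rewrite /k; cont.
Qed.

(** The defect k of the equation at first order solves the same kind of flux
    equation, with source s (2 - s) H; Cauchy's mean value theorem against
    the flux of s (2 - s) then gives its rate of vanishing. *)
Let defect_mean s : 0 < s < r ->
  exists2 x, 0 < x < s & k s / (s * (2 - s)) = u x.
Proof.
move=> /andP[s0 sr]; have [_ _ dg dy] := sol.
have /andP[_ r1] := r0.
pose W x : R := weight x ^+ n.
have cf (x : R) : 0 <= x <= s -> continuous_at x (fun x => W x * k x).
  by move=> _; move: (@ck x) (@weight_cont R x) => ? ?; rewrite /W; cont.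
have cG (x : R) : 0 <= x <= s -> continuous_at x (fun x => W x * (x * (2 - x))).
  by move=> _; move: (@weight_cont R x) => ?; rewrite /W; cont.
have df (x : R) : 0 < x < s -> is_derive x 1 (fun x => W x * k x)
    (weight x ^+ n.-2 * (x * (2 - x) * H x)).
  move=> hx; apply: (@is_derive_flux R n hn k (fun x => x * (2 - x) * H x)).
    by lra.
  have h1 : 0 < x < 3 / 2 by lra.
  have h2 : 0 < x < r by lra.
  move: (dg x h1) (dy x h1) (dNg h2) => ? ? ?; rewrite /k /H; der_to.
  by field; apply/andP; split; rewrite gt_eqF//; lra.
have dG (x : R) : 0 < x < s -> is_derive x 1 (fun x => W x * (x * (2 - x)))
    (weight x ^+ n.-2 * (x * (2 - x) * ((n%:R + 2) * (1 - x)))).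
  move=> hx; apply: (@is_derive_flux R n hn (fun x => x * (2 - x))
    (fun x => x * (2 - x) * ((n%:R + 2) * (1 - x)))).
    by lra.
  der_to; field; apply/andP; split; rewrite gt_eqF//; lra.
have w0 (x : R) : 0 < x < s -> weight x != 0.
  by move=> hx; rewrite gt_eqF// weight_gt0//; lra.
have np : n%:R + 2 != 0 :> R by rewrite gt_eqF// ltr_wpDl.
have G0 (x : R) : 0 < x < s ->
    weight x ^+ n.-2 * (x * (2 - x) * ((n%:R + 2) * (1 - x))) != 0.
  by move=> hx; rewrite !mulf_neq0 ?expf_neq0 ?w0// gt_eqF//; lra.
have [x hx] := cauchy_mean_value s0 cf cG df dG G0.
have en : W 0 = 0.
  by rewrite /W /weight mul0r sqrtr0 expr0n; case: eqP hn => [->|].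
rewrite en !mul0r !subr0 => E; exists x => //.
have Ws : W s != 0.
  by rewrite expf_neq0// gt_eqF// weight_gt0//; apply/andP; split; lra.
rewrite (_ : k s / _ = W s * k s / (W s * (s * (2 - s)))); last first.
  by field; rewrite Ws /=; apply/andP; split; rewrite gt_eqF//; lra.
rewrite -E /u; have := w0 x hx => wx.
by field; rewrite np expf_neq0//=; apply/and3P; split; rewrite gt_eqF//; lra.
Qed.

Let cu : continuous_at 0 u.
Proof.
have np : n%:R + 2 != 0 :> R by rewrite gt_eqF// ltr_wpDl.
rewrite /u /H; move: cdN (@cy 0) => ? ?; cont.
by rewrite subr0 mulr1.
Qed.

(* The solution is extended past the pole by its Taylor polynomial of degree
   2, so that it becomes twice differentiable at s = 0. *)
Let z0 : R := u 0.
Let zt s : R := if 0 < s then k s / (s * (2 - s)) else z0.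
Let yt s := if 0 < s then y s else y 0 + z0 * s.
Let gt s := if 0 < s then g s else g 0 + y 0 * s + z0 / 2 * s ^+ 2.

Let zt_cont s : s < 3 / 2 -> continuous_at s zt.
Proof.
move=> s1; case: (ltgtP 0 s) => s0.
- have c : continuous_at s (fun x => k x / (x * (2 - x))).
    move: (@ck s) => ?; cont; rewrite mulf_neq0 ?gt_eqF//; lra.
  rewrite /continuous_at [X in _ --> X](_ : _ = k s / (s * (2 - s))); last by rewrite /zt s0.
  apply: cvg_trans c; apply: near_eq_cvg.
  by apply: filterS (near_gt s0) => x x0; rewrite /zt x0.
- rewrite /continuous_at {2}/zt ltNge (ltW s0) /=.
  apply: cvg_near_cst; apply: filterS (near_lt s0) => x x0.
  by rewrite /zt ltNge (ltW x0).
- rewrite -s0; have /andP[r00 _] := r0.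
  apply: (cont_glue r00 cu (v := fun=> z0)) => //; first exact: cfun_cst.
  move=> x hx; have [x' /andP[? ?] E] := defect_mean hx.
  by exists x' => //; rewrite !ltW.
Qed.

Let glue0 (w v : R -> R) : continuous w -> continuous_at 0 v -> v 0 = w 0 ->
  continuous_at 0 (fun s => if 0 < s then w s else v s).
Proof.
move=> cw cv vw; apply: (cont_glue ltr01 (cw 0) cv vw) => s /andP[s0 _].
by exists s; rewrite ?lexx ?ltW.
Qed.

Let yt_deriv s : s < 3 / 2 -> is_derive s 1 yt (zt s).
Proof.
have [_ _ dg dy] := sol.
have nz (x : R) : x < 3 / 2 -> x != 0 -> is_derive x 1 yt (zt x).
  move=> x1; case: ltgtP => // x0 _.
    rewrite /zt ltNge (ltW x0) /=; apply: (@dfun_near _ (fun x => y 0 + z0 * x)).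
      by apply: filterS (near_lt x0) => x' x'0; rewrite /yt ltNge (ltW x'0).
    by der_to; ring.
  rewrite /zt x0; apply: (@dfun_near _ y).
    by apply: filterS (near_gt x0) => x' x'0; rewrite /yt x'0.
  by apply: dy; rewrite x0.
move=> s1; have [->|] := eqVneq s 0; last exact: nz.
apply: (@is_derive_removable _ _ _ _ 1) => //; last first.
- by move=> x; rewrite subr0 => /ltr_normlP[_ x1] /nz; apply; lra.
- by apply: zt_cont; lra.
- by apply: glue0 => //; [cont|rewrite mulr0 addr0].
Qed.

Let gt_deriv s : s < 3 / 2 -> is_derive s 1 gt (yt s).
Proof.
have [_ _ dg dy] := sol.
have nz (x : R) : x < 3 / 2 -> x != 0 -> is_derive x 1 gt (yt x).
  move=> x1; case: ltgtP => // x0 _.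
    rewrite /yt ltNge (ltW x0) /=.
    apply: (@dfun_near _ (fun x => g 0 + y 0 * x + z0 / 2 * x ^+ 2)).
      by apply: filterS (near_lt x0) => x' x'0; rewrite /gt ltNge (ltW x'0).
    by der_to; rewrite /=; field.
  rewrite /yt x0; apply: (@dfun_near _ g).
    by apply: filterS (near_gt x0) => x' x'0; rewrite /gt x'0.
  by apply: dg; rewrite x0.
move=> s1; have [->|] := eqVneq s 0; last exact: nz.
apply: (@is_derive_removable _ _ _ _ 1) => //; last first.
- by move=> x; rewrite subr0 => /ltr_normlP[_ x1] /nz; apply; lra.
- by apply: is_derive_cont (yt_deriv _); lra.
- by apply: glue0 => //; [cont|rewrite expr0n !mulr0 !addr0].
Qed.

(* The equation at the pole itself, where it only holds in the limit. *)
Let pole_eq : k 0 = 0.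
Proof.
have /andP[r00 r1] := r0.
suff : `|k 0 - 0 * (2 - 0) * zt 0| <= 0.
  by rewrite normr_le0 !mul0r subr0 => /eqP.
apply: (@le_cont_right R (fun s => k s - s * (2 - s) * zt s) 0 r) => //.
  have ? : continuous_at 0 zt by apply: zt_cont; lra.
  by move: (@ck 0) => ?; cont.
move=> x /andP[x0 xr]; rewrite /zt x0 mulrC divfK ?subrr ?normr0//.
by rewrite mulf_neq0// gt_eqF//; lra.
Qed.

(** Reflecting across the equator: if g'(1) = 0, the even extension
    t |-> g (1 - |t|) is a C^2 zonal solution on the whole sphere. *)
Lemma zonal_profile : y 1 = 0 -> exists f f1 f2 : R -> R,
  [/\ forall t, is_derive t 1 f (f1 t), forall t, is_derive t 1 f1 (f2 t),
      continuous f2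
    & forall t, `|t| <= 1 -> f t = g (1 - `|t|) /\
      (1 - t ^+ 2) * f2 t - n%:R * t * f1 t + N (f t) = 0].
Proof.
move=> y1.
pose f t := gt (1 - `|t|); pose f1 t := - Num.sg t * yt (1 - `|t|).
pose f2 t := zt (1 - `|t|).
have lt32 t : 1 - `|t| < 3 / 2 by have := normr_ge0 t; lra.
have cabs t : continuous_at t (fun t => 1 - `|t|).
  by apply: cfunB; [exact: cfun_cst|exact: norm_continuous].
have cf : continuous f.
  by move=> t; apply: cfun_comp (cabs t); exact: is_derive_cont (gt_deriv (lt32 t)).
have cf2 : continuous f2.
  by move=> t; apply: cfun_comp (cabs t); exact: zt_cont (lt32 t).
have yt1 : yt 1 = 0 by rewrite /yt ltr01.
have cf1 : continuous_at 0 f1.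
  have c : continuous_at 0 (fun t => yt (1 - `|t|)).
    by apply: cfun_comp (cabs 0); exact: is_derive_cont (yt_deriv (lt32 0)).
  move/cont_epsP: c => c; apply/cont_epsP => e e0.
  have [d d0 hd] := c e e0; exists d => // t /hd.
  rewrite /f1 normr0 subr0 sgr0 oppr0 mul0r yt1 !subr0 normrM normrN.
  rewrite normr_sg; case: eqP => _; last by rewrite mul1r.
  by rewrite mul0r.
have dlin (c t : R) : is_derive t 1 (fun x => 1 + c * x) c by der_to; ring.
have nearpos (h : R -> R) t : 0 < t ->
    \forall x \near t, h (1 + (- 1) * x) = h (1 - `|x|).
  move=> t0; apply: filterS (near_gt t0) => x x0.
  by rewrite gtr0_norm// mulN1r.
have nearneg (h : R -> R) t : t < 0 ->
    \forall x \near t, h (1 + 1 * x) = h (1 - `|x|).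
  move=> t0; apply: filterS (near_lt t0) => x x0.
  by rewrite ltr0_norm// mul1r opprK.
have df0 t : t != 0 -> is_derive t 1 f (f1 t).
  have := lt32 t; move=> ts; rewrite /f1; case: (ltgtP t 0) => // t0 _.
    apply: (@dfun_near _ (fun x => gt (1 + 1 * x)) _ _ _ (nearneg gt t t0)).
    rewrite ltr0_sg// opprK mul1r ltr0_norm// opprK -[yt _]mulr1.
    refine (@dfun_compR R gt (fun x => 1 + 1 * x) t _ _ _ (dlin 1 t)).
    by rewrite mul1r; apply: gt_deriv; lra.
  apply: (@dfun_near _ (fun x => gt (1 + (- 1) * x)) _ _ _ (nearpos gt t t0)).
  rewrite gtr0_sg// mulrC gtr0_norm//.
  refine (@dfun_compR R gt (fun x => 1 + (- 1) * x) t _ _ _ (dlin (- 1) t)).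
  by rewrite mulN1r; apply: gt_deriv; lra.
have df10 t : t != 0 -> is_derive t 1 f1 (f2 t).
  have := lt32 t; move=> ts; rewrite /f2; case: (ltgtP t 0) => // t0 _.
    apply: (@dfun_near _ (fun x => yt (1 + 1 * x))).
      apply: filterS (near_lt t0) => x x0.
      by rewrite /f1 ltr0_sg// ltr0_norm// !opprK !mul1r.
    rewrite ltr0_norm// opprK -[zt _]mulr1.
    refine (@dfun_compR R yt (fun x => 1 + 1 * x) t _ _ _ (dlin 1 t)).
    by rewrite mul1r; apply: yt_deriv; lra.
  apply: (@dfun_near _ (fun x => - yt (1 + (- 1) * x))).
    apply: filterS (near_gt t0) => x x0.
    by rewrite /f1 gtr0_sg// gtr0_norm// !mulN1r.
  rewrite gtr0_norm// (_ : zt (1 - t) = - (zt (1 + (- 1) * t) * (- 1))).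
    refine (dfunN (@dfun_compR R yt (fun x => 1 + (- 1) * x) t _ _ _ (dlin (- 1) t))).
    by apply: yt_deriv; lra.
  by rewrite mulN1r mulrN1 opprK.
have df t : is_derive t 1 f (f1 t).
  have [->|] := eqVneq t 0; last exact: df0.
  by apply: (@is_derive_removable _ _ _ _ 1) => // x _; exact: df0.
have df1 t : is_derive t 1 f1 (f2 t).
  have [->|] := eqVneq t 0; last exact: df10.
  by apply: (@is_derive_removable _ _ _ _ 1) => // x _; exact: df10.
exists f, f1, f2; split=> // t t1.
have tf1 : t * f1 t = - `|t| * yt (1 - `|t|).
  by rewrite /f1 mulrA mulrN [t * _]mulrC -normrEsg.
have ft : f t = g (1 - `|t|).
  rewrite /f /gt; case: ifPn => //; rewrite -leNgt => h.
  have -> : 1 - `|t| = 0 by apply/eqP; rewrite eq_le h subr_ge0.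
  by rewrite expr0n !mulr0 !addr0.
split=> //; rewrite -mulrA tf1 ft -real_normK ?num_real// /f2.
have := lt32 t; set s := 1 - `|t|; have -> : `|t| = 1 - s by rewrite /s; ring.
move=> s32; have s0 : 0 <= s by rewrite subr_ge0.
move: s0; rewrite le_eqVlt => /predU1P[s0|s0].
  rewrite -s0 /yt /zt ltxx; move: pole_eq; rewrite /k subr0 => E.
  by rewrite mulr0 addr0 expr1n subrr mul0r sub0r; lra.
rewrite /yt /zt s0 /k; field.
by apply/andP; split; rewrite gt_eqF//; lra.
Qed.

End Profile.
End Pole.

(** * The phase angle *)

Section RealLine.
Context {R : realType}.
Implicit Types (f : R -> R).

Lemma first_zero f (a b : R) : a < b -> continuous f -> 0 < f a -> f b <= 0 ->
  exists c, [/\ a < c <= b, f c = 0 & forall x, a <= x < c -> 0 < f x].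
Proof.
move=> ab cf fa fb.
pose A := [set x | a <= x <= b /\ f x <= 0].
have Ab : A b by split; rewrite ?lexx ?(ltW ab).
have lbA : has_lbound A by exists a => x [/andP[]].
have hA : has_inf A by split; [exists b|].
pose c := inf A.
have ac : a <= c by apply: lb_le_inf; [exists b|move=> x [/andP[]]].
have cb : c <= b by apply: ge_inf.
have below x : a <= x < c -> 0 < f x.
  move=> /andP[ax xc]; rewrite ltNge; apply/negP => fx.
  have : c <= x by apply: ge_inf => //; split=> //; rewrite ax (le_trans (ltW xc)).
  by rewrite leNgt xc.
have fc0 : f c <= 0.
  rewrite leNgt; apply/negP => fc.
  have /cont_epsP/(_ _ fc)[d d0 hd] := cf c.
  have [x [/andP[ax xb] fx] xcd] := inf_adherent d0 hA.
  have cx : c <= x by apply: ge_inf => //; split=> //; rewrite ax.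
  have := hd x; rewrite ger0_norm ?subr_ge0// ltrBlDl => /(_ xcd).
  by rewrite ltr_norml => /andP[]; lra.
have ac' : a < c.
  by rewrite lt_neqAle ac andbT; apply/eqP => e; move: fc0; rewrite -e leNgt fa.
have fc1 : 0 <= f c.
  rewrite leNgt; apply/negP => fc.
  have fcN : 0 < - f c by rewrite oppr_gt0.
  have /cont_epsP/(_ _ fcN)[d d0 hd] := cf c.
  pose x := c - Num.min (d / 2) ((c - a) / 2).
  have m0 : 0 < Num.min (d / 2) ((c - a) / 2).
    by rewrite lt_min !divr_gt0// subr_gt0.
  have m1 : Num.min (d / 2) ((c - a) / 2) <= d / 2 by rewrite ge_min lexx.
  have m2 : Num.min (d / 2) ((c - a) / 2) <= (c - a) / 2 by rewrite ge_min lexx orbT.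
  have : 0 < f x by apply: below; rewrite /x; lra.
  have := hd x; rewrite ltr0_norm; last by rewrite /x; lra.
  move=> /(_ _)H; have {H} : `|f x - f c| < - f c by apply: H; rewrite /x; lra.
  by rewrite ltr_norml => /andP[]; lra.
exists c; split=> //; first by rewrite ac'.
by apply/eqP; rewrite eq_le fc0.
Qed.

Lemma no_zero_gt0 f (a b : R) : a <= b -> continuous f -> 0 < f a ->
  (forall x, a <= x <= b -> f x != 0) -> 0 < f b.
Proof.
rewrite le_eqVlt => /predU1P[<-//|ab] cf fa nz; rewrite ltNge; apply/negP => fb.
have [c [/andP[ac cb] fc _]] := first_zero ab cf fa fb.
by have := nz c; rewrite (ltW ac) cb fc eqxx => /(_ isT).
Qed.

(** Joint continuity is uniform along a compact fibre. *)
Lemma tube (phi : R -> R -> R) (e0 a b : R) :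
  (forall s, a <= s <= b -> continuous_at (e0, s) (fun p : R * R => phi p.1 p.2)) ->
  forall eps, 0 < eps -> exists2 d, 0 < d &
    forall e, `|e - e0| < d -> forall s, a <= s <= b -> `|phi e s - phi e0 s| < eps.
Proof.
move=> cphi eps eps0.
have cpt := @segment_compact R a b.
move/compact_near_coveringP: cpt => /(_ R (nbhs e0)
  (fun e s => `|phi e s - phi e0 s| < eps) _) [].
  move=> s; rewrite /= in_itv /= => hs.
  have e2 : 0 < eps / 2 by rewrite divr_gt0.
  have /cvgrPdist_lt/(_ _ e2)[[A B] /= [nA nB] hAB] := cphi s hs.
  exists (B, A) => //= -[s' e] /= [Bs' Ae].
  have h1 := hAB (e, s') (conj Ae Bs').
  have h2 := hAB (e0, s') (conj (nbhs_singleton nA) Bs').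
  rewrite /= in h1 h2; move: h1 h2; rewrite !ltr_norml => /andP[? ?] /andP[? ?].
  by apply/andP; split; lra.
move=> d /= d0 hd; exists d => // e ee s hs.
by apply: (hd e); rewrite /ball_ /= ?in_itv// distrC.
Qed.

End RealLine.

Section Angle.
Context {R : realType} (n : nat) (hn : (2 <= n)%N).
Implicit Types (f g h y z N : R -> R) (s t : R).

Let n0 : 0 < n%:R :> R. Proof. by rewrite ltr0n (ltn_trans _ hn). Qed.

(** Away from the pole, Gronwall's inequality for g^2 + y^2 runs backwards. *)
Lemma radial_backward_unique N g y (L s1 : R) : 0 < L ->
  radial_sol n N g y -> (forall s, `|N (g s)| <= L * `|g s|) -> 0 < s1 <= 1 ->
  g s1 = 0 -> y s1 = 0 -> forall s, 0 <= s <= s1 -> g s = 0.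
Proof.
move=> L0 [cg cy dg dy] hN /andP[s10 s11] gs1 ys1.
have pos s0 : 0 < s0 < s1 -> g s0 = 0.
  move=> /andP[s00 s01].
  pose C : R := 1 + (L + 2 * n%:R) / s0.
  pose E s := (g s ^+ 2 + y s ^+ 2) * expR (C * s).
  pose z s := (- N (g s) - n%:R * (1 - s) * y s) / (s * (2 - s)).
  have H : E s0 <= E s1.
    refine (@derive_ge0_le _ E (fun s => expR (C * s) *
      (2 * g s * y s + 2 * y s * z s + C * (g s ^+ 2 + y s ^+ 2)))
      _ _ (ltW s01) _ _ _) => s hs.
    - rewrite /E; apply: cfunM; first by move: (cg s) (cy s) => ? ?; cont.
      exact: is_derive_cont (is_derive_expRM _ _).
    - have hs' : 0 < s < 3 / 2 by lra.
      move: (dg s hs') (dy s hs') (is_derive_expRM C s) => ? ? ?.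
      by rewrite /E; der_to; rewrite /z /=; ring.
    - apply: mulr_ge0; first exact: expR_ge0.
      have /andP[hs1 hs2] := hs.
      have s2 : s0 <= s * (2 - s).
        have : 0 <= s * (1 - s) by rewrite mulr_ge0; lra.
        by lra.
      have p0 : 0 < s * (2 - s) := lt_le_trans s00 s2.
      have az : `|z s| <= (L * `|g s| + n%:R * `|y s|) / s0.
        rewrite /z normrM normfV (gtr0_norm p0).
        apply: ler_pM; [exact: normr_ge0|by rewrite invr_ge0 ltW| |];
          last by rewrite lef_pV2 ?posrE.
        apply: le_trans (ler_normB _ _) _; rewrite normrN; apply: lerD; first exact: hN.
        rewrite !normrM (gtr0_norm n0) ler_wpM2r// ler_piMr ?(ltW n0)//.
        by rewrite ger0_norm; lra.
      have b1 : - (g s ^+ 2 + y s ^+ 2) <= 2 * g s * y s.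
        by have := sqr_ge0 (g s + y s); rewrite sqrrD; lra.
      have b2 : - (2 * (`|y s| * `|z s|)) <= 2 * y s * z s.
        rewrite -normrM -[2 * y s * z s]mulrA lerNl -mulrN ler_pM2l//.
        by rewrite -normrN ler_norm.
      have b3 : `|y s| * `|z s| <= `|y s| * ((L * `|g s| + n%:R * `|y s|) / s0).
        by rewrite ler_wpM2l.
      have b4 : 2 * (`|y s| * (L * `|g s| + n%:R * `|y s|)) <=
          (L + 2 * n%:R) * (g s ^+ 2 + y s ^+ 2).
        rewrite -(real_normK (num_real (g s))) -(real_normK (num_real (y s))).
        set a := `|g s|; set b := `|y s|.
        have : 0 <= L * (a - b) ^+ 2 by rewrite mulr_ge0 ?sqr_ge0// ltW.
        have : 0 <= 2 * n%:R * a ^+ 2 by rewrite mulr_ge0 ?sqr_ge0// mulr_ge0// ltW.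
        by lra.
      have b5 : 2 * (`|y s| * ((L * `|g s| + n%:R * `|y s|) / s0)) <=
          (L + 2 * n%:R) / s0 * (g s ^+ 2 + y s ^+ 2).
        by rewrite [leLHS]mulrA [2 * _ * _]mulrA -[2 * _ * _]mulrA
          [leRHS]mulrAC ler_pM2r ?invr_gt0.
      rewrite /C mulrDl mul1r; lra.
  have E0 : E s0 <= 0 by apply: le_trans H _; rewrite /E gs1 ys1 expr0n addr0 mul0r.
  have : g s0 ^+ 2 + y s0 ^+ 2 <= 0.
    by move: E0; rewrite /E pmulr_lle0// expR_gt0.
  have := sqr_ge0 (g s0); have := sqr_ge0 (y s0) => y2 g2 gy.
  by apply/eqP; rewrite -sqrf_eq0 eq_le g2 andbT; lra.
move=> s /andP[]; rewrite le_eqVlt => /predU1P[<-|s0] ss1.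
  apply/eqP; rewrite -normr_le0; apply: (le_cont_right (cg 0) s10) => x hx.
  by rewrite pos// normr0.
move: ss1; rewrite le_eqVlt => /predU1P[->//|ss1].
by rewrite pos// s0.
Qed.

(** The curve (g, - s y) never meets the origin, hence has a phase. *)
Lemma radial_nondegenerate N g y (L : R) s : 0 < L ->
  radial_sol n N g y -> (forall s, `|N (g s)| <= L * `|g s|) -> g 0 = 1 ->
  0 <= s <= 1 -> 0 < g s ^+ 2 + (s * y s) ^+ 2.
Proof.
move=> L0 sol hN g0 /andP[s0 s1].
have a := sqr_ge0 (g s); have b := sqr_ge0 (s * y s).
rewrite lt_neqAle addr_ge0// andbT eq_sym paddr_eq0// !sqrf_eq0 mulf_eq0.
apply/negP => /andP[/eqP gs /orP[/eqP s00|/eqP ys]].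
  by move: gs; rewrite s00 g0 => /eqP; rewrite oner_eq0.
move: s0; rewrite le_eqVlt => /predU1P[e|s0].
  by move: gs; rewrite -e g0 => /eqP; rewrite oner_eq0.
have hs : 0 < s <= 1 by rewrite s0.
have := radial_backward_unique L0 sol hN hs gs ys (s := 0).
by rewrite lexx (ltW s0) g0 => /(_ isT)/eqP; rewrite oner_eq0.
Qed.

Definition unit_clamp s : R := Num.min (Num.max s 0) 1.

Lemma unit_clamp_itv s : 0 <= unit_clamp s <= 1.
Proof. by rewrite /unit_clamp le_min ge_min lexx orbT le_max lexx orbT ler01. Qed.

Lemma unit_clampE s : 0 <= s <= 1 -> unit_clamp s = s.
Proof. by move=> /andP[? ?]; rewrite /unit_clamp max_l// min_l. Qed.

Lemma unit_clamp_cont s : continuous_at s unit_clamp.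
Proof. by rewrite /unit_clamp; cont. Qed.

(** Angular velocity of the planar curve (g, - s y); the factor s makes it
    continuous up to the singular end s = 0. *)
Definition turning N g y s : R :=
  (g s * (- y s + (N (g s) + n%:R * (1 - s) * y s) / gap s) + s * y s ^+ 2)
  / (g s ^+ 2 + (s * y s) ^+ 2).

Definition angle N g y : R -> R :=
  primitive (fun s => turning N g y (unit_clamp s)).

Lemma gap_cont s : continuous_at s (@gap R).
Proof. by rewrite /gap; cont. Qed.

Section Polar.
Variables (N g y : R -> R) (L : R).
Hypotheses (L0 : 0 < L) (cN : continuous N) (sol : radial_sol n N g y).
Hypotheses (hN : forall s, `|N (g s)| <= L * `|g s|) (g0 : g 0 = 1).

Let th := angle N g y.
Let rad s := g s * cos (th s) - s * y s * sin (th s).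

Lemma turning_cont : continuous (fun s => turning N g y (unit_clamp s)).
Proof.
move=> s; have [cg cy _ _] := sol.
apply: (@cfun_comp _ _ (turning N g y)); last exact: unit_clamp_cont.
have := unit_clamp_itv s; set x := unit_clamp s => hx.
have nd := radial_nondegenerate L0 sol hN g0 hx.
have ? : continuous_at x (fun x => N (g x)) by apply: cfun_comp; [exact: cN|].
move: (cg x) (cy x) (@gap_cont x) => ? ? ?; rewrite /turning; cont.
  by rewrite gt_eqF// gap_gt0.
by rewrite gt_eqF.
Qed.

Lemma angle0 : th 0 = 0. Proof. exact: primitive0. Qed.

Lemma angle_cont : continuous th.
Proof. by move=> s; exact: (primitive_cont turning_cont). Qed.

Lemma is_derive_angle s : 0 <= s <= 1 -> is_derive s 1 th (turning N g y s).
Proof.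
by move=> hs; have := is_derive_primitive s turning_cont; rewrite unit_clampE.
Qed.

(** The component D of the curve orthogonal to the direction of the phase
    satisfies (D^2 / (g^2 + (s y)^2))' = 0, because the phase turns with the
    angular velocity of the curve; so D stays 0. *)
Lemma polar s : 0 <= s <= 1 ->
  [/\ 0 < rad s, g s = rad s * cos (th s) & - (s * y s) = rad s * sin (th s)].
Proof.
have [cg cy dg dy] := sol.
have nd x := radial_nondegenerate (s := x) L0 sol hN g0.
pose D x := g x * sin (th x) + x * y x * cos (th x).
have cs x : continuous_at x (fun x => sin (th x)).
  by apply: cfun_comp; [exact: continuous_sin|exact: angle_cont].
have cc x : continuous_at x (fun x => cos (th x)).
  by apply: cfun_comp; [exact: continuous_cos|exact: angle_cont].
have cD x : continuous_at x D.
  by move: (cg x) (cy x) (cs x) (cc x) => ? ? ? ?; rewrite /D; cont.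
have crad : continuous rad.
  by move=> x; move: (cg x) (cy x) (cs x) (cc x) => ? ? ? ?; rewrite /rad; cont.
have Q0 x : 0 <= x <= 1 -> D x ^+ 2 / (g x ^+ 2 + (x * y x) ^+ 2) = 0.
  move=> /andP[x0 x1].
  have -> : 0 = D 0 ^+ 2 / (g 0 ^+ 2 + (0 * y 0) ^+ 2).
    by rewrite /D angle0 sin0 !mulr0 !mul0r addr0 expr0n mul0r.
  apply/esym; refine (@derive_eq0_eq _
    (fun x => D x ^+ 2 / (g x ^+ 2 + (x * y x) ^+ 2)) (fun=> 0) _ _ x0 _ _ _) => // t ht.
  - have ht1 : 0 <= t <= 1 by lra.
    by move: (cD t) (cg t) (cy t) => ? ? ?; cont; rewrite gt_eqF// nd.
  - have ht1 : 0 <= t <= 1 by lra.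
    have ht2 : 0 < t < 3 / 2 by lra.
    have nt := nd t ht1.
    move: (dg t ht2) (dy t ht2) (is_derive_angle ht1) => d1 d2 d3.
    have d4 : is_derive t 1 (fun x => sin (th x)) (cos (th t) * turning N g y t).
      exact: (dfun_compR (is_derive_sin _) d3).
    have d5 : is_derive t 1 (fun x => cos (th x)) (- sin (th t) * turning N g y t).
      exact: (dfun_compR (is_derive_cos _) d3).
    rewrite /D; der_to; first by rewrite gt_eqF.
    rewrite /= /turning gapE; last by lra.
    set S := sin _; set C := cos _; set G := g t; set Y := y t.
    have nt' : G ^+ 2 + (t * Y) ^+ 2 != 0 by rewrite gt_eqF.
    by field; rewrite nt' /=; apply/andP; split; rewrite gt_eqF//; lra.
have D0 x : 0 <= x <= 1 -> D x = 0.
  move=> hx; have /eqP := Q0 x hx.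
  by rewrite mulf_eq0 invr_eq0 (gt_eqF (nd x hx)) orbF sqrf_eq0 => /eqP.
have polar x : 0 <= x <= 1 -> g x = rad x * cos (th x) /\ - (x * y x) = rad x * sin (th x).
  move=> hx; have d0 := D0 x hx; have cs2 := cos2Dsin2 (th x).
  split; apply/eqP; rewrite -subr_eq0; apply/eqP.
    rewrite (_ : _ - _ = g x * (1 - (cos (th x) ^+ 2 + sin (th x) ^+ 2)) + D x * sin (th x)).
      by rewrite cs2 d0 subrr mulr0 mul0r addr0.
    by rewrite /D /rad; ring.
  rewrite (_ : _ - _ = - (x * y x) * (1 - (cos (th x) ^+ 2 + sin (th x) ^+ 2)) - D x * cos (th x)).
    by rewrite cs2 d0 subrr mulr0 mul0r subr0.
  by rewrite /D /rad; ring.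
move=> hs; have /andP[s0 s1] := hs; have [p1 p2] := polar s hs; split=> //.
apply: (no_zero_gt0 s0 crad).
  by rewrite /rad angle0 cos0 sin0 g0 mulr0 subr0 mulr1 ltr01.
move=> x /andP[x0 xs]; apply/negP => /eqP r0.
have hx : 0 <= x <= 1 by rewrite x0 (le_trans xs).
have [] := polar x hx; rewrite r0 !mul0r => gx /eqP; rewrite oppr_eq0 => /eqP yx.
by have := nd x hx; rewrite gx yx expr0n addr0 ltxx.
Qed.

End Polar.
End Angle.

Section AngleFamily.
Context {R : realType} (n : nat) (hn : (2 <= n)%N).
Variables (N G Y : R -> R -> R) (L : R).
Hypotheses (L0 : 0 < L) (lN : forall e, lipschitz_with L (N e))
  (N0 : forall e, N e 0 = 0)
  (cN : forall e x : R, continuous_at (e, x) (fun p : R * R => N p.1 p.2))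
  (sol : forall e, radial_sol n (N e) (G e) (Y e)) (G0 : forall e, G e 0 = 1).

Lemma lipschitz_with_bound e x : `|N e x| <= L * `|x|.
Proof. by have := @lN e x 0; rewrite N0 !subr0. Qed.

Let uniform (e0 eps : R) : 0 < eps -> exists2 d, 0 < d &
  forall e, `|e - e0| < d -> forall s, 0 <= s < 3 / 2 ->
    `|G e s - G e0 s| < eps /\ `|Y e s - Y e0 s| < eps.
Proof.
move=> eps0; have [C C0 hC] := radial_stability (R := R) hn L0.
have [cG _ _ _] := sol e0.
have ce : 0 < eps / 2 / C by rewrite !divr_gt0.
have [|d d0 hd] := @tube R (fun e s => N e (G e0 s)) e0 0 (3 / 2) _ _ ce.
  move=> s _; apply: (@continuous_comp _ _ _ (fun p : R * R => (p.1, G e0 p.2))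
    (fun p : R * R => N p.1 p.2) (e0, s)); last exact: cN.
  apply: (@cvg_pair _ _ _ _ (nbhs e0) (nbhs (G e0 s))); first exact: cvg_fst.
  by apply: cvg_comp; [exact: cvg_snd|exact: cG].
exists d => // e /hd he s hs.
have := hC _ _ _ _ _ _ (eps / 2 / C) (@lN e) (sol e) (sol e0) _ s hs.
rewrite !G0 subrr normr0 add0r (_ : C * (eps / 2 / C) = eps / 2); last first.
  by field; rewrite gt_eqF.
move=> /(_ _)[].
  by move=> t ht; rewrite ltW// he.
by move=> h1 h2; split; lra.
Qed.

Let joint (F : R -> R -> R) (e0 s0 : R) : continuous (F e0) -> 0 <= s0 <= 1 ->
  (forall eps : R, 0 < eps -> exists2 d : R, 0 < d &
    forall e, `|e - e0| < d -> forall s, 0 <= s < 3 / 2 -> `|F e s - F e0 s| < eps) ->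
  continuous_at (e0, s0) (fun p : R * R => F p.1 (unit_clamp p.2)).
Proof.
move=> cF hs0 hF; apply/cvgrPdist_lt => eps eps0.
have e2 : 0 < eps / 2 by rewrite divr_gt0.
have [d d0 hd] := hF _ e2.
have cFc : continuous_at s0 (fun s => F e0 (unit_clamp s)).
  by apply: cfun_comp; [exact: cF|exact: unit_clamp_cont].
have /cont_epsP/(_ _ e2)[d' d'0 hd'] := cFc.
exists (ball e0 d, ball s0 d'); first by split; exact: nbhsx_ballx.
move=> [e s] /= [Be Bs]; rewrite distrC.
have /andP[u0 u1] := @unit_clamp_itv R s.
have h1 : `|F e (unit_clamp s) - F e0 (unit_clamp s)| < eps / 2.
  apply: hd; first by rewrite distrC.
  by rewrite u0 /=; lra.
have h2 : `|F e0 (unit_clamp s) - F e0 (unit_clamp s0)| < eps / 2.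
  by apply: hd'; rewrite distrC.
by move: h1 h2; rewrite !ltr_norml => /andP[? ?] /andP[? ?]; apply/andP; split; lra.
Qed.

(** By stability the curves converge uniformly, hence so do their angular
    velocities, whose denominators stay away from 0. *)
Lemma angle_family_cont : continuous (fun e => angle n (N e) (G e) (Y e) 1).
Proof.
move=> e0; apply/cont_epsP => eps eps0.
have e2 : 0 < eps / 2 by rewrite divr_gt0.
have hN e s : `|N e (G e s)| <= L * `|G e s| := lipschitz_with_bound e (G e s).
have cNe e : continuous (N e) := lipschitz_with_cont L0 (@lN e).
have [|d d0 hd] := @tube R (fun e s => turning n (N e) (G e) (Y e) (unit_clamp s))
  e0 0 1 _ _ e2.
  move=> s hs; have [cG cY _ _] := sol e0.
  have jG : continuous_at (e0, s) (fun p : R * R => G p.1 (unit_clamp p.2)).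
    apply: joint => // t t0; have [d d0 hd] := uniform e0 t0.
    by exists d => // e /hd he x /he[].
  have jY : continuous_at (e0, s) (fun p : R * R => Y p.1 (unit_clamp p.2)).
    apply: joint => // t t0; have [d d0 hd] := uniform e0 t0.
    by exists d => // e /hd he x /he[].
  have js : continuous_at (e0, s) (fun p : R * R => unit_clamp p.2).
    apply: (@continuous_comp _ _ _ (fun p : R * R => p.2) unit_clamp).
      exact: cvg_snd.
    exact: unit_clamp_cont.
  have jN : continuous_at (e0, s)
      (fun p : R * R => N p.1 (G p.1 (unit_clamp p.2))).
    apply: (@continuous_comp _ _ _
      (fun p : R * R => (p.1, G p.1 (unit_clamp p.2)))
      (fun p : R * R => N p.1 p.2) (e0, s)); last exact: cN.
    by apply: (@cvg_pair _ _ _ _ (nbhs e0) (nbhs (G e0 (unit_clamp s))));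
      [exact: cvg_fst|exact: jG].
  have jg : continuous_at (e0, s) (fun p : R * R => gap (unit_clamp p.2)).
    by apply: (@cfun_comp _ _ gap) => //; exact: gap_cont.
  have nd : 0 < G e0 (unit_clamp s) ^+ 2 + (unit_clamp s * Y e0 (unit_clamp s)) ^+ 2.
    exact: radial_nondegenerate L0 (sol e0) (hN e0) (G0 e0) (unit_clamp_itv s).
  rewrite /turning; cont; first by rewrite gt_eqF// gap_gt0.
  by rewrite /= gt_eqF.
exists d => // e /hd he.
have ct e' := turning_cont hn L0 (cNe e') (sol e') (hN e') (G0 e').
pose P x := angle n (N e) (G e) (Y e) x - angle n (N e0) (G e0) (Y e0) x.
have [x hx E] : exists2 x : R, 0 < x < 1 & P 1 - P 0 =
   (turning n (N e) (G e) (Y e) (unit_clamp x) -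
    turning n (N e0) (G e0) (Y e0) (unit_clamp x)) * (1 - 0).
  apply: (@mean_value _ P (fun x => turning n (N e) (G e) (Y e) (unit_clamp x) -
    turning n (N e0) (G e0) (Y e0) (unit_clamp x)) 0 1 ltr01) => x hx.
    rewrite /P; apply: cfunB; exact: (primitive_cont (ct _)).
  move: (is_derive_primitive x (ct e)) (is_derive_primitive x (ct e0)) => ? ?.
  by rewrite /P /angle; der.
have -> : angle n (N e) (G e) (Y e) 1 - angle n (N e0) (G e0) (Y e0) 1 = P 1 - P 0.
  by rewrite /P /angle !primitive0; ring.
rewrite E subr0 mulr1.
apply: (@lt_trans _ _ (eps / 2)); last by lra.
by apply: he; lra.
Qed.

End AngleFamily.

(** * Sturm comparison and Gegenbauer polynomials *)

Section Sturm.
Context {R : realType} (n : nat) (hn : (2 <= n)%N).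
Implicit Types (g y D V : R -> R) (s t : R).

Lemma cosM_ge_sinB (a b : R) : 0 < b - a < 1 ->
  0 <= cos a * cos b + sin (b - a).
Proof.
move=> /andP[d0 d1]; have pi2 := @pi_ge2 R.
have s0 : 0 < sin (b - a) by apply: sin_gt0_pi; rewrite d0 /=; lra.
have c0 : 0 <= cos (b - a) by apply: cos_ge0_pihalf; lra.
have q1 := cos2Dsin2 (b - a).
have q2 : cos (b - a) ^+ 2 <= cos (b - a) by rewrite expr2 ler_piMl ?cos_le1.
have q3 : sin (b - a) ^+ 2 <= sin (b - a) by rewrite expr2 ler_piMl ?sin_le1 ?(ltW s0).
have := cosD a b; have := cosB b a; have := cos_geN1 (a + b); lra.
Qed.

(** A zero of D from above would lie in the region 0 < D < 1 just before it,
    where V e^(c s) is nondecreasing; V would stay positive up to that zero,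
    although there it has the sign of sin 0. *)
Lemma phase_barrier D V (V' : R -> R) (c : R) :
  continuous D -> D 0 = 0 -> continuous V ->
  (forall s, 0 < s <= 1 -> (0 < V s) = (0 < sin (D s))) ->
  (forall s, 0 < s < 1 -> is_derive s 1 V (V' s)) ->
  (forall s, 0 < s < 1 -> 0 < D s < 1 -> 0 <= V' s + c * V s) ->
  (exists2 r, 0 < r & forall s, 0 < s < r -> 0 < V s) ->
  0 < D 1.
Proof.
move=> cD D0 cV sign dV V'ge [r r0 Vr]; have pi2 := @pi_ge2 R.
have [s0 hs0 Ds0] : exists2 s0, 0 < s0 < 1 & 0 < D s0.
  have /cont_epsP/(_ 1 ltr01)[d d0 hd] := cD 0.
  pose m := Num.min 1 (Num.min r d).
  have m0 : 0 < m by rewrite !lt_min ltr01 r0.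
  have [m1 mr md] : [/\ m <= 1, m <= r & m <= d] by rewrite /m !ge_min !lexx ?orbT.
  have Vs : 0 < V (m / 2) by apply: Vr; lra.
  have hm : 0 < m / 2 <= 1 by lra.
  have := hd (m / 2); rewrite D0 !subr0 gtr0_norm; last by lra.
  move=> /(_ _)Dlt; have {Dlt} : `|D (m / 2)| < 1 by apply: Dlt; lra.
  rewrite ltr_norml => /andP[Dlt _]; exists (m / 2); first by lra.
  rewrite sign// in Vs; rewrite ltNge; apply/negP => Dle.
  have : 0 <= sin (- D (m / 2)) by apply: sin_ge0_pi; lra.
  by rewrite sinN; lra.
rewrite ltNge; apply/negP => D1; have [s00 s01] := andP hs0.
have [z [/andP[sz z1] Dz below]] := first_zero s01 cD Ds0 D1.
have /cont_epsP/(_ 1 ltr01)[d d0 hd] := cD z.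
pose a := z - Num.min (d / 2) ((z - s0) / 2).
have m0 : 0 < Num.min (d / 2) ((z - s0) / 2) by rewrite lt_min !divr_gt0// subr_gt0.
have m1 : Num.min (d / 2) ((z - s0) / 2) <= d / 2 by rewrite ge_min lexx.
have m2 : Num.min (d / 2) ((z - s0) / 2) <= (z - s0) / 2 by rewrite ge_min lexx orbT.
have [ac sa ad] : [/\ a < z, s0 <= a & z - a < d] by rewrite /a; split; lra.
have small s : a <= s < z -> 0 < D s < 1.
  move=> hs; have Dsp : 0 < D s by apply: below; lra.
  rewrite Dsp /=; have := hd s; rewrite Dz subr0 distrC !gtr0_norm//; last by lra.
  by apply; lra.
have /= EE : V a * expR (c * a) <= V z * expR (c * z).
  apply: (@derive_ge0_le _ (fun s => V s * expR (c * s))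
    (fun s => expR (c * s) * (V' s + c * V s)) _ _ (ltW ac)) => s hs.
  - by apply: cfunM; [exact: cV|exact: is_derive_cont (is_derive_expRM _ _)].
  - have hs' : 0 < s < 1 by lra.
    by move: (dV s hs') (is_derive_expRM c s) => ? ?; der_to; ring.
  - rewrite mulr_ge0 ?expR_ge0// V'ge//; [lra|apply: small; lra].
have ha : 0 < a <= 1 by lra.
have Da : 0 < D a < 1 by apply: small; rewrite lexx.
have Va : 0 < V a by rewrite sign//; apply: sin_gt0_pi; lra.
have hz : 0 < z <= 1 by lra.
have Vz : V z <= 0 by rewrite leNgt sign// Dz sin0 ltxx.
have : 0 < V a * expR (c * a) by rewrite mulr_gt0// expR_gt0.
have : V z * expR (c * z) <= 0 by rewrite mulr_le0_ge0// expR_ge0.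
lra.
Qed.

(** The phase of the linear equation increases strictly with the eigenvalue
    parameter: near the pole the Wronskian V has the sign of v2 - v1, and
    where the phase difference is small, V' >= - (v2 - v1) V. The phase
    difference D enters V as r1 r2 weight^n sin D / s. *)
Lemma angle_linear_lt (v1 v2 : R) g1 y1 g2 y2 : 0 <= v1 < v2 ->
  radial_sol n ( *%R v1) g1 y1 -> radial_sol n ( *%R v2) g2 y2 ->
  g1 0 = 1 -> g2 0 = 1 ->
  angle n ( *%R v1) g1 y1 1 < angle n ( *%R v2) g2 y2 1.
Proof.
move=> /andP[v10 v12] sol1 sol2 g10 g20.
have lin (v : R) : 0 <= v -> forall x, `|v * x| <= (v + 1) * `|x|.
  by move=> v0 x; rewrite normrM ger0_norm// ler_wpM2r//; lra.
have v20 : 0 <= v2 by lra.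
have L1 : 0 < v1 + 1 by lra. have L2 : 0 < v2 + 1 by lra.
have cl (v : R) : continuous ( *%R v) by move=> x; exact: mulrl_continuous.
have p1 := polar hn L1 (cl v1) sol1 (fun s => lin v1 v10 (g1 s)) g10.
have p2 := polar hn L2 (cl v2) sol2 (fun s => lin v2 v20 (g2 s)) g20.
have ca1 := angle_cont hn L1 (cl v1) sol1 (fun s => lin v1 v10 (g1 s)) g10.
have ca2 := angle_cont hn L2 (cl v2) sol2 (fun s => lin v2 v20 (g2 s)) g20.
set th1 := angle n ( *%R v1) g1 y1 in p1 ca1 *.
set th2 := angle n ( *%R v2) g2 y2 in p2 ca2 *.
pose D s := th2 s - th1 s.
have cD : continuous D by move=> s; move: (ca1 s) (ca2 s) => ? ?; rewrite /D; cont.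
have D0 : D 0 = 0 by rewrite /D /th1 /th2 /angle !primitive0 subrr.
have [cg1 cy1 dg1 dy1] := sol1; have [cg2 cy2 dg2 dy2] := sol2.
pose V s := weight s ^+ n * (y1 s * g2 s - g1 s * y2 s).
have cV : continuous V.
  move=> s; move: (cg1 s) (cg2 s) (cy1 s) (cy2 s) (@weight_cont R s) => ? ? ? ? ?.
  by rewrite /V; cont.
have V0 : V 0 = 0.
  by rewrite /V /weight mul0r sqrtr0 expr0n; case: eqP hn => [->//|_ _]; rewrite mul0r.
have dV s : 0 < s < 3 / 2 ->
    is_derive s 1 V (weight s ^+ n.-2 * ((v2 - v1) * (g1 s * g2 s))).
  move=> hs; apply: (@is_derive_flux R n hn _ (fun s => (v2 - v1) * (g1 s * g2 s))).
    by lra.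
  move: (dg1 s hs) (dg2 s hs) (dy1 s hs) (dy2 s hs) => ? ? ? ?; der_to.
  by field; apply/andP; split; rewrite gt_eqF//; lra.
have wp k s : 0 < s <= 1 -> 0 < weight s ^+ k.
  by move=> hs; rewrite exprn_gt0// weight_gt0//; lra.
(* the Wronskian in polar coordinates *)
have VE s : 0 < s <= 1 -> exists2 c, 0 < c & V s * s = c * weight s ^+ n * sin (D s)
    /\ g1 s * g2 s = c * (cos (th1 s) * cos (th2 s)).
  move=> hs; have hs' : 0 <= s <= 1 by lra.
  have [r1 a1 b1] := p1 s hs'; have [r2 a2 b2] := p2 s hs'.
  set R1 := _ - _ in r1 a1 b1; set R2 := _ - _ in r2 a2 b2.
  exists (R1 * R2); first by rewrite mulr_gt0.
  split; last by rewrite a1 a2; ring.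
  rewrite /D sinB (_ : V s * s = weight s ^+ n *
    (- (s * y2 s) * g1 s - (- (s * y1 s)) * g2 s)); last by rewrite /V; ring.
  by rewrite b1 b2 a1 a2; ring.
have dv0 : 0 < v2 - v1 by rewrite subr_gt0.
clear p1 p2 ca1 ca2 sol1 sol2 lin L1 L2 v10 v20 v12 dg1 dg2 dy1 dy2 cy1 cy2.
rewrite -subr_gt0 -/(D 1).
apply: (@phase_barrier D V _ (v2 - v1) cD D0 cV _ (fun s hs => dV s ltac:(lra))).
- move=> s hs; have [c c0 [E _]] := VE s hs; have /andP[s0 _] := hs.
  by rewrite -(pmulr_lgt0 _ s0) E pmulr_rgt0// mulr_gt0// wp.
- move=> s hs Ds; have hs1 : 0 < s <= 1 by lra.
  have [k k0 [Vk gk]] := VE s hs1; have w2 := wp n.-2 s hs1.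
  have sp : s != 0 by apply: lt0r_neq0; lra.
  have wn : weight s ^+ n = weight s ^+ n.-2 * (s * (2 - s)).
    rewrite -weight_sqr; last by lra.
    by rewrite -exprD addn2; congr (_ ^+ _); case: n hn => [|[|]].
  have Vs : V s = k * weight s ^+ n.-2 * (2 - s) * sin (D s).
    by apply: (mulIf sp); rewrite Vk wn; ring.
  rewrite gk Vs (_ : _ + _ = (v2 - v1) * (k * weight s ^+ n.-2) *
    (cos (th1 s) * cos (th2 s) + sin (D s) + (1 - s) * sin (D s))); last by ring.
  rewrite mulr_ge0//; first by rewrite mulr_ge0 ?(ltW dv0)// mulr_ge0 ?(ltW k0) ?(ltW w2).
  rewrite addr_ge0 ?cosM_ge_sinB// mulr_ge0//; first by lra.
  by apply: sin_ge0_pi; have := @pi_ge2 R; lra.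
- have /cont_epsP/(_ 1 ltr01)[d1 d10 h1] := cg1 0.
  have /cont_epsP/(_ 1 ltr01)[d2 d20 h2] := cg2 0.
  exists (Num.min 1 (Num.min d1 d2)); first by rewrite !lt_min ltr01 d10.
  move=> r /andP[r0]; rewrite !lt_min => /and3P[r1 rd1 rd2]; rewrite -V0.
  apply: (@derive_gt0_lt _ V _ _ _ r0 (fun s _ => cV s) (fun s hs => dV s ltac:(lra))).
  move=> s hs; have [sd1 sd2] : `|s - 0| < d1 /\ `|s - 0| < d2.
    by rewrite subr0 gtr0_norm; lra.
  have := h1 s sd1; have := h2 s sd2; rewrite g10 g20 !ltr_norml.
  move=> /andP[q1 _] /andP[q2 _].
  rewrite mulr_gt0//; first by apply: wp; lra.
  by rewrite mulr_gt0// mulr_gt0; lra.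
Qed.

End Sturm.

Section Gegenbauer.
Context {R : realType} (n : nat) (hn : (2 <= n)%N).
Implicit Types (g y : R -> R) (s t v : R).

(** Eigenvalues of minus the Laplacian of the sphere of dimension n. *)
Definition eigenvalue_of (l : nat) : R := l%:R * (l%:R + n%:R - 1).

Fixpoint even_coef v (i : nat) : R :=
  match i with
  | 0 => 1
  | 1 => 0
  | i'.+2 => (eigenvalue_of i' - v) / (i'.+2%:R * i'.+1%:R) * even_coef v i'
  end.

(** For even m, the zonal harmonic of degree m as a polynomial in the height,
    up to normalisation: the power series solution breaks off at degree m. *)
Definition gegenbauer (m : nat) : {poly R} :=
  \poly_(i < m.+1) even_coef (eigenvalue_of m) i.

Lemma even_coef_odd v i : odd i -> even_coef v i = 0.
Proof.
elim/ltn_ind: i => -[//|[//|i]] IH /=.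
by rewrite negbK => oi; rewrite IH ?mulr0.
Qed.

Lemma even_coef_large m i : ~~ odd m -> (m < i)%N -> even_coef (eigenvalue_of m) i = 0.
Proof.
move=> om; elim/ltn_ind: i => -[//|[|i]] IH mi; first exact: even_coef_odd.
rewrite /=; have [oi|oi] := boolP (odd i); first by rewrite even_coef_odd// mulr0.
have [->|im] := eqVneq i m; first by rewrite subrr !mul0r.
rewrite IH ?mulr0//; rewrite ltn_neqAle eq_sym im /=.
move: mi; rewrite ltnS leq_eqVlt => /predU1P[e|//].
by move: om; rewrite e /= oi.
Qed.

Lemma coef_gegenbauer m i : ~~ odd m ->
  (gegenbauer m)`_i = even_coef (eigenvalue_of m) i.
Proof.
move=> om; rewrite coef_poly; case: ltnP => // h.
by rewrite even_coef_large.
Qed.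

Lemma gegenbauer_eq m t : ~~ odd m -> let P := gegenbauer m in
  (1 - t ^+ 2) * P^`()^`().[t] - n%:R * t * P^`().[t] + eigenvalue_of m * P.[t] = 0.
Proof.
move=> om P; have E : P^`()^`() - 'X^2 * P^`()^`() - n%:R *: ('X * P^`())
    + eigenvalue_of m *: P = 0.
  set a := even_coef (eigenvalue_of m).
  have d0 i : P`_i = a i by exact: coef_gegenbauer.
  have d1 i : P^`()`_i = a i.+1 * i.+1%:R by rewrite coef_deriv d0 mulr_natr.
  have d2 i : P^`()^`()`_i = a i.+2 * i.+2%:R * i.+1%:R.
    by rewrite coef_deriv d1 -[LHS]mulr_natr.
  apply/polyP => i; rewrite coefD 2!coefB !coefZ coefXnM coefXM coef0.
  rewrite d0 d2; case: i => [|[|i]].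
  - by rewrite /= /a /= /eigenvalue_of; field.
  - by rewrite /= d1 /a /= /eigenvalue_of; ring.
  - have aE : a i.+4 = (eigenvalue_of i.+2 - eigenvalue_of m) /
        (i.+4%:R * i.+3%:R) * a i.+2 by [].
    rewrite subn2 /= d1 d2 aE; set b := a i.+2.
    have h1 : i.+4%:R != 0 :> R by rewrite pnatr_eq0.
    have h2 : i.+3%:R != 0 :> R by rewrite pnatr_eq0.
    rewrite /eigenvalue_of; move: h1 h2; rewrite -!natr1 => h1 h2.
    by field; rewrite ?h1 ?h2.
have := congr1 (horner^~ t) E; rewrite !hornerE /= => <-; ring.
Qed.

Lemma gegenbauer_sol m (c : R) : ~~ odd m ->
  radial_sol n ( *%R (eigenvalue_of m)) (fun s => (gegenbauer m).[1 - s] * c)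
    (fun s => - (gegenbauer m)^`().[1 - s] * c).
Proof.
move=> om; set P := gegenbauer m.
have dP (p : {poly R}) s : is_derive s 1 (fun s => p.[1 - s]) (- p^`().[1 - s]).
  have d : is_derive s 1 (fun s => 1 - s) (- 1) by der_to; ring.
  rewrite -mulrN1.
  exact: (@dfun_compR R (horner p) (fun s => 1 - s) s _ _ (is_derive_poly p (1 - s)) d).
have cP (p : {poly R}) : continuous (fun s => p.[1 - s]).
  by move=> s; exact: is_derive_cont (dP p s).
split.
- by move=> s; move: (cP P s) => ?; cont.
- by move=> s; move: (cP P^`() s) => ?; cont.
- by move=> s _; have := dP P s => ?; der_to; ring.
- move=> s hs; have := dP P^`() s => ?; der_to.
  have := gegenbauer_eq (1 - s) om; rewrite /= -/P.
  set p2 := P^`()^`().[_]; set p1 := P^`().[_]; set p0 := P.[_] => E.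
  have hs0 : s * (2 - s) != 0 by rewrite mulf_neq0// gt_eqF//; lra.
  apply: (mulIf hs0); rewrite divfK//.
  apply/eqP; rewrite -subr_eq0; apply/eqP.
  transitivity (c * ((1 - (1 - s) ^+ 2) * p2 - n%:R * (1 - s) * p1
    + eigenvalue_of m * p0)); last by rewrite E mulr0.
  by ring.
Qed.

Lemma zero_sol (v : R) : radial_sol n ( *%R v) (fun=> 0) (fun=> 0).
Proof.
split.
- by move=> s; cont.
- by move=> s; cont.
- by move=> s _; der.
- by move=> s _; der_to; ring.
Qed.

(** The value at the pole cannot vanish, by uniqueness for the singular
    Cauchy problem. *)
Lemma gegenbauer1_neq0 m : ~~ odd m -> (gegenbauer m).[1] != 0.
Proof.
move=> om; apply/eqP => P1.
have v0 : 0 <= eigenvalue_of m.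
  by case: m {om P1} => [|m]; rewrite /eigenvalue_of ?mul0r// mulr_ge0//
    -natr1 addrAC -addrA subrr addr0 addrC addr_ge0.
have L0 : 0 < eigenvalue_of m + 1 by lra.
have lip : lipschitz_with (eigenvalue_of m + 1) ( *%R (eigenvalue_of m)).
  by move=> a b; rewrite -mulrBr normrM ger0_norm// ler_wpM2r//; lra.
have [C C0 hC] := radial_stability hn L0.
have h1 : forall s, 0 <= s <= 3 / 2 ->
    `|eigenvalue_of m * (0 : R) - eigenvalue_of m * 0| <= 0.
  by move=> s _; rewrite subrr normr0.
have hs : 0 <= (1 : R) < 3 / 2 by lra.
have [] := hC _ _ _ _ _ _ 0 lip (gegenbauer_sol 1 om)
  (zero_sol (eigenvalue_of m)) h1 1 hs.
rewrite !subr0 subrr mulr1 horner_coef0 coef_gegenbauer// mulr1 P1 normr0 addr0 mulr0.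
by rewrite normr_le0 oner_eq0.
Qed.

(** Evenness in the height is the Neumann condition at the equator. *)
Lemma even_mode_exists m : ~~ odd m -> exists g y,
  [/\ radial_sol n ( *%R (eigenvalue_of m)) g y, g 0 = 1 & y 1 = 0].
Proof.
move=> om; set P := gegenbauer m.
exists (fun s => P.[1 - s] * P.[1]^-1), (fun s => - P^`().[1 - s] * P.[1]^-1).
split; first exact: gegenbauer_sol.
  by rewrite subr0 mulfV// gegenbauer1_neq0.
by rewrite subrr horner_coef0 coef_deriv coef_gegenbauer// mulr1n oppr0 mul0r.
Qed.

Lemma sin_zero_step (x : R) j : sin x = 0 -> j%:R * pi < x -> j.+1%:R * pi <= x.
Proof.
elim: j x => [|j IH] x sx.
  rewrite mul0r mul1r => x0; rewrite leNgt; apply/negP => xpi.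
  by have := @sin_gt0_pi R x; rewrite x0 xpi sx ltxx => /(_ isT).
have sx' : sin (x - pi) = 0.
  have := @sinDpi R (x - pi); rewrite subrK sx => /esym/eqP.
  by rewrite oppr_eq0 => /eqP.
move=> jx; have h : j.+1%:R * pi <= x - pi.
  by apply: IH => //; move: jx; rewrite -[j.+1%:R]natr1; lra.
by move: h; rewrite -[j.+2%:R]natr1; lra.
Qed.

Section Phase.
Variables (N : R -> R) (g y : R -> R) (L : R).
Hypotheses (L0 : 0 < L) (cN : continuous N) (sol : radial_sol n N g y).
Hypotheses (hN : forall s, `|N (g s)| <= L * `|g s|) (g0 : g 0 = 1).

(** The Neumann condition at the equator quantises the phase there. *)
Lemma angle_sin_eq0 : sin (angle n N g y 1) = 0 <-> y 1 = 0.
Proof.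
have h1 : 0 <= (1 : R) <= 1 by rewrite ler01 lexx.
have [+ _] := polar hn L0 cN sol hN g0 h1; move: (_ - _) => r r0.
rewrite mul1r => E.
split=> [s0|y1]; first by move: E; rewrite s0 mulr0 => /eqP; rewrite oppr_eq0 => /eqP.
move: E; rewrite y1 oppr0 => /esym/eqP; rewrite mulf_eq0 (gt_eqF r0) /=.
by move/eqP.
Qed.

(** The phase starts at 0, and at the level pi the derivative y vanishes. *)
Lemma angle_lt_pi : (forall s, 0 < s <= 1 -> y s != 0) -> angle n N g y 1 < pi.
Proof.
move=> hy; rewrite ltNge; apply/negP => h.
have ca := angle_cont hn L0 cN sol hN g0.
have a0 : angle n N g y 0 = 0 by exact: primitive0.
have pi0 := @pi_gt0 R.
have [|c] := @IVT R (angle n N g y) 0 1 pi ler01 (@cont_within _ _ 0 1 (fun x _ => ca x)).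
  by rewrite a0 ge_min le_max h (ltW pi0) orbT.
rewrite in_itv /= => /andP[c0 c1] E.
have cp : 0 < c.
  rewrite lt_neqAle c0 andbT; apply/eqP => e.
  by move: E; rewrite -e a0 => /eqP; rewrite lt_eqF.
have hc : 0 <= c <= 1 by rewrite c0.
have [_ _] := polar hn L0 cN sol hN g0 hc; rewrite [sin _](_ : _ = 0); last by rewrite E sinpi.
rewrite mulr0 => /eqP.
by rewrite oppr_eq0 mulf_eq0 (gt_eqF cp) /= (negPf (hy _ _))// cp.
Qed.

End Phase.

Lemma eigenvalue_of_lt l : eigenvalue_of l < eigenvalue_of l.+1.
Proof.
rewrite /eigenvalue_of -natr1.
have h1 : 0 <= l%:R :> R by [].
have h2 : 2 <= n%:R :> R by rewrite ler_nat.
rewrite -subr_gt0 (_ : _ - _ = 2 * l%:R + n%:R); last by ring.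
by lra.
Qed.

Lemma eigenvalue_of_ge0 l : 0 <= eigenvalue_of l.
Proof.
elim: l => [|l IH]; first by rewrite /eigenvalue_of mul0r.
by rewrite ltW// (le_lt_trans IH)// eigenvalue_of_lt.
Qed.

(** Each even eigenvalue is a zero of sin (angle), and the angle increases
    between consecutive ones, hence by at least pi. *)
Lemma even_mode_angle j : exists g y,
  [/\ radial_sol n ( *%R (eigenvalue_of j.*2)) g y, g 0 = 1
    & j%:R * pi <= angle n ( *%R (eigenvalue_of j.*2)) g y 1].
Proof.
elim: j => [|j [g [y [sol g0 IH]]]].
  exists (fun=> 1), (fun=> 0); split=> //; first split.
  - by move=> s; cont.
  - by move=> s; cont.
  - by move=> s _; der.
  - by move=> s _; rewrite /eigenvalue_of mul0r; der_to; ring.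
  rewrite mul0r /angle (_ : (fun s => _) = fun=> 0); last first.
    apply/funext => s; have -> : eigenvalue_of 0.*2 = 0.
      by rewrite /eigenvalue_of mul0r.
    by rewrite /turning expr0n !(mulr0, mul0r, oppr0, addr0).
  have c0 : continuous (fun _ : R => 0 : R) by move=> s; cont.
  have <- // := @derive_eq0_eq R (primitive (fun=> 0)) (fun=> 0) 0 1 ler01
    (fun x _ => primitive_cont c0 x) (fun x _ => is_derive_primitive x c0)
    (fun _ _ => erefl).
  by rewrite primitive0.
have oj : ~~ odd j.+1.*2 by rewrite odd_double.
have [g' [y' [sol' g0' y1']]] := even_mode_exists oj.
exists g', y'; split=> //.
have v0 := eigenvalue_of_ge0 j.+1.*2.
have L0 : 0 < eigenvalue_of j.+1.*2 + 1 by lra.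
apply: sin_zero_step.
  apply/(angle_sin_eq0 L0 _ sol' _ g0') => //; first by move=> x; exact: mulrl_continuous.
  by move=> s; rewrite normrM ger0_norm// ler_wpM2r//; lra.
apply: (le_lt_trans IH); apply: angle_linear_lt => //.
rewrite eigenvalue_of_ge0 /= doubleS.
exact: lt_trans (eigenvalue_of_lt _) (eigenvalue_of_lt _).
Qed.

(** The linearisation at a constant has turned past j pi as soon as its
    parameter exceeds the eigenvalue of degree 2 j. *)
Lemma angle_linear_gt v g y j : eigenvalue_of j.*2 < v ->
  radial_sol n ( *%R v) g y -> g 0 = 1 -> j%:R * pi < angle n ( *%R v) g y 1.
Proof.
move=> vj sol g0; have [g' [y' [sol' g0' h]]] := even_mode_angle j.
apply: (le_lt_trans h); apply: angle_linear_lt => //.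
by rewrite eigenvalue_of_ge0.
Qed.

End Gegenbauer.

(** * The truncated nonlinearity *)

Section Nonlinearity.
Context {R : realType}.

Definition clip (M x : R) : R := Num.min (Num.max x 0) M.

Lemma clip_incr (M a b : R) : 0 <= M -> a <= b ->
  clip M a <= clip M b /\ clip M b - clip M a <= b - a.
Proof.
move=> M0 ab; rewrite /clip.
case: (leP b 0) => hb; first by rewrite (max_r (le_trans ab hb)) subrr subr_ge0.
case: (leP a 0) => ha.
  by rewrite (min_l M0); case: (leP b M) => hM; split; lra.
by case: (leP b M) => hM; case: (leP a M) => hM'; split; lra.
Qed.

Section Truncation.
Variables (q M : R).
Hypotheses (q1 : 1 < q) (M2 : 2 <= M).
Implicit Types (x a b : R).

Let q0 : 0 < q. Proof. exact: lt_trans ltr01 q1. Qed.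
Let qm0 : 0 < q - 1. Proof. by rewrite subr_gt0. Qed.
Let M0 : 0 < M. Proof. by apply: lt_le_trans M2. Qed.

Let q0w : 0 <= q. Proof. exact: ltW. Qed.
Let qm0w : 0 <= q - 1. Proof. exact: ltW. Qed.
Let M0w : 0 <= M. Proof. exact: ltW. Qed.

Let M1 : 1 <= M. Proof. by apply: le_trans M2; rewrite ler1n. Qed.
Let pow1 r : 1 `^ r = 1 :> R. Proof. by rewrite powR1. Qed.

Local Notation clip := (clip M).

(** x^q - x on [0, M], extended by constants: globally Lipschitz, so that the
    Cauchy problem is globally solvable. *)
Definition bulk x : R := clip x `^ q - clip x.

Lemma clip_itv x : 0 <= clip x <= M.
Proof. by rewrite /clip le_min ge_min lexx orbT le_max lexx orbT ltW. Qed.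

Lemma clip_id x : 0 <= x <= M -> clip x = x.
Proof. by move=> /andP[? ?]; rewrite /clip max_l// min_l. Qed.

Lemma clip_le0 x : x <= 0 -> clip x = 0.
Proof. by move=> h; rewrite /clip max_r// min_l// ltW. Qed.

Lemma bulk_le0 x : x <= 0 -> bulk x = 0.
Proof. by move=> h; rewrite /bulk clip_le0// powR0 ?subrr// gt_eqF. Qed.

Lemma bulk1 : bulk 1 = 0.
Proof. by rewrite /bulk clip_id ?powR1 ?subrr// ler01 (le_trans _ M2)// ler1n. Qed.

Lemma powR_lip a b : 0 <= a <= b -> b <= M ->
  `|b `^ q - a `^ q| <= q * M `^ (q - 1) * (b - a).
Proof.
move=> /andP[a0 ab] bM.
have Mq : 0 < M `^ (q - 1) := powR_gt0 _ M0.
have qq : 1 <= q := ltW q1.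
move: a0; rewrite le_eqVlt => /predU1P[e|a0].
  rewrite -e in ab *; rewrite powR0 ?gt_eqF// !subr0 ger0_norm ?powR_ge0//.
  rewrite -mulr_powRB1// [leRHS]mulrC ler_wpM2l//.
  apply: (@le_trans _ _ (M `^ (q - 1))); last by rewrite ler_peMl// ltW.
  by rewrite ge0_ler_powR ?nnegrE//.
move: ab; rewrite le_eqVlt => /predU1P[->|ab].
  by rewrite !subrr normr0 mulr0.
have dp x : 0 < x -> is_derive x 1 (fun x => x `^ q) (q * x `^ (q - 1)).
  by move=> x0; exact: is_derive1_powR.
have [|x hx|x /andP[ax xb] ->] := @mean_value R (fun x => x `^ q)
    (fun x => q * x `^ (q - 1)) a b ab.
- by move=> x /andP[ax _]; apply: is_derive_cont (dp _ _); exact: lt_le_trans ax.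
- by apply: dp; lra.
- have x0 : 0 < x by lra.
  rewrite ger0_norm; last first.
    by rewrite !mulr_ge0 ?powR_ge0 ?(ltW q0)// subr_ge0 ltW.
  rewrite ler_wpM2r ?subr_ge0 ?(ltW ab)// ler_wpM2l ?(ltW q0)//.
  by rewrite ge0_ler_powR ?nnegrE//; lra.
Qed.

Definition bulkL : R := q * M `^ (q - 1) + 1.

Lemma bulkL_ge : q + 1 <= bulkL.
Proof.
rewrite lerD2r ler_peMr ?(ltW q0)//.
by rewrite -[leLHS](pow1 (q - 1)) ge0_ler_powR ?nnegrE ?ler01//.
Qed.

Lemma bulkL_gt0 : 0 < bulkL.
Proof. by have := bulkL_ge; have := q1; have := M2; lra. Qed.

Lemma bulk_lip : lipschitz_with bulkL bulk.
Proof.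
have main a b : a <= b -> `|bulk a - bulk b| <= bulkL * `|a - b|.
  move=> ab; have ca := clip_itv a; have cb := clip_itv b.
  have [cab cba] := clip_incr M0w ab.
  have := @powR_lip (clip a) (clip b).
  rewrite cab; have /andP[-> _] := ca; have /andP[_ cbM] := cb => /(_ isT cbM) h.
  rewrite distrC (ler0_norm (x := a - b)) ?subr_le0// (opprB a b) /bulk /bulkL.
  rewrite (_ : clip b `^ q - clip b - (clip a `^ q - clip a) =
    (clip b `^ q - clip a `^ q) - (clip b - clip a)); last by ring.
  apply: le_trans (ler_normB _ _) _; rewrite mulrDl mul1r.
  apply: lerD; last by rewrite ger0_norm// subr_ge0.
  apply: (le_trans h); rewrite ler_wpM2l// mulr_ge0 ?powR_ge0// ltW//.
by move=> a b; case: (leP a b) => [/main//|/ltW/main]; rewrite distrC [`|b - a|]distrC.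
Qed.

Lemma is_derive_bulk x : 0 < x < M -> is_derive x 1 bulk (q * x `^ (q - 1) - 1).
Proof.
move=> /andP[x0 xM]; apply: (@dfun_near _ (fun x => x `^ q - x)).
  apply: filterS2 (near_gt x0) (near_lt xM) => y y0 yM.
  by rewrite /bulk clip_id// !ltW.
have := is_derive1_powR q x0 => ?; by der.
Qed.

Lemma bulk_cont : continuous bulk.
Proof. exact: lipschitz_with_cont bulkL_gt0 bulk_lip. Qed.

Lemma powR_subM x : 0 <= x -> x `^ q - x = x * (x `^ (q - 1) - 1).
Proof. by move=> x0; rewrite mulrBr mulr1 mulr_powRB1. Qed.

Lemma bulk_ge x a : 1 <= a <= M -> a <= x -> a `^ q - a <= bulk x.
Proof.
move=> /andP[a1 aM] ax; have [c0 cM] := andP (clip_itv x).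
have ac : a <= clip x by rewrite /clip le_min aM le_max ax.
have a0 : 0 <= a := le_trans ler01 a1.
rewrite /bulk !powR_subM//.
have h1 : 1 <= a `^ (q - 1).
  by rewrite -[leLHS](pow1 (q - 1)) ge0_ler_powR ?nnegrE ?ler01//.
apply: ler_pM => //; first by rewrite subr_ge0.
by rewrite lerD2r ge0_ler_powR ?nnegrE//.
Qed.

Lemma bulk_gt0 x : 1 < x -> 0 < bulk x.
Proof.
move=> x1; rewrite /bulk powR_subM; last by case/andP: (clip_itv x).
have c1 : 1 < clip x by rewrite /clip lt_min lt_max x1 /=; have := q1; have := M2; lra.
rewrite mulr_gt0//; first by have := q1; have := M2; lra.
rewrite subr_gt0 -[ltLHS](pow1 (q - 1)) gt0_ltr_powR ?nnegrE ?ler01//; lra.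
Qed.

Lemma bulk_geN1 x : -1 <= bulk x.
Proof.
have [x1|x1] := ltP 1 x; first by have := bulk_gt0 x1; lra.
have c1 : clip x <= 1 by rewrite /clip ge_min ge_max x1 ler01.
by rewrite /bulk; have := powR_ge0 (clip x) q; lra.
Qed.

Lemma bulk_lt0 x : 0 < x < 1 -> bulk x < 0.
Proof.
move=> /andP[x0 x1]; rewrite /bulk clip_id; last by apply/andP; split; have := q1; have := M2; lra.
rewrite powR_subM ?ltW// pmulr_rlt0// subr_lt0.
by rewrite -[ltRHS](pow1 (q - 1)) gt0_ltr_powR ?nnegrE ?ltW.
Qed.

Lemma bulk_norm_le x : `|bulk x| <= M `^ q.
Proof.
have [c0 cM] := andP (clip_itv x).
have h1 : 1 <= M `^ q.
  by rewrite -[leLHS](pow1 q) ge0_ler_powR ?nnegrE ?ler01//.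
have h2 : clip x `^ q <= M `^ q by rewrite ge0_ler_powR ?nnegrE.
rewrite ler_norml; apply/andP; split; first by have := bulk_geN1 x; lra.
by rewrite /bulk; lra.
Qed.

(** The nonlinearity divided by its zero at 1; the value q - 1 in the middle
    is the linearisation from which the solutions bifurcate. *)
Definition slope x : R := if x == 0 then q - 1 else bulk (1 + x) / x.

Lemma slope_cont : continuous slope.
Proof.
move=> x; have [->|x0] := eqVneq x 0.
  have h1 : 0 < (1 : R) < M by rewrite ltr01 /=; have := q1; have := M2; lra.
  have := is_derive_bulk h1; rewrite powR1 mulr1 => /is_derive1_caratheodory.
  move=> [g [gE cg g1]]; have E : slope = fun x => g (1 + x).
    apply/funext => z; rewrite /slope; case: eqP => [->|/eqP z0].
      by rewrite addr0.
    have := gE (1 + z); rewrite bulk1 subr0 => ->.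
    by rewrite (_ : 1 + z - 1 = z) ?mulfK//; ring.
  rewrite E; apply: (@cfun_comp _ _ g (fun x => 1 + x)); last by cont.
  by rewrite addr0.
have c : continuous_at x (fun x => bulk (1 + x) / x).
  have ? : continuous_at x (fun x => bulk (1 + x)).
    by apply: (@cfun_comp _ _ bulk (fun x => 1 + x)); [exact: bulk_cont|cont].
  by cont.
rewrite /continuous_at [X in _ --> X](_ : _ = bulk (1 + x) / x); last first.
  by rewrite /slope (negPf x0).
apply: cvg_trans c; apply: near_eq_cvg.
have xn : 0 < `|x| by rewrite normr_gt0.
apply/nbhs_ballP; exists `|x| => // y; rewrite /ball /= => xy.
rewrite /slope; case: eqP => // y0; move: xy.
by rewrite y0 subr0 ltxx.
Qed.

Section Rescaled.
Variable mu : R.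
Hypothesis mu0 : 0 < mu.

(** Source term of the equation satisfied by g when the solution is written
    1 + e g; it is regular, and linear, at the bifurcation value e = 0. *)
Definition rescaled e x : R := mu * (slope (e * x) * x).

Lemma rescaledE e x : e * rescaled e x = mu * bulk (1 + e * x).
Proof.
rewrite /rescaled /slope; case: eqP => [ex0|/eqP ex0].
  transitivity (mu * (q - 1) * (e * x)); first by ring.
  by rewrite ex0 addr0 bulk1 !mulr0.
transitivity (mu * (bulk (1 + e * x) / (e * x) * (e * x))).
  by set v := _^-1; ring.
by rewrite divfK.
Qed.

Lemma rescaled0 e : rescaled e 0 = 0.
Proof. by rewrite /rescaled !mulr0. Qed.

Lemma rescaled_linear : rescaled 0 = *%R (mu * (q - 1)).
Proof. by apply/funext => x; rewrite /rescaled mul0r /slope eqxx mulrA. Qed.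

Lemma rescaled_lip e : lipschitz_with (mu * bulkL) (rescaled e).
Proof.
move=> a b; have [->|e0] := eqVneq e 0.
  rewrite rescaled_linear -mulrBr normrM ler_wpM2r// ger0_norm; last first.
    by rewrite mulr_ge0 ?ltW.
  by rewrite ler_wpM2l ?(ltW mu0)//; have := bulkL_ge; have := q1; have := M2; lra.
have e1 : 0 < `|e| by rewrite normr_gt0.
rewrite -(ler_pM2l e1) -normrM mulrBr !rescaledE -mulrBr normrM gtr0_norm//.
rewrite mulrCA -!mulrA ler_pM2l//; apply: le_trans (bulk_lip _ _) _.
rewrite (_ : 1 + e * a - _ = e * (a - b)); last by ring.
by rewrite normrM mulrCA.
Qed.

Lemma rescaled_joint_cont (e x : R) :
  continuous_at (e, x) (fun p : R * R => rescaled p.1 p.2).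
Proof.
have c1 : continuous_at (e, x) (fun p : R * R => p.1) by exact: cvg_fst.
have c2 : continuous_at (e, x) (fun p : R * R => p.2) by exact: cvg_snd.
have c3 : continuous_at (e, x) (fun p : R * R => slope (p.1 * p.2)).
  by apply: (@cfun_comp _ _ slope); [exact: slope_cont|cont].
by rewrite /rescaled; cont.
Qed.

Lemma rescaled_sol n e g y : radial_sol n (rescaled e) g y ->
  radial_sol n (fun x => mu * bulk x) (fun s => 1 + e * g s) (fun s => e * y s).
Proof.
case=> cg cy dg dy; split.
- by move=> s; move: (cg s) => ?; cont.
- by move=> s; move: (cy s) => ?; cont.
- by move=> s hs; move: (dg s hs) => ?; der_to; ring.
- move=> s hs; move: (dy s hs) => ?; der_to; rewrite -rescaledE; field.
  by apply/andP; split; rewrite gt_eqF//; lra.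
Qed.

End Rescaled.
End Truncation.
End Nonlinearity.

(** * A priori estimates: energy, positivity, large initial value *)

Section APriori.
Context {R : realType} (n : nat) (hn : (2 <= n)%N) (q M mu : R).
Hypotheses (q1 : 1 < q) (M2 : 2 <= M) (mu0 : 0 < mu).
Implicit Types (f y : R -> R) (s : R).

Let n0 : 0 < n%:R :> R. Proof. by rewrite ltr0n (ltn_trans _ hn). Qed.
Let M0 : 0 < M. Proof. by apply: lt_le_trans M2. Qed.
Let cbulk := bulk_cont q1 M2.
Let source x := mu * bulk q M x.
Let potential := primitive (bulk q M).

(** The friction term - (n - 1) (1 - s) y^2 dissipates the energy on the
    hemisphere s <= 1. *)
Lemma potential_le f y s : radial_sol n source f y -> 0 <= s <= 1 ->
  potential (f s) <= potential (f 0).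
Proof.
move=> [cf cy df dy] /andP[s0 s1].
pose E x := - (x * (2 - x) * y x ^+ 2 / 2 + mu * potential (f x)).
have dV x := is_derive_primitive x cbulk.
have cV x := is_derive_cont (dV x).
have : E 0 <= E s.
  refine (@derive_ge0_le _ E (fun x => (n%:R - 1) * (1 - x) * y x ^+ 2)
    _ _ s0 _ _ _) => x hx.
  - rewrite /E; have ? : continuous_at x (fun x => potential (f x)).
      by apply: cfun_comp; [exact: cV|exact: cf].
    by move: (cy x) => ?; cont.
  - have hx' : 0 < x < 3 / 2 by lra.
    have d1 : is_derive x 1 (fun x => potential (f x)) (bulk q M (f x) * y x).
      exact: (dfun_compR (dV (f x)) (df x hx')).
    move: (dy x hx') => ?; rewrite /E; der_to; rewrite /source /=; field.
    by apply/andP; split; rewrite gt_eqF//; lra.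
  - apply: mulr_ge0; last exact: sqr_ge0.
    by apply: mulr_ge0; [rewrite subr_ge0 ler1n (leq_trans _ hn)|lra].
rewrite /E !mul0r add0r lerNr opprK => h.
have h2 : 0 <= s * (2 - s) * y s ^+ 2 / 2.
  by rewrite divr_ge0// mulr_ge0 ?sqr_ge0// mulr_ge0//; lra.
by rewrite -(ler_pM2l mu0); lra.
Qed.

(** The energy bound confines f to a sublevel set of the potential. The
    potential is negative at f 0 < 1 but positive at M, by the condition on M,
    and it increases beyond 1, so that M is out of reach. *)
Lemma below_truncation f y s : 1 < (2 `^ q - 2) * (M - 2) ->
  radial_sol n source f y -> 0 < f 0 < M -> f 0 != 1 -> 0 <= s <= 1 -> f s < M.
Proof.
move=> hM sol /andP[f00 f0M] f01 hs; have := potential_le sol hs => h.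
have dV x := is_derive_primitive x cbulk.
have cV x (_ : x = x) := is_derive_cont (dV x).
rewrite ltNge; apply/negP => fM.
have [f0l|f0g|f0e] := ltgtP (f 0) 1; last by rewrite f0e eqxx in f01.
- have V1 : potential (f 0) < 0.
    have [c hc E] := @mean_value R potential (bulk q M) 0 (f 0) f00
      (fun x _ => is_derive_cont (dV x)) (fun x _ => dV x).
    rewrite [potential 0]primitive0 !subr0 in E; rewrite E pmulr_llt0//.
    by apply: bulk_lt0 => //; lra.
  have [c1 _ E1] := @mean_value R potential (bulk q M) 0 1 ltr01
      (fun x _ => is_derive_cont (dV x)) (fun x _ => dV x).
  rewrite [potential 0]primitive0 !subr0 mulr1 in E1.
  have b1 := bulk_geN1 q1 M2 c1.
  have lt12 : (1 : R) < 2 by rewrite ltr1n.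
  have [c2 hc2 E2] := @mean_value R potential (bulk q M) 1 2 lt12
      (fun x _ => is_derive_cont (dV x)) (fun x _ => dV x).
  have c21 : 1 < c2 by lra.
  have b2 := bulk_gt0 q1 M2 c21.
  have p2 : (2 : R) `^ q - 2 > 0.
    rewrite subr_gt0 -[ltLHS]powRr1//; rewrite /powR pnatr_eq0 /= ltr_expR mul1r.
    by rewrite ltr_pMl ?ln_gt0.
  have M2' : 2 < M.
    rewrite lt_neqAle M2 andbT; apply/eqP => e.
    by move: hM; rewrite -e subrr mulr0 ltr10.
  have [c3 hc3 E3] := @mean_value R potential (bulk q M) 2 M M2'
      (fun x _ => is_derive_cont (dV x)) (fun x _ => dV x).
  have b3 : 2 `^ q - 2 <= bulk q M c3.
    by apply: bulk_ge => //; [rewrite ler1n M2|lra].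
  have b3' : (2 `^ q - 2) * (M - 2) <= bulk q M c3 * (M - 2).
    by rewrite ler_wpM2r// subr_ge0.
  have E4 : potential M <= potential (f s).
    apply: (@derive_ge0_le R potential (bulk q M) M (f s) fM
      (fun x _ => is_derive_cont (dV x)) (fun x _ => dV x)) => x hx.
    by apply/ltW/bulk_gt0 => //; have := M2; lra.
  by lra.
- have fl : f 0 < f s by lra.
  have : potential (f 0) < potential (f s).
    apply: (@derive_gt0_lt R potential (bulk q M) _ _ fl
      (fun x _ => is_derive_cont (dV x)) (fun x _ => dV x)) => x hx.
    by apply: bulk_gt0 => //; lra.
  by lra.
Qed.

Lemma source_bound x : `|source x| <= mu * bulkL q M * `|x|.
Proof.
rewrite /source normrM gtr0_norm// -mulrA ler_pM2l//.
have := bulk_lip q1 M2 x 0; rewrite (bulk_le0 q1 M2 (lexx 0)) !subr0.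
by [].
Qed.

Lemma flux_derivE f y s : radial_sol n source f y -> 0 < s < 3 / 2 ->
  is_derive s 1 (fun x => weight x ^+ n * y x)
    (weight s ^+ n.-2 * - source (f s)).
Proof.
move=> [_ _ _ dy] hs; apply: (@is_derive_flux R n hn y (fun s => - source (f s))).
  by lra.
exact: dy.
Qed.

(** Once f vanishes the source switches off and the (negative) flux is
    conserved: such a solution cannot satisfy the Neumann condition. *)
Lemma neumann_gt0 f y : radial_sol n source f y -> 0 < f 0 -> y 1 = 0 ->
  forall s, 0 <= s <= 1 -> 0 < f s.
Proof.
move=> sol f0 y1 s /andP[s0 s1]; have [cf cy df dy] := sol.
rewrite ltNge; apply/negP => fs.
have sp : 0 < s.
  by rewrite lt_neqAle s0 andbT; apply/eqP => e; rewrite -e leNgt f0 in fs.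
have [c [/andP[c0 cs] fc below]] := first_zero sp cf f0 fs.
have L0 : 0 < mu * bulkL q M by rewrite mulr_gt0// bulkL_gt0.
have yc0 : y c != 0.
  apply/eqP => yc; have hc : 0 < c <= 1 by lra.
  have := radial_backward_unique hn L0 sol (fun s => source_bound (f s)) hc fc yc (s := 0).
  by rewrite lexx (ltW c0) => /(_ isT); move: f0 => /[swap] ->; rewrite ltxx.
have yc : y c < 0.
  rewrite lt_neqAle yc0 /= leNgt; apply/negP => ycp.
  have /cont_epsP/(_ _ ycp)[d d0 hd] := cy c.
  pose m := Num.min (d / 2) (c / 2).
  have m0 : 0 < m by rewrite lt_min !divr_gt0.
  have m1 : m <= d / 2 by rewrite ge_min lexx.
  have m2 : m <= c / 2 by rewrite ge_min lexx orbT.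
  have ac : c - m < c by lra.
  have [x hx E] := @mean_value R f y (c - m) c ac (fun x _ => cf x)
    (fun x hx => df x ltac:(lra)).
  have yx : 0 < y x.
    have := hd x; rewrite ler0_norm; last by lra.
    move=> /(_ _)H; have {H} : `|y x - y c| < y c by apply: H; lra.
    by rewrite ltr_norml => /andP[]; lra.
  have : 0 < f (c - m) by apply: below; lra.
  have : 0 < y x * (c - (c - m)) by rewrite mulr_gt0//; lra.
  by lra.
have c1 : c < 1.
  rewrite lt_neqAle (le_trans cs s1) andbT; apply/eqP => e.
  by move: yc; rewrite e y1 ltxx.
have cNy : continuous (fun x => - y x) by move=> x; move: (cy x) => ?; cont.
have [||c2 [/andP[cc2 c21] yc2 neg]] := @first_zero R (fun x => - y x) c 1 c1 cNy.
- by rewrite oppr_gt0.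
- by rewrite y1 oppr0.
have {}yc2 : y c2 = 0 by apply/eqP; rewrite -oppr_eq0 yc2.
have fneg x : c <= x < c2 -> f x <= 0.
  move=> /andP[cx xc2]; rewrite -oppr_ge0 -oppr0 -fc.
  apply: (@derive_ge0_le R (fun x => - f x) (fun x => - y x) c x cx) => z hz.
  - by move: (cf z) => ?; cont.
  - have hz' : 0 < z < 3 / 2 by lra.
    by move: (df z hz') => ?; der.
  - by apply/ltW/neg; lra.
have : weight c ^+ n * y c = weight c2 ^+ n * y c2.
  apply: (@derive_eq0_eq R (fun x => weight x ^+ n * y x)
    (fun x => weight x ^+ n.-2 * - source (f x)) c c2 (ltW cc2)) => x hx.
  - by move: (cy x) (@weight_cont R x) => ? ?; cont.
  - by apply: (flux_derivE sol); lra.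
  - have fx : f x <= 0 by apply: fneg; lra.
    by rewrite /source bulk_le0// mulr0 oppr0 mulr0.
rewrite yc2 mulr0 => /eqP; rewrite mulf_eq0 (negPf yc0) orbF gt_eqF//.
by rewrite exprn_gt0// weight_gt0//; lra.
Qed.

(** Up to this radius a solution that starts from the height M stays above
    M / 2, since its slope is at most fluxC mu M^q. *)
Definition core_radius : R := (2 * (fluxC n * mu))^-1 * M `^ (1 - q).

Lemma core_radius_gt0 : 0 < core_radius.
Proof.
have F0 := @fluxC_gt0 R n hn.
rewrite /core_radius; apply: mulr_gt0; last exact: powR_gt0.
by rewrite invr_gt0 mulr_gt0// mulr_gt0.
Qed.

(** For large M the flux through the boundary of the core exceeds mu, the
    most that the region f < 1 of the hemisphere can give back; hence f
    decreases all the way to the equator. *)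
Lemma large_decreasing f y : core_radius < 1 -> 2 <= (M / 2) `^ (q - 1) ->
  1 < Num.sqrt core_radius ^+ n * (M / 2) `^ q / n%:R ->
  radial_sol n source f y -> f 0 = M -> forall s, 0 < s <= 1 -> y s < 0.
Proof.
move=> r1 hM hflux sol f0; have [cf cy df dy] := sol.
have F0 := @fluxC_gt0 R n hn; have r0 := core_radius_gt0.
set r := core_radius in r0 r1 hflux.
pose B := (M / 2) `^ q; have B0 : 0 < B by rewrite powR_gt0// divr_gt0.
have yle s : 0 < s < 3 / 2 -> `|y s| <= fluxC n * (mu * M `^ q).
  move=> hs; apply: (flux_le hn cy (h := fun s => - source (f s)) dy hs) => x _.
  by rewrite normrN /source normrM gtr0_norm// ler_pM2l// bulk_norm_le.
have rE : fluxC n * (mu * M `^ q) * r = M / 2.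
  rewrite /r /core_radius (_ : _ * _ = (M `^ q * M `^ (1 - q)) / 2); last first.
    by field; rewrite !gt_eqF.
  rewrite -powRD ?(gt_eqF M0) ?implybT//.
  by rewrite (_ : q + (1 - q) = 1) ?powRr1 ?ltW//; ring.
have core s : 0 <= s <= r -> M / 2 <= f s.
  move=> /andP[]; rewrite le_eqVlt => /predU1P[<-|s0] sr.
    by rewrite f0; have := M0; lra.
  have [x hx E] := @mean_value R f y 0 s s0 (fun x _ => cf x)
    (fun x hx => df x ltac:(lra)).
  have hx' : 0 < x < 3 / 2 by lra.
  have := yle x hx'; rewrite ler_norml => /andP[yx _].
  have h1 : - (fluxC n * (mu * M `^ q)) * s <= y x * s by rewrite ler_wpM2r// ltW.
  have h2 : fluxC n * (mu * M `^ q) * s <= M / 2.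
    rewrite -rE ler_wpM2l// mulr_ge0 ?(ltW F0)//.
    by rewrite mulr_ge0 ?powR_ge0// ltW.
  by move: E h1; rewrite subr0 f0 mulNr; lra.
have bulkB s : 0 <= s <= r -> B / 2 <= bulk q M (f s).
  move=> hs; have h1 : 1 <= M / 2 <= M by have := M2; lra.
  have := bulk_ge q1 M2 h1 (core s hs); rewrite -/B => h2.
  have : M / 2 * 2 <= B.
    rewrite /B -mulr_powRB1 ?divr_ge0 ?(ltW M0) ?(lt_trans ltr01 q1)//.
    by rewrite ler_wpM2l// divr_ge0 ?ltW.
  by lra.
pose K := mu * (B / n%:R); have K0 : 0 < K by rewrite /K mulr_gt0// divr_gt0.
have inner s : 0 < s <= r -> Num.sqrt (2 - s) ^+ n * y s <= - K.
  move=> /andP[s0 sr]; have hs : 0 < s < 3 / 2 by lra.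
  have [x hx ->] := flux_mean hn cy (h := fun s => - source (f s)) dy hs.
  have hx' : 0 <= x <= r by lra.
  have h1 : 1 <= Num.sqrt (2 - x) ^+ n.-2.
    by rewrite exprn_ege1// -[leLHS]sqrtr1 ler_sqrt; lra.
  have h2 : mu * (B / 2) <= source (f x) by rewrite ler_pM2l// bulkB.
  have h3 : mu * (B / 2) <= Num.sqrt (2 - x) ^+ n.-2 * source (f x).
    by rewrite (le_trans h2)// ler_peMl// (le_trans _ h2)// !mulr_ge0 ?ltW.
  have h4 : 2 / n%:R * (mu * (B / 2)) <= 2 / n%:R * (Num.sqrt (2 - x) ^+ n.-2 * source (f x)).
    by rewrite ler_wpM2l// divr_ge0// ltW.
  rewrite mulrN mulrN lerN2; apply: le_trans h4.
  rewrite /K (_ : 2 / n%:R * (mu * (B / 2)) = mu * (B / n%:R))//.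
  by field; rewrite gt_eqF.
have r32 : 0 < r < 3 / 2 by lra.
have pos2 s : s <= 1 -> 0 < Num.sqrt (2 - s) ^+ n.
  by move=> s1; rewrite exprn_gt0// sqrtr_gt0; lra.
move=> s /andP[s0 s1]; have [sr|rs] := leP s r.
  have := inner s; rewrite s0 sr => /(_ isT) h.
  by rewrite -(pmulr_rlt0 _ (pos2 s s1)); lra.
have Pr : weight r ^+ n * y r < - mu.
  rewrite /weight sqrtrM ?(ltW r0)// exprMn -mulrA.
  have := inner r; rewrite r0 lexx => /(_ isT) h.
  have p1 : 0 < Num.sqrt r ^+ n by rewrite exprn_gt0// sqrtr_gt0.
  apply: (@le_lt_trans _ _ (Num.sqrt r ^+ n * - K)); first by rewrite ler_pM2l.
  rewrite mulrN ltrN2 /K mulrCA -[ltLHS]mulr1 ltr_pM2l//.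
  by rewrite mulrA.
have cP (x : R) : r <= x <= s -> continuous_at x (fun x => weight x ^+ n * y x).
  by move=> _; move: (cy x) (@weight_cont R x) => ? ?; cont.
have dP (x : R) : r < x < s -> is_derive x 1 (fun x => weight x ^+ n * y x)
    (weight x ^+ n.-2 * - source (f x)).
  by move=> hx; apply: (flux_derivE sol); lra.
have [x hx E] := mean_value rs cP dP.
have w1 : 0 <= weight x ^+ n.-2 <= 1.
  rewrite exprn_ge0 ?sqrtr_ge0//= exprn_ile1 ?sqrtr_ge0//.
  rewrite -[leRHS]sqrtr1 ler_sqrt//.
  by have := sqr_ge0 (1 - x); lra.
have w2 : weight x ^+ n.-2 * - source (f x) <= mu.
  have /andP[w3 w4] := w1; have := bulk_geN1 q1 M2 (f x) => b1.
  have b2 : - source (f x) <= mu.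
    by rewrite /source -mulrN -[leRHS]mulr1 ler_pM2l// lerNl.
  apply: (@le_trans _ _ (weight x ^+ n.-2 * mu)); first by rewrite ler_wpM2l.
  by rewrite ler_piMl// ltW.
have w3 : weight x ^+ n.-2 * - source (f x) * (s - r) <= mu.
  apply: (@le_trans _ _ (mu * (s - r))); first by rewrite ler_wpM2r//; lra.
  by rewrite ler_piMr ?(ltW mu0)//; lra.
have Ps : weight s ^+ n * y s < 0 by move: E w3 Pr; lra.
have ws : 0 < weight s ^+ n by rewrite exprn_gt0// weight_gt0//; lra.
by rewrite -(pmulr_rlt0 _ ws).
Qed.

End APriori.

(** * The family of zonal solutions *)

Section ZonalSolutions.
Context {R : realType}.

Definition zonal_solution (n : nat) (q mu a : R) : Prop :=
  exists f f1 f2 : R -> R,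
  [/\ forall t : R, is_derive t 1 f (f1 t),
      forall t : R, is_derive t 1 f1 (f2 t),
      continuous f2, f 1 = a
    & forall t : R, `|t| <= 1 -> 0 < f t /\
      (1 - t ^+ 2) * f2 t - n%:R * t * f1 t + mu * (f t `^ q - f t) = 0].

Lemma powR_eventually_gt (g B : R) : 0 < g ->
  exists M0, forall M, M0 <= M -> B < M `^ g.
Proof.
move=> g0; exists ((`|B| + 1) `^ g^-1) => M hM.
have B1 : 0 < `|B| + 1 by rewrite ltr_wpDl.
apply: (@lt_le_trans _ _ (`|B| + 1)).
  by apply: (le_lt_trans (ler_norm B)); rewrite ltrDl.
have -> : `|B| + 1 = ((`|B| + 1) `^ g^-1) `^ g.
  by rewrite -powRrM mulVf ?gt_eqF// powRr1// ltW.
rewrite ge0_ler_powR ?nnegrE ?powR_ge0//; first exact: ltW.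
exact: le_trans (powR_ge0 _ _) hM.
Qed.

(** The exponent of M in the flux condition is q - (q - 1) n / 2, positive
    exactly when q (n - 2) < n. *)
Lemma truncation_exists (n : nat) (q mu : R) : (2 <= n)%N -> 1 < q ->
  q * (n%:R - 2) < n%:R -> 0 < mu -> exists M,
  [/\ 2 <= M, 1 < (2 `^ q - 2) * (M - 2), core_radius n q M mu < 1,
      2 <= (M / 2) `^ (q - 1)
    & 1 < Num.sqrt (core_radius n q M mu) ^+ n * (M / 2) `^ q / n%:R].
Proof.
move=> hn q1 qn mu0.
have n0 : 0 < n%:R :> R by rewrite ltr0n (ltn_trans _ hn).
have F0 := @fluxC_gt0 R n hn.
have k0 : 0 < (2 * (fluxC n * mu))^-1 by rewrite invr_gt0 mulr_gt0// mulr_gt0.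
set k := (2 * (fluxC n * mu))^-1 in k0.
have p2 : (2 : R) `^ q - 2 > 0.
  rewrite subr_gt0 -[ltLHS]powRr1//; rewrite /powR pnatr_eq0 /= ltr_expR mul1r.
  by rewrite ltr_pMl ?ln_gt0// ltr1n.
have qm0 : 0 < q - 1 by rewrite subr_gt0.
pose g := q + (1 - q) * (n%:R / 2).
have g0 : 0 < g by rewrite /g; lra.
pose c := k `^ (n%:R / 2) * 2^-1 `^ q / n%:R.
have c0 : 0 < c.
  rewrite /c; apply: divr_gt0 => //; apply: mulr_gt0; first exact: powR_gt0.
  by apply: powR_gt0; rewrite invr_gt0.
have h20 : 0 < 2^-1 `^ (q - 1) :> R by rewrite powR_gt0 ?invr_gt0.
have [A hA] := powR_eventually_gt k qm0.
have [B hB] := powR_eventually_gt (2 / 2^-1 `^ (q - 1)) qm0.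
have [C hC] := powR_eventually_gt c^-1 g0.
pose M := Num.max (3 + (2 `^ q - 2)^-1) (Num.max A (Num.max B C)).
have [h3 MA MB MC] : [/\ 3 + (2 `^ q - 2)^-1 <= M, A <= M, B <= M & C <= M].
  by rewrite /M !le_max !lexx ?orbT.
have i0 : 0 < (2 `^ q - 2)^-1 by rewrite invr_gt0.
have M2 : 2 < M by lra.
have M0 : 0 < M by lra.
have Mq := hA M MA.
exists M; split.
- exact: ltW.
- rewrite mulrC -ltr_pdivrMr// mul1r; lra.
- rewrite /core_radius -/k -opprB powRN ltr_pdivrMr ?powR_gt0// mul1r.
  exact: Mq.
- rewrite powRM ?invr_ge0 ?(ltW M0)// -ler_pdivrMr//; exact/ltW/hB.
- rewrite -powR12_sqrt; last exact: ltW (core_radius_gt0 hn q (ltW M2) mu0).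
  rewrite -powR_mulrn ?powR_ge0// -powRrM [_^-1 * _]mulrC.
  rewrite /core_radius -/k !powRM ?powR_ge0 ?(ltW k0) ?(ltW M0) ?invr_ge0// -powRrM.
  rewrite (_ : _ / n%:R = c * (M `^ ((1 - q) * (n%:R / 2)) * M `^ q)); last first.
    by rewrite /c; ring.
  rewrite -powRD ?(gt_eqF M0) ?implybT// -[ltLHS](mulfV (lt0r_neq0 c0)).
  rewrite ltr_pM2l// [(1 - q) * _ + q]addrC; exact: hC.
Qed.

Lemma zonal_solution_const n (q mu : R) : zonal_solution n q mu 1.
Proof.
exists (fun=> 1), (fun=> 0), (fun=> 0); split=> //.
- by move=> t; der.
- by move=> t; der.
- by move=> t; cont.
- by move=> t _; rewrite ltr01 powR1 !mulr0 !subrr mulr0 addr0.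
Qed.

Section Branches.
Variables (n m : nat) (q mu : R).
Hypotheses (hn : (2 <= n)%N) (q1 : 1 < q) (qn : q * (n%:R - 2) < n%:R)
  (mu0 : 0 < mu) (hm : eigenvalue_of n m.*2 < mu * (q - 1)).

(** Shooting in the value 1 + e at the pole. The phase at the equator is below
    pi for e = - 1, where the solution is constant 0, and for e = M - 1, where
    it is decreasing, and above m pi for e = 0, where the rescaled equation is
    linear. So each level j pi with 0 < j <= m, that is, each solution with a
    Neumann condition at the equator, occurs on both sides of e = 0. *)
Lemma zonal_solutions : exists A : option (bool * 'I_m) -> R,
  injective A /\ forall i, zonal_solution n q mu (A i).
Proof.
have [M [M2 hM1 hM2 hM3 hM4]] := truncation_exists hn q1 qn mu0.
have L0 : 0 < mu * bulkL q M by rewrite mulr_gt0// bulkL_gt0.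
pose N e := rescaled q M mu e.
have lN e : lipschitz_with (mu * bulkL q M) (N e).
  by apply: rescaled_lip.
have cN e : continuous (N e) := lipschitz_with_cont L0 (lN e).
have /choice[G hG] : forall e : R, exists G : (R -> R) * (R -> R),
    radial_sol n (N e) G.1 G.2 /\ G.1 0 = 1.
  move=> e; have [g [y [sol g0]]] := radial_sol_exists hn 1 L0 (lN e).
  by exists (g, y).
pose g e := (G e).1; pose y e := (G e).2.
have sol e : radial_sol n (N e) (g e) (y e) by case: (hG e).
have g0 e : g e 0 = 1 by case: (hG e).
have N0 e : N e 0 = 0 := rescaled0 q M mu e.
have hN e s : `|N e (g e s)| <= mu * bulkL q M * `|g e s|.
  exact: lipschitz_with_bound.
pose al e := angle n (N e) (g e) (y e) 1.
have cal : continuous al.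
  have jN (e x : R) : continuous_at (e, x) (fun p : R * R => N p.1 p.2).
    exact: rescaled_joint_cont.
  by move=> e0; exact: (angle_family_cont hn L0 lN N0 jN sol g0).
have pi0 := @pi_gt0 R.
have al0 : m%:R * pi < al 0.
  have lin := rescaled_linear q M mu.
  have := sol 0; rewrite /al /N lin => sol0.
  exact: (angle_linear_gt hn hm sol0 (g0 0)).
have fsol (e : R) : radial_sol n (fun x => mu * bulk q M x)
    (fun s => 1 + e * g e s) (fun s => e * y e s).
  exact: rescaled_sol (sol e).
have alN1 : al (- 1) < pi.
  have f0 s : 0 <= s <= 1 -> g (- 1) s = 1 /\ y (- 1) s = 0.
    move=> hs.
    have [C C0 hC] := radial_stability hn L0.
    have lb : lipschitz_with (mu * bulkL q M) (fun x => mu * bulk q M x).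
      by move=> a b; rewrite -mulrBr normrM gtr0_norm// -mulrA ler_pM2l// bulk_lip.
    have z0 : radial_sol n (fun x => mu * bulk q M x) (fun=> 0) (fun=> 0).
      have b0 : bulk q M 0 = 0 by apply: bulk_le0.
      split.
      - by move=> x; cont.
      - by move=> x; cont.
      - by move=> x _; der.
      - by move=> x _; rewrite b0; der_to; ring.
    have h0 : forall s : R, 0 <= s <= 3 / 2 ->
        `|mu * bulk q M 0 - mu * bulk q M 0| <= 0.
      by move=> x _; rewrite subrr normr0.
    have hs' : 0 <= s < 3 / 2 by lra.
    have [] := hC _ _ _ _ _ _ 0 lb (fsol (- 1)) z0 h0 s hs'.
    rewrite g0 mulr1 !subr0 subrr normr0 addr0 mulr0 !normr_le0 => /eqP a /eqP b.
    by split; lra.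
  have -> // : al (- 1) = 0.
  have ct := turning_cont hn L0 (cN (- 1)) (sol (- 1)) (hN (- 1)) (g0 (- 1)).
  rewrite -[RHS](primitive0 (fun s => turning n (N (- 1)) (g (- 1)) (y (- 1)) (unit_clamp s))).
  apply/esym; apply: (@derive_eq0_eq R _
    (fun s => turning n (N (- 1)) (g (- 1)) (y (- 1)) (unit_clamp s))
    0 1 ler01 (fun x _ => primitive_cont ct x)
    (fun x _ => is_derive_primitive x ct)) => x _.
  rewrite /turning; have [-> ->] := f0 _ (unit_clamp_itv x).
  have -> : N (- 1) 1 = 0.
    have : - 1 * N (- 1) 1 = mu * bulk q M (1 + - 1 * 1) by exact: rescaledE.
    by rewrite mulr1 subrr bulk_le0// mulr0; lra.
  by rewrite expr0n !(mulr0, mul0r, oppr0, addr0).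
have alM : al (M - 1) < pi.
  apply: (angle_lt_pi hn L0 (cN _) (sol _) (hN _) (g0 _)) => s hs.
  have := large_decreasing hn q1 M2 mu0 hM2 hM3 hM4 (fsol (M - 1)).
  rewrite g0 mulr1 addrC subrK => /(_ erefl s hs).
  by apply: contraTneq => ->; rewrite mulr0 ltxx.
have good e : - 1 < e < M - 1 -> e != 0 -> sin (al e) = 0 ->
    zonal_solution n q mu (1 + e).
  move=> he e0 sal; have y1 : y e 1 = 0.
    exact: (angle_sin_eq0 hn L0 (cN e) (sol e) (hN e) (g0 e)).1.
  pose f s := 1 + e * g e s; pose Y s := e * y e s.
  have fs : radial_sol n (fun x => mu * bulk q M x) f Y := fsol e.
  have f0 : f 0 = 1 + e by rewrite /f g0 mulr1.
  have Y1 : Y 1 = 0 by rewrite /Y y1 mulr0.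
  have fpos : forall s, 0 <= s <= 1 -> 0 < f s.
    by apply: (neumann_gt0 hn q1 M2 mu0 fs) => //; rewrite f0; lra.
  have flt s : 0 <= s <= 1 -> f s < M.
    apply: (below_truncation hn q1 M2 mu0 hM1 fs); first by rewrite f0; lra.
    by apply: contra_neq e0; rewrite f0; lra.
  have [cf cY df dY] := fs.
  have cb : continuous (fun x => mu * bulk q M x).
    move=> x; have ? : continuous_at x (bulk q M) by exact: bulk_cont.
    by cont.
  have r0 : 0 < (1 : R) <= 1 by rewrite ltr01 lexx.
  have dNg (s : R) : 0 < s < 1 -> is_derive s 1 (fun x => mu * bulk q M (f x))
      (mu * (q * f s `^ (q - 1) - 1) * Y s).
    move=> hs; have hf : 0 < f s < M by rewrite fpos ?flt//; lra.
    have hs' : 0 < s < 3 / 2 by lra.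
    have db : is_derive (f s) 1 (bulk q M) (q * f s `^ (q - 1) - 1).
      exact: is_derive_bulk.
    have := dfun_compR db (df s hs') => ?.
    by der_to; ring.
  have cdN : continuous_at 0 (fun s => mu * (q * f s `^ (q - 1) - 1) * Y s).
    have : continuous_at 0 (fun s => f s `^ (q - 1)).
      apply: (@cfun_comp _ _ (fun x => x `^ (q - 1)) f); last exact: cf.
      by apply: is_derive_cont (is_derive1_powR _ _); rewrite f0; lra.
    by move: (cf 0) (cY 0) => ? ? ?; cont.
  have [phi [phi1 [phi2 [d1 d2 c2 E]]]] := zonal_profile hn fs cb r0 dNg cdN Y1.
  exists phi, phi1, phi2; split=> //.
    have [|-> _] := E 1; first by rewrite normr1.
    by rewrite normr1 subrr f0.
  move=> t ht; have [Et eq] := E t ht.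
  have hs : 0 <= 1 - `|t| <= 1 by have := normr_ge0 t; lra.
  have fp := fpos _ hs; have fl := flt _ hs.
  split; first by rewrite Et.
  by rewrite -eq Et /bulk clip_id// !ltW.
have lvl (j : 'I_m) : (pi : R) <= j.+1%:R * (pi : R) <= m%:R * (pi : R).
  apply/andP; split; first by rewrite ler_peMl ?(ltW pi0) ?ler1n.
  by rewrite (ler_pM2r pi0) ler_nat.
have sinlvl (j : nat) : sin (j%:R * pi) = 0 :> R.
  elim: j => [|j IH]; first by rewrite mul0r sin0.
  by rewrite -natr1 mulrDl mul1r sinDpi IH oppr0.
have /choice[e he] : forall bj : bool * 'I_m, exists e : R,
    [/\ -1 < e < M - 1, (0 < e) = bj.1, e != 0 & al e = bj.2.+1%:R * pi].
  move=> [b j] /=.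
  have /andP[l1 l2] := lvl j.
  case: b.
  - have M1 : (0 : R) <= M - 1 by lra.
    have [|e] := @IVT R al 0 (M - 1) (j.+1%:R * pi) M1 (@cont_within _ _ _ _ (fun x _ => cal x)).
      by rewrite ge_min le_max; apply/andP; split; apply/orP; [right|left]; lra.
    rewrite in_itv /= => /andP[e0 eM] E; exists e.
    have eM1 : e != M - 1 by apply/eqP => h; rewrite h in E; lra.
    have e00 : e != 0 by apply/eqP => h; rewrite h in E; lra.
    have ep : 0 < e by rewrite lt_neqAle eq_sym e00.
    by split=> //; apply/andP; split; [lra|rewrite lt_neqAle eM1].
  - have M1 : (- 1 : R) <= 0 by lra.
    have [|e] := @IVT R al (- 1) 0 (j.+1%:R * pi) M1 (@cont_within _ _ _ _ (fun x _ => cal x)).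
      by rewrite ge_min le_max; apply/andP; split; apply/orP; [left|right]; lra.
    rewrite in_itv /= => /andP[e0 eM] E; exists e.
    have eM1 : e != - 1 by apply/eqP => h; rewrite h in E; lra.
    have e00 : e != 0 by apply/eqP => h; rewrite h in E; lra.
    have ep : -1 < e by rewrite lt_neqAle eq_sym eM1.
    split=> //; first by rewrite ep /=; lra.
    by rewrite ltNge eM.
exists (fun i => if i is Some bj then 1 + e bj else 1); split.
- have inj : forall bj bj', e bj = e bj' -> bj = bj'.
    move=> [b j] [b' j'] E; have [_ s1 _ a1] := he (b, j); have [_ s2 _ a2] := he (b', j').
    have bb : b = b' by rewrite E s2 in s1.
    congr (_, _) => //; apply/val_inj.
    move: a1; rewrite E a2 /= => /(mulIf (lt0r_neq0 pi0)) /eqP.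
    by rewrite eqr_nat eqSS => /eqP.
  have nz bj : 1 + e bj <> 1.
    have [_ _ + _] := he bj => /eqP + h; apply; lra.
  move=> [bj|] [bj'|] //.
  + by move=> h; congr Some; apply: inj; lra.
  + by move=> h; case: (nz bj).
  + by move=> h; case: (nz bj').
- case=> [bj|]; last exact: zonal_solution_const.
  by have [h1 _ h2 h3] := he bj; apply: good => //; rewrite h3.
Qed.

End Branches.
End ZonalSolutions.

(** * Functions of class C^2 on R^m *)

Section ClassC.
Context {R : realType} {m : nat}.
Implicit Types (f g : 'rV[R]_m -> R) (z v : 'rV[R]_m).

Lemma is_derive_coord z v k : is_derive z v (fun x : 'rV[R]_m => x 0 k) (v 0 k).
Proof.
apply/is_derive_restrict.
have -> : (fun h : R => (h *: v + z) 0 k) = fun h => h * v 0 k + z 0 k.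
  by apply/funext => h; rewrite !mxE.
by der_to; ring.
Qed.

Lemma coord_cont k : continuous (fun x : 'rV[R]_m => x 0 k).
Proof. exact: coord_continuous. Qed.

Lemma pderiveE i f z d : is_derive z (delta_mx 0 i) f d -> pderive i f z = d.
Proof. by case. Qed.

Lemma classC1_is_derive i f z : classC1 f ->
  is_derive z (delta_mx 0 i) f (pderive i f z).
Proof. by case=> _ /(_ i)[/(_ z) h _]; exact: derivableP. Qed.

Lemma classC1_intro f (d : 'I_m -> 'rV[R]_m -> R) : continuous f ->
  (forall i z, is_derive z (delta_mx 0 i) f (d i z)) ->
  (forall i, continuous (d i)) -> classC1 f.
Proof.
move=> cf df cd; split=> // i; split=> [z|]; first by case: (df i z).
have -> : pderive i f = d i by apply/funext => z; exact: pderiveE.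
exact: cd.
Qed.

Lemma classC1_cst (c : R) : classC1 (fun _ : 'rV[R]_m => c).
Proof.
refine (@classC1_intro _ (fun _ _ => 0) _ _ _) => [|i].
- exact: cst_continuous.
- exact: cst_continuous.
Qed.

Lemma classC1_coord k : classC1 (fun z : 'rV[R]_m => z 0 k).
Proof.
refine (@classC1_intro _ (fun i _ => (delta_mx 0 i : 'rV[R]_m) 0 k) _ _ _) => [|i z|i].
- exact: coord_cont.
- exact: is_derive_coord.
- exact: cst_continuous.
Qed.

Lemma pderiveD i f g : classC1 f -> classC1 g ->
  pderive i (fun z => f z + g z) = fun z => pderive i f z + pderive i g z.
Proof.
by move=> hf hg; apply/funext => z; apply: pderiveE; apply: dfunD; exact: classC1_is_derive.
Qed.

Lemma pderiveM i f g : classC1 f -> classC1 g ->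
  pderive i (fun z => f z * g z) = fun z => f z * pderive i g z + g z * pderive i f z.
Proof.
by move=> hf hg; apply/funext => z; apply: pderiveE; apply: dfunM; exact: classC1_is_derive.
Qed.

Lemma pderiveV i f : (forall z, f z != 0) -> classC1 f ->
  pderive i (fun z => (f z)^-1) =
  fun z => - 1 * ((f z)^-1 * (f z)^-1) * pderive i f z.
Proof.
move=> f0 hf; apply/funext => z; apply: pderiveE.
apply: dfun_eq; first by apply: dfunV; [exact: f0|exact: classC1_is_derive].
by rewrite expr2 invfM; ring.
Qed.

Lemma pderive_comp i (phi phi1 : R -> R) f :
  (forall t : R, is_derive t 1 phi (phi1 t)) -> classC1 f ->
  pderive i (fun z => phi (f z)) = fun z => phi1 (f z) * pderive i f z.
Proof.
move=> dphi hf; apply/funext => z; apply: pderiveE.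
exact: dfun_comp (dphi _) (classC1_is_derive _ _ hf).
Qed.

Lemma classC1_pderive_cont i f : classC1 f -> continuous (pderive i f).
Proof. by case=> _ /(_ i)[]. Qed.

Lemma classC1D f g : classC1 f -> classC1 g -> classC1 (fun z => f z + g z).
Proof.
move=> hf hg; have [cf _] := hf; have [cg _] := hg; split=> [z|i].
  by move: (cf z) (cg z) => ? ?; cont.
split=> [z|].
  by case: (dfunD (classC1_is_derive i z hf) (classC1_is_derive i z hg)).
rewrite pderiveD// => z.
by move: (@classC1_pderive_cont i f hf z) (@classC1_pderive_cont i g hg z) => ? ?; cont.
Qed.

Lemma classC1M f g : classC1 f -> classC1 g -> classC1 (fun z => f z * g z).
Proof.
move=> hf hg; have [cf _] := hf; have [cg _] := hg; split=> [z|i].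
  by move: (cf z) (cg z) => ? ?; cont.
split=> [z|].
  by case: (dfunM (classC1_is_derive i z hf) (classC1_is_derive i z hg)).
rewrite pderiveM// => z; move: (cf z) (cg z).
by move: (@classC1_pderive_cont i f hf z) (@classC1_pderive_cont i g hg z) => ? ? ? ?; cont.
Qed.

Lemma classC1V f : (forall z, f z != 0) -> classC1 f -> classC1 (fun z => (f z)^-1).
Proof.
move=> f0 hf; have [cf _] := hf; split=> [z|i].
  by move: (cf z) => ?; cont.
split=> [z|].
  by case: (dfunV (f0 z) (classC1_is_derive i z hf)).
rewrite pderiveV// => z; move: (cf z).
by move: (@classC1_pderive_cont i f hf z) => ? ?; cont.
Qed.

Lemma classC1_comp (phi phi1 : R -> R) f :
  (forall t : R, is_derive t 1 phi (phi1 t)) -> continuous phi1 ->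
  classC1 f -> classC1 (fun z => phi (f z)).
Proof.
move=> dphi cphi1 hf; have [cf _] := hf; split=> [z|i].
  by apply: cfun_comp; [exact: is_derive_cont (dphi _)|exact: cf].
split=> [z|].
  by case: (dfun_comp (dphi (f z)) (classC1_is_derive i z hf)).
rewrite (pderive_comp i dphi hf) => z.
have ? : continuous_at z (fun z => phi1 (f z)).
  by apply: cfun_comp; [exact: cphi1|exact: cf].
by move: (@classC1_pderive_cont i f hf z) => ?; cont.
Qed.

Lemma classC2_cst (c : R) : classC2 (fun _ : 'rV[R]_m => c).
Proof.
split=> [|i]; first exact: classC1_cst.
have -> : pderive i (fun _ : 'rV[R]_m => c) = fun=> 0.
  by apply/funext => z; apply: pderiveE; exact: dfun_cst.
exact: classC1_cst.
Qed.

Lemma classC2_coord k : classC2 (fun z : 'rV[R]_m => z 0 k).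
Proof.
split=> [|i]; first exact: classC1_coord.
have -> : pderive i (fun z : 'rV[R]_m => z 0 k) = fun=> (delta_mx 0 i : 'rV[R]_m) 0 k.
  by apply/funext => z; apply: pderiveE; exact: is_derive_coord.
exact: classC1_cst.
Qed.

Lemma classC2D f g : classC2 f -> classC2 g -> classC2 (fun z => f z + g z).
Proof.
move=> [hf hf'] [hg hg']; split=> [|i]; first exact: classC1D.
rewrite (pderiveD i hf hg); exact: classC1D (hf' i) (hg' i).
Qed.

Lemma classC2M f g : classC2 f -> classC2 g -> classC2 (fun z => f z * g z).
Proof.
move=> [hf hf'] [hg hg']; split=> [|i]; first exact: classC1M.
rewrite (pderiveM i hf hg).
exact: classC1D (classC1M hf (hg' i)) (classC1M hg (hf' i)).
Qed.

Lemma classC2V f : (forall z, f z != 0) -> classC2 f -> classC2 (fun z => (f z)^-1).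
Proof.
move=> f0 [hf hf']; split=> [|i]; first exact: classC1V.
rewrite (pderiveV i f0 hf); have hV := classC1V f0 hf.
exact: classC1M (classC1M (classC1_cst _) (classC1M hV hV)) (hf' i).
Qed.

Lemma classC2_comp (phi phi1 phi2 : R -> R) f :
  (forall t : R, is_derive t 1 phi (phi1 t)) ->
  (forall t : R, is_derive t 1 phi1 (phi2 t)) -> continuous phi2 ->
  classC2 f -> classC2 (fun z => phi (f z)).
Proof.
move=> d1 d2 c2 [hf hf'].
have c1 : continuous phi1 by move=> t; exact: is_derive_cont (d2 t).
split=> [|i]; first exact: classC1_comp d1 c1 hf.
rewrite (pderive_comp i d1 hf).
exact: classC1M (classC1_comp d2 c2 hf) (hf' i).
Qed.

Lemma classC2_sum k (f : 'I_k -> 'rV[R]_m -> R) : (forall i, classC2 (f i)) ->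
  classC2 (fun z => \sum_(i < k) f i z).
Proof.
elim: k f => [|k IH] f hf.
  have -> : (fun z => \sum_(i < 0) f i z) = fun=> 0.
    by apply/funext => z; rewrite big_ord0.
  exact: classC2_cst.
have -> : (fun z => \sum_(i < k.+1) f i z) =
    fun z => f ord0 z + \sum_(i < k) f (lift ord0 i) z.
  by apply/funext => z; rewrite big_ord_recl.
by apply: classC2D => //; apply: IH.
Qed.

End ClassC.

(** * Stereographic coordinates *)

Section Stereographic.
Context {R : realType} (n : nat).
Implicit Types (s : bool) (xi : 'rV[R]_n) (Y : 'rV[R]_n.+1).

(** Half the conformal factor of stereographic coordinates. *)
Definition conformal xi : R := (1 + dotv xi xi)^-1.

Definition sgn s : R := (-1) ^+ s.

Lemma sgn_sqr s : sgn s * sgn s = 1.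
Proof. by rewrite /sgn; case: s; rewrite ?expr1 ?expr0; ring. Qed.

Lemma one_plus_dotv_neq0 xi : 1 + dotv xi xi != 0.
Proof. by rewrite gt_eqF// ltr_wpDr// dotv_ge0. Qed.

Lemma conformal_gt0 xi : 0 < conformal xi.
Proof. by rewrite invr_gt0 ltr_wpDr// dotv_ge0. Qed.

Lemma stereo_inv0 s xi :
  stereo_inv s xi 0 ord0 = conformal xi * (sgn s * (dotv xi xi - 1)).
Proof.
rewrite /stereo_inv mxE -/(conformal xi); congr (_ * _).
have -> : ord0 = lshift n (ord0 : 'I_1) by apply/val_inj.
by rewrite (row_mxEl _ _ 0 (ord0 : 'I_1)) mxE eqxx mulr1n.
Qed.

Lemma stereo_invS s xi k :
  stereo_inv s xi 0 (lift ord0 k) = conformal xi * (2 * xi 0 k).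
Proof.
rewrite /stereo_inv mxE -/(conformal xi); congr (_ * _).
have -> : lift ord0 k = rshift 1 k by apply/val_inj.
by rewrite (row_mxEr _ _ 0 k) mxE.
Qed.

Definition tail Y : 'rV[R]_n := \row_k Y 0 (lift ord0 k).

Lemma dotv_recl Y Z : dotv Y Z = Y 0 ord0 * Z 0 ord0 + dotv (tail Y) (tail Z).
Proof. by rewrite /dotv big_ord_recl; congr (_ + _); apply: eq_bigr => k _; rewrite !mxE. Qed.

Lemma dotv_stereo s xi Y : dotv (stereo_inv s xi) Y =
  conformal xi * (sgn s * Y 0 ord0 * (dotv xi xi - 1) + 2 * dotv xi (tail Y)).
Proof.
rewrite dotv_recl stereo_inv0.
have -> : dotv (tail (stereo_inv s xi)) (tail Y) = conformal xi * 2 * dotv xi (tail Y).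
  rewrite /dotv mulr_sumr; apply: eq_bigr => k _.
  have -> : tail (stereo_inv s xi) 0 k = conformal xi * (2 * xi 0 k).
    by rewrite mxE stereo_invS.
  by ring.
ring.
Qed.

Lemma is_derive_dotvl xi v (a : 'rV[R]_n) :
  is_derive xi v (fun z => dotv z a) (dotv v a).
Proof.
apply: dfun_sum => k; have := is_derive_coord xi v k => ?.
by der_to; ring.
Qed.

Lemma is_derive_dotv2 xi v : is_derive xi v (fun z => dotv z z) (2 * dotv v xi).
Proof.
rewrite /dotv mulr_sumr; apply: dfun_sum => k; have := is_derive_coord xi v k => ?.
by der_to; ring.
Qed.

Lemma dotv_delta i (a : 'rV[R]_n) : dotv (delta_mx 0 i) a = a 0 i.
Proof.
rewrite /dotv (bigD1 i)//= big1 ?addr0 => [|k ki]; last first.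
  by rewrite mxE (negPf ki) andbF mul0r.
by rewrite mxE !eqxx mul1r.
Qed.

Lemma is_derive_conformal xi i :
  is_derive xi (delta_mx 0 i) conformal (- 2 * xi 0 i * conformal xi ^+ 2).
Proof.
have := is_derive_dotv2 xi (delta_mx 0 i); rewrite dotv_delta => ?.
rewrite /conformal; der_to; first exact: one_plus_dotv_neq0.
by rewrite exprVn; ring.
Qed.

Lemma is_derive_conformalX xi i k :
  is_derive xi (delta_mx 0 i) (fun z => conformal z ^+ k)
    (- 2 * k%:R * xi 0 i * conformal xi ^+ k.+1).
Proof.
have := is_derive_conformal xi i => ?; der_to.
by case: k => [|k] /=; [ring|rewrite !exprS; ring].
Qed.

Section Slice.
Variables (s : bool) (Y : 'rV[R]_n.+1).

Let tau xi := dotv (stereo_inv s xi) Y.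
Let a := sgn s * Y 0 ord0.
Let b xi := dotv xi (tail Y).

(** The i-th partial derivative of the height in the direction Y. *)
Definition height_grad i xi : R :=
  4 * conformal xi ^+ 2 * xi 0 i * (a - b xi) + 2 * conformal xi * tail Y 0 i.

Lemma is_derive_height i xi :
  is_derive xi (delta_mx 0 i) tau (height_grad i xi).
Proof.
have -> : tau = fun z => conformal z * (a * (dotv z z - 1) + 2 * b z).
  by apply/funext => z; rewrite /tau dotv_stereo.
have := is_derive_conformal xi i; have := is_derive_dotv2 xi (delta_mx 0 i).
have := is_derive_dotvl xi (delta_mx 0 i) (tail Y); rewrite !dotv_delta -/b => ? ? ?.
der_to; rewrite /height_grad /conformal; field.
exact: one_plus_dotv_neq0.
Qed.

(** Divergence form of the zonal Laplacian: in stereographic coordinates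
    w^(- n) div (w^(n - 2) grad (f o tau)) / 4 = (1 - tau^2) f'' - n tau f'. The
    derivative D i is a combination of xi_i^2, xi_i y_i, y_i^2 and 1, with y the
    horizontal part of Y; summing leaves norms and inner products, which the
    equation of the sphere eliminates. *)
Lemma zonal_divergence (f1 f2 : R -> R) xi :
  (2 <= n)%N -> (forall t : R, is_derive t 1 f1 (f2 t)) -> dotv Y Y = 1 ->
  exists D : 'I_n -> R,
  (forall i, is_derive xi (delta_mx 0 i)
     (fun z => conformal z ^+ n.-2 * (f1 (tau z) * height_grad i z)) (D i)) /\
  \sum_(i < n) D i = 4 * conformal xi ^+ n *
     ((1 - tau xi ^+ 2) * f2 (tau xi) - n%:R * tau xi * f1 (tau xi)).
Proof.
move=> hn df1 YY.
set w := conformal xi; set F1 := f1 (tau xi); set F2 := f2 (tau xi).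
pose A := - 8 * n.-2%:R * w ^+ n.-2.+1 * F1 * w ^+ 2 * (a - b xi)
  + w ^+ n.-2 * F2 * (16 * w ^+ 4 * (a - b xi) ^+ 2)
  - 16 * w ^+ n.-2 * F1 * w ^+ 3 * (a - b xi).
pose B := - 4 * n.-2%:R * w ^+ n.-2.+1 * F1 * w
  + w ^+ n.-2 * F2 * (16 * w ^+ 3 * (a - b xi)) - 8 * w ^+ n.-2 * F1 * w ^+ 2.
pose C := w ^+ n.-2 * F2 * (4 * w ^+ 2).
pose E := w ^+ n.-2 * F1 * (4 * w ^+ 2 * (a - b xi)).
pose y := tail Y.
exists (fun i => A * (xi 0 i * xi 0 i) + B * (xi 0 i * y 0 i) + C * (y 0 i * y 0 i) + E).
split=> [i|].
  have d1 := is_derive_conformalX xi i n.-2.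
  have d2 := is_derive_conformal xi i.
  have d3 := is_derive_dotvl xi (delta_mx 0 i) (tail Y).
  rewrite dotv_delta -/b in d3.
  have d4 : is_derive xi (delta_mx 0 i) (fun z => f1 (tau z)) (F2 * height_grad i xi).
    exact: dfun_comp (df1 _) (is_derive_height i xi).
  have d5 : is_derive xi (delta_mx 0 i) (fun z : 'rV[R]_n => z 0 i) 1.
    by have := is_derive_coord xi (delta_mx 0 i) i; rewrite mxE !eqxx.
  have d6 : is_derive xi (delta_mx 0 i) (height_grad i)
      (4 * w ^+ 2 * (a - b xi) - 16 * w ^+ 3 * xi 0 i * xi 0 i * (a - b xi)
       - 8 * w ^+ 2 * xi 0 i * y 0 i).
    rewrite /height_grad; der_to; rewrite /= -/w -/y; ring.
  notypeclasses refine (dfun_eq (dfunM d1 (dfunM d4 d6)) _).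
  rewrite /= -/F1 -/w /height_grad -/w -/y /A /B /C /E; ring.
rewrite !big_split /= -!mulr_sumr sumr_const card_ord -/(dotv xi xi).
rewrite -/(dotv xi y) -/(dotv y y) -[dotv xi y]/(b xi) -mulr_natr.
have yy : dotv y y = 1 - Y 0 ord0 ^+ 2.
  by rewrite -YY (dotv_recl Y Y) -/y; ring.
have aa : Y 0 ord0 ^+ 2 = a ^+ 2.
  by rewrite /a exprMn [sgn s ^+ 2]expr2 sgn_sqr mul1r.
have tE : tau xi = w * (a * (dotv xi xi - 1) + 2 * b xi) by rewrite /tau dotv_stereo.
have wE : dotv xi xi = w^-1 - 1 by rewrite /w /conformal invrK; ring.
have w0 : w != 0 by rewrite gt_eqF// conformal_gt0.
rewrite yy aa tE wE /A /B /C /E; case: n hn => [//|[//|k]] _ /=.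
rewrite -!natr1 !exprS.
by field.
Qed.

End Slice.
End Stereographic.

(** * The Laplacian of the product in stereographic charts *)

Section ProductChart.
Context {R : realType} (n : nat).
Implicit Types (z : 'rV[R]_(n + n)) (xi eta : 'rV[R]_n) (s t : bool).

Lemma lsubmx_shift (h : R) z i :
  lsubmx (h *: (delta_mx 0 (lshift n i) : 'rV[R]_(n + n)) + z) =
  h *: delta_mx 0 i + lsubmx z.
Proof. by apply/rowP => j; rewrite !mxE eq_lshift. Qed.

Lemma rsubmx_lshift (h : R) z i :
  rsubmx (h *: (delta_mx 0 (lshift n i) : 'rV[R]_(n + n)) + z) = rsubmx z.
Proof. by apply/rowP => j; rewrite !mxE eq_rlshift andbF mulr0 add0r. Qed.

Lemma rsubmx_shift (h : R) z i :
  rsubmx (h *: (delta_mx 0 (rshift n i) : 'rV[R]_(n + n)) + z) =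
  h *: delta_mx 0 i + rsubmx z.
Proof. by apply/rowP => j; rewrite !mxE eq_rshift. Qed.

Lemma lsubmx_rshift (h : R) z i :
  lsubmx (h *: (delta_mx 0 (rshift n i) : 'rV[R]_(n + n)) + z) = lsubmx z.
Proof. by apply/rowP => j; rewrite !mxE eq_lrshift andbF mulr0 add0r. Qed.

(** Along a coordinate vector of one factor only that factor moves. *)
Lemma is_derive_lshift (G : 'rV[R]_n -> 'rV[R]_n -> R) z i (d : R) :
  is_derive (lsubmx z) (delta_mx 0 i) (G^~ (rsubmx z)) d ->
  is_derive z (delta_mx 0 (lshift n i)) (fun x => G (lsubmx x) (rsubmx x)) d.
Proof.
move=> /is_derive_restrict h; apply/is_derive_restrict.
suff -> : (fun h : R => G (lsubmx (h *: (delta_mx 0 (lshift n i) : 'rV[R]_(n + n)) + z))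
    (rsubmx (h *: (delta_mx 0 (lshift n i) : 'rV[R]_(n + n)) + z))) =
  (fun h => G (h *: delta_mx 0 i + lsubmx z) (rsubmx z)) by [].
by apply/funext => k; rewrite lsubmx_shift rsubmx_lshift.
Qed.

Lemma is_derive_rshift (G : 'rV[R]_n -> 'rV[R]_n -> R) z i (d : R) :
  is_derive (rsubmx z) (delta_mx 0 i) (G (lsubmx z)) d ->
  is_derive z (delta_mx 0 (rshift n i)) (fun x => G (lsubmx x) (rsubmx x)) d.
Proof.
move=> /is_derive_restrict h; apply/is_derive_restrict.
suff -> : (fun h : R => G (lsubmx (h *: (delta_mx 0 (rshift n i) : 'rV[R]_(n + n)) + z))
    (rsubmx (h *: (delta_mx 0 (rshift n i) : 'rV[R]_(n + n)) + z))) =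
  (fun h => G (lsubmx z) (h *: delta_mx 0 i + rsubmx z)) by [].
by apply/funext => k; rewrite rsubmx_shift lsubmx_rshift.
Qed.

Lemma dotvC (d : nat) (v w : 'rV[R]_d) : dotv v w = dotv w v.
Proof. by apply: eq_bigr => i _; rewrite mulrC. Qed.

Definition stereo_grad s i xi : 'rV[R]_n.+1 :=
  \row_j height_grad s (delta_mx 0 j) i xi.

Lemma dotv_deltar (d : nat) (v : 'rV[R]_d) j : dotv v (delta_mx 0 j) = v 0 j.
Proof.
rewrite /dotv (bigD1 j)//= big1 ?addr0 => [|k kj]; last first.
  by rewrite mxE (negPf kj) andbF mulr0.
by rewrite mxE !eqxx mulr1.
Qed.

Lemma is_derive_stereo s i j xi :
  is_derive xi (delta_mx 0 i) (fun x => stereo_inv s x 0 j) (stereo_grad s i xi 0 j).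
Proof.
have -> : (fun x : 'rV[R]_n => stereo_inv s x 0 j) =
    fun x => dotv (stereo_inv s x) (delta_mx 0 j).
  by apply/funext => x; rewrite dotv_deltar.
rewrite mxE; exact: is_derive_height.
Qed.

(** Stereographic projection is conformal. *)
Lemma stereo_grad_gram s i j xi :
  dotv (stereo_grad s i xi) (stereo_grad s j xi) =
  4 * conformal xi ^+ 2 *+ (i == j).
Proof.
set w := conformal xi.
have tE (Y : 'rV[R]_n.+1) l : tail Y 0 l = Y 0 (lift ord0 l) by rewrite mxE.
have g0 k : stereo_grad s k xi 0 ord0 = 4 * w ^+ 2 * xi 0 k * sgn s.
  have t0 : tail (delta_mx 0 ord0 : 'rV[R]_n.+1) = 0.
    by apply/rowP => l; rewrite !mxE.
  have d0 : dotv xi 0 = 0 by rewrite /dotv big1// => l _; rewrite mxE mulr0.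
  have -> : stereo_grad s k xi 0 ord0 = height_grad s (delta_mx 0 ord0) k xi.
    by rewrite mxE.
  by rewrite /height_grad -/w t0 d0 !mxE !eqxx /=; ring.
have gS k l : stereo_grad s k xi 0 (lift ord0 l) =
    2 * w * (l == k)%:R - 4 * w ^+ 2 * xi 0 k * xi 0 l.
  have tl : tail (delta_mx 0 (lift ord0 l) : 'rV[R]_n.+1) = delta_mx 0 l.
    by apply/rowP => m; rewrite !mxE (inj_eq lift_inj).
  have -> : stereo_grad s k xi 0 (lift ord0 l) =
      height_grad s (delta_mx 0 (lift ord0 l)) k xi by rewrite mxE.
  by rewrite /height_grad -/w tl dotv_deltar !mxE !eqxx /= (eq_sym k l); ring.
rewrite dotv_recl !g0.
have -> : dotv (tail (stereo_grad s i xi)) (tail (stereo_grad s j xi)) =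
    4 * w ^+ 2 *+ (i == j) - 16 * w ^+ 3 * xi 0 i * xi 0 j
    + 16 * w ^+ 4 * xi 0 i * xi 0 j * dotv xi xi.
  rewrite /dotv (eq_bigr (fun l => 4 * w ^+ 2 * ((l == i)%:R * (l == j)%:R)
    - 8 * w ^+ 3 * xi 0 j * ((l == i)%:R * xi 0 l)
    - 8 * w ^+ 3 * xi 0 i * ((l == j)%:R * xi 0 l)
    + 16 * w ^+ 4 * xi 0 i * xi 0 j * (xi 0 l * xi 0 l))); last first.
    by move=> l _; rewrite !tE !gS; ring.
  rewrite !big_split /= !sumrN -!mulr_sumr.
  have pick k (F : 'I_n -> R) : \sum_(l < n) (l == k)%:R * F l = F k.
    rewrite (bigD1 k)//= big1 ?addr0 ?eqxx ?mul1r// => l lk.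
    by rewrite (negPf lk) mul0r.
  by rewrite !pick -mulr_natr; ring.
have wE : dotv xi xi = w^-1 - 1 by rewrite /w /conformal invrK; ring.
have w0 : w != 0 by rewrite gt_eqF// conformal_gt0.
rewrite wE -mulr_natr; have := sgn_sqr s; set e := sgn s => ee.
rewrite (_ : _ * e * (_ * e) = (4 * w ^+ 2 * xi 0 i) * (4 * w ^+ 2 * xi 0 j) * (e * e)).
  by rewrite ee; field.
by ring.
Qed.

Lemma derive_pair_mx (k l : nat) (A : 'rV[R]_(n + n) -> 'rV[R]_k)
    (B : 'rV[R]_(n + n) -> 'rV[R]_l) z v (a : 'rV[R]_k) (b : 'rV[R]_l) :
  (forall j, is_derive z v (fun x => A x 0 j) (a 0 j)) ->
  (forall j, is_derive z v (fun x => B x 0 j) (b 0 j)) ->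
  'D_v (fun x => (A x, B x)) z = (a, b).
Proof.
move=> hA hB.
have dA : derivable A z v by apply/derivable_mxP => i j; rewrite ord1; case: (hA j).
have dB : derivable B z v by apply/derivable_mxP => i j; rewrite ord1; case: (hB j).
have eA : 'D_v A z = a.
  by rewrite derive_mx//; apply/rowP => j; rewrite mxE; case: (hA j).
have eB : 'D_v B z = b.
  by rewrite derive_mx//; apply/rowP => j; rewrite mxE; case: (hB j).
rewrite -eA -eB; apply: cvg_lim => //.
exact: (@cvg_pair _ _ _ _ (nbhs ('D_v A z)) (nbhs ('D_v B z)) _ _ _ _ _ dA dB).
Qed.

Lemma pderive_chart_l s t i z :
  pderive (lshift n i) (@prod_chart R n s t) z = (stereo_grad s i (lsubmx z), 0).
Proof.
apply: derive_pair_mx => j.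
  apply: (@is_derive_lshift (fun x _ => stereo_inv s x 0 j)).
  exact: is_derive_stereo.
rewrite mxE; apply: (@is_derive_lshift (fun _ y => stereo_inv t y 0 j)).
exact: dfun_cst.
Qed.

Lemma pderive_chart_r s t i z :
  pderive (rshift n i) (@prod_chart R n s t) z = (0, stereo_grad t i (rsubmx z)).
Proof.
apply: derive_pair_mx => j; last first.
  apply: (@is_derive_rshift (fun _ y => stereo_inv t y 0 j)).
  exact: is_derive_stereo.
rewrite mxE; apply: (@is_derive_rshift (fun x _ => stereo_inv s x 0 j)).
Qed.

(** The metric is conformally flat on each factor; only the constant delta
    distinguishes the second one. *)
Definition metric_diag (delta : R) z : 'rV[R]_(n + n) :=
  row_mx (const_mx (4 * conformal (lsubmx z) ^+ 2))
         (const_mx (delta * (4 * conformal (rsubmx z) ^+ 2))).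

Lemma dotv0l (d : nat) (v : 'rV[R]_d) : dotv 0 v = 0.
Proof. by rewrite /dotv big1// => i _; rewrite mxE mul0r. Qed.

Lemma dotv0r (d : nat) (v : 'rV[R]_d) : dotv v 0 = 0.
Proof. by rewrite dotvC dotv0l. Qed.

Lemma chart_metricE delta s t z :
  chart_metric delta s t z = diag_mx (metric_diag delta z).
Proof.
apply/matrixP => i j; rewrite !mxE /prod_metric.
case: (split_ordP i) => i' ->; case: (split_ordP j) => j' ->;
  rewrite ?pderive_chart_l ?pderive_chart_r /= ?dotv0l ?dotv0r
    ?stereo_grad_gram ?mulr0 ?addr0 ?add0r ?mxE.
- by rewrite eq_lshift.
- by rewrite eq_lrshift.
- by rewrite eq_rlshift.
- by rewrite eq_rshift mulrnAr.
Qed.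

Lemma metric_diag_gt0 delta z i : 0 < delta -> 0 < metric_diag delta z 0 i.
Proof.
move=> d0; rewrite /metric_diag mxE; case: splitP => j _; rewrite mxE.
  by rewrite mulr_gt0// exprn_gt0// conformal_gt0.
by rewrite mulr_gt0// mulr_gt0// exprn_gt0// conformal_gt0.
Qed.

Lemma invmx_diag (k : nat) (d : 'rV[R]_k) : (forall i, d 0 i != 0) ->
  invmx (diag_mx d) = diag_mx (\row_i (d 0 i)^-1).
Proof.
move=> d0; have E : diag_mx d *m diag_mx (\row_i (d 0 i)^-1) = 1%:M.
  apply/matrixP => i j; rewrite mul_diag_mx !mxE.
  by case: eqP => [_|_]; rewrite ?mulr1n ?mulfV// ?mulr0n mulr0.
have [U _] := mulmx1_unit E.
by rewrite -[RHS](mulKmx U) E mulmx1.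
Qed.

Lemma sum_invmx_diag (k : nat) (d : 'rV[R]_k) (x : 'I_k -> R) i :
  (forall i, d 0 i != 0) ->
  \sum_(j < k) invmx (diag_mx d) i j * x j = (d 0 i)^-1 * x i.
Proof.
move=> d0; rewrite invmx_diag// (bigD1 i)//= big1 ?addr0 => [|j ji].
  by rewrite !mxE eqxx mulr1n.
by rewrite !mxE eq_sym (negPf ji) mulr0n mul0r.
Qed.

Definition volume_const (delta : R) : R := Num.sqrt ((16 * delta) ^+ n).

Lemma volume_const_gt0 delta : 0 < delta -> 0 < volume_const delta.
Proof. by move=> d0; rewrite sqrtr_gt0 exprn_gt0// mulr_gt0. Qed.

Lemma sqrt_det_metric delta s t z : 0 < delta ->
  Num.sqrt (\det (chart_metric delta s t z)) =
  volume_const delta * (conformal (lsubmx z) ^+ n * conformal (rsubmx z) ^+ n).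
Proof.
move=> d0; rewrite chart_metricE det_diag big_split_ord /=.
rewrite (eq_bigr (fun=> 4 * conformal (lsubmx z) ^+ 2)); last first.
  by move=> i _; rewrite /metric_diag row_mxEl mxE.
rewrite [X in _ * X](eq_bigr (fun=> delta * (4 * conformal (rsubmx z) ^+ 2))); last first.
  by move=> i _; rewrite /metric_diag row_mxEr mxE.
rewrite !prodr_const !card_ord; set a := conformal _; set b := conformal _.
have -> : (4 * a ^+ 2) ^+ n * (delta * (4 * b ^+ 2)) ^+ n =
    (16 * delta) ^+ n * (a ^+ n * b ^+ n) ^+ 2.
  by rewrite -!exprMn -!exprM [(n * 2)%N]mulnC exprM -!exprMn; congr (_ ^+ n); ring.
rewrite sqrtrM ?exprn_ge0 ?mulr_ge0 ?(ltW d0)// sqrtr_sqr ger0_norm//.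
by rewrite mulr_ge0 ?exprn_ge0// ltW// conformal_gt0.
Qed.

(** Both factors contribute the same zonal operator in the common height
    tau = <x, y>, the second one divided by delta: with respect to each
    variable, tau is the height in the direction of the other one. *)
Lemma laplace_zonal (f f1 f2 : R -> R) delta s t z : (2 <= n)%N -> 0 < delta ->
  (forall x : R, is_derive x 1 f (f1 x)) ->
  (forall x : R, is_derive x 1 f1 (f2 x)) ->
  let tau := dotv (stereo_inv s (lsubmx z)) (stereo_inv t (rsubmx z)) in
  laplace_beltrami (@chart_metric R n delta s t)
    ((fun p : 'rV[R]_n.+1 * 'rV[R]_n.+1 => f (dotv p.1 p.2)) \o @prod_chart R n s t) z
  = (1 + delta^-1) * ((1 - tau ^+ 2) * f2 tau - n%:R * tau * f1 tau).
Proof.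
move=> hn d0 df df1 tau; set v := _ \o _.
have hv x : v x = f (dotv (stereo_inv s (lsubmx x)) (stereo_inv t (rsubmx x))) by [].
pose T xi eta := dotv (stereo_inv s xi) (stereo_inv t eta).
have vl i x : pderive (lshift n i) v x =
    f1 (T (lsubmx x) (rsubmx x)) * height_grad s (stereo_inv t (rsubmx x)) i (lsubmx x).
  apply: pderiveE; apply: (@is_derive_lshift (fun xi eta => f (T xi eta))).
  exact: dfun_comp (df _) (is_derive_height _ _ _ _).
have vr i x : pderive (rshift n i) v x =
    f1 (T (lsubmx x) (rsubmx x)) * height_grad t (stereo_inv s (lsubmx x)) i (rsubmx x).
  apply: pderiveE; apply: (@is_derive_rshift (fun xi eta => f (T xi eta))).
  apply: (dfun_comp (df _)); rewrite /T.
  have -> : (fun eta : 'rV[R]_n => dotv (stereo_inv s (lsubmx x)) (stereo_inv t eta)) =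
      fun eta => dotv (stereo_inv t eta) (stereo_inv s (lsubmx x)).
    by apply/funext => eta; rewrite dotvC.
  exact: is_derive_height.
pose K := volume_const delta; have K0 : 0 < K := volume_const_gt0 d0.
have md x i : metric_diag delta x 0 i != 0 by rewrite gt_eqF// metric_diag_gt0.
pose w1 := conformal (lsubmx z); pose w2 := conformal (rsubmx z).
have w10 : 0 < w1 := conformal_gt0 _; have w20 : 0 < w2 := conformal_gt0 _.
have cz xi : conformal xi != 0 :> R by rewrite gt_eqF// conformal_gt0.
have dl := zonal_divergence s (lsubmx z) hn df1 (stereo_inv_sphere t (rsubmx z)).
have dr := zonal_divergence t (rsubmx z) hn df1 (stereo_inv_sphere s (lsubmx z)).
have [Dl [hDl sDl]] := dl; have [Dr [hDr sDr]] := dr.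
have split_n (c : R) : c != 0 -> c ^+ n / c ^+ 2 = c ^+ n.-2.
  by move=> c0; case: n hn => [//|[//|k]] _ /=; rewrite !exprS; field; rewrite c0 ?expf_neq0.
have EL i : pderive (lshift n i) (fun x => Num.sqrt (\det (chart_metric delta s t x)) *
    \sum_(j < n + n) invmx (chart_metric delta s t x) (lshift n i) j * pderive j v x) z
  = K / 4 * w2 ^+ n * Dl i.
  apply: pderiveE.
  have -> : (fun x => Num.sqrt (\det (chart_metric delta s t x)) *
    \sum_(j < n + n) invmx (chart_metric delta s t x) (lshift n i) j * pderive j v x) =
    fun x => (fun xi eta => K / 4 * conformal eta ^+ n * (conformal xi ^+ n.-2 *
      (f1 (T xi eta) * height_grad s (stereo_inv t eta) i xi))) (lsubmx x) (rsubmx x).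
    apply/funext => x; rewrite sqrt_det_metric// chart_metricE sum_invmx_diag//.
    rewrite vl /metric_diag row_mxEl mxE -/K -(split_n _ (cz (lsubmx x))).
    by field; rewrite cz.
  apply: (@is_derive_lshift (fun xi eta => K / 4 * conformal eta ^+ n *
    (conformal xi ^+ n.-2 * (f1 (T xi eta) * height_grad s (stereo_inv t eta) i xi)))).
have ER i : pderive (rshift n i) (fun x => Num.sqrt (\det (chart_metric delta s t x)) *
    \sum_(j < n + n) invmx (chart_metric delta s t x) (rshift n i) j * pderive j v x) z
  = K / (4 * delta) * w1 ^+ n * Dr i.
  apply: pderiveE.
  have -> : (fun x => Num.sqrt (\det (chart_metric delta s t x)) *
    \sum_(j < n + n) invmx (chart_metric delta s t x) (rshift n i) j * pderive j v x) =
    fun x => (fun xi eta => K / (4 * delta) * conformal xi ^+ n * (conformal eta ^+ n.-2 *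
      (f1 (dotv (stereo_inv t eta) (stereo_inv s xi)) *
       height_grad t (stereo_inv s xi) i eta))) (lsubmx x) (rsubmx x).
    apply/funext => x; rewrite sqrt_det_metric// chart_metricE sum_invmx_diag//.
    rewrite vr /metric_diag row_mxEr mxE -/K -(split_n _ (cz (rsubmx x))).
    rewrite /T [dotv (stereo_inv t _) _]dotvC.
    by field; rewrite cz gt_eqF.
  apply: (@is_derive_rshift (fun xi eta => K / (4 * delta) * conformal xi ^+ n *
    (conformal eta ^+ n.-2 * (f1 (dotv (stereo_inv t eta) (stereo_inv s xi)) *
       height_grad t (stereo_inv s xi) i eta)))).
rewrite /laplace_beltrami big_split_ord /= (eq_bigr _ (fun i _ => EL i)).
rewrite [X in _ + X](eq_bigr _ (fun i _ => ER i)) -!mulr_sumr sDl sDr.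
rewrite sqrt_det_metric// -/K -/w1 -/w2 -/tau [dotv (stereo_inv t _) _]dotvC -/tau.
have a1 : w1 ^+ n != 0 by rewrite expf_neq0// cz.
have a2 : w2 ^+ n != 0 by rewrite expf_neq0// cz.
by field; rewrite a1 a2 !gt_eqF.
Qed.

(** The coordinates of xi are selected by c from those of a larger space, so
    that the lemma covers both halves of a product chart. *)
Lemma stereo_C2 (m : nat) (c : 'I_n -> 'I_m) s j :
  classC2 (fun z : 'rV[R]_m => stereo_inv s (\row_i z 0 (c i)) 0 j).
Proof.
have cq : classC2 (fun z : 'rV[R]_m => dotv (\row_i z 0 (c i)) (\row_i z 0 (c i))).
  have -> : (fun z : 'rV[R]_m => dotv (\row_i z 0 (c i)) (\row_i z 0 (c i))) =
      fun z : 'rV[R]_m => \sum_(i < n) z 0 (c i) * z 0 (c i).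
    by apply/funext => z; apply: eq_bigr => i _; rewrite mxE.
  by apply: classC2_sum => i; apply: classC2M; exact: classC2_coord.
have cw : classC2 (fun z : 'rV[R]_m => conformal (\row_i z 0 (c i))).
  apply: classC2V => [z|]; first exact: one_plus_dotv_neq0.
  exact: (classC2D (classC2_cst 1) cq).
have [j' ->|->] := unliftP ord0 j.
  have -> : (fun z : 'rV[R]_m => stereo_inv s (\row_i z 0 (c i)) 0 (lift ord0 j')) =
      fun z : 'rV[R]_m => conformal (\row_i z 0 (c i)) * (2 * z 0 (c j')).
    by apply/funext => z; rewrite stereo_invS mxE.
  exact: (classC2M cw (classC2M (classC2_cst 2) (classC2_coord (c j')))).
have -> : (fun z : 'rV[R]_m => stereo_inv s (\row_i z 0 (c i)) 0 ord0) =
    fun z : 'rV[R]_m => conformal (\row_i z 0 (c i)) *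
      (sgn s * (dotv (\row_i z 0 (c i)) (\row_i z 0 (c i)) + - 1)).
  by apply/funext => z; rewrite stereo_inv0.
exact: (classC2M cw (classC2M (classC2_cst _) (classC2D cq (classC2_cst (- 1))))).
Qed.

Lemma zonal_C2 (f f1 f2 : R -> R) :
  (forall x : R, is_derive x 1 f (f1 x)) ->
  (forall x : R, is_derive x 1 f1 (f2 x)) -> continuous f2 ->
  sphere2_C2 (fun p : 'rV[R]_n.+1 * 'rV[R]_n.+1 => f (dotv p.1 p.2)).
Proof.
move=> d1 d2 c2 s t.
apply: (classC2_comp (f := fun z => dotv (stereo_inv s (lsubmx z)) (stereo_inv t (rsubmx z)))
  d1 d2 c2).
apply: classC2_sum => j; apply: classC2M.
  have -> : (fun z : 'rV[R]_(n + n) => stereo_inv s (lsubmx z) 0 j) =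
      fun z => stereo_inv s (\row_i z 0 (lshift n i)) 0 j.
    apply/funext => z; congr (stereo_inv s _ 0 j); apply/rowP => i.
    by rewrite !mxE.
  exact: stereo_C2.
have -> : (fun z : 'rV[R]_(n + n) => stereo_inv t (rsubmx z) 0 j) =
    fun z => stereo_inv t (\row_i z 0 (rshift n i)) 0 j.
  apply/funext => z; congr (stereo_inv t _ 0 j); apply/rowP => i.
  by rewrite !mxE.
exact: stereo_C2.
Qed.

Lemma dotv_sphere_le1 (d : nat) (x y : 'rV[R]_d) :
  dotv x x = 1 -> dotv y y = 1 -> `|dotv x y| <= 1.
Proof.
move=> xx yy.
have h (e : R) : e * e = 1 -> 0 <= 2 + 2 * e * dotv x y.
  move=> ee; have -> : 2 + 2 * e * dotv x y = dotv (x + e *: y) (x + e *: y).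
    transitivity (dotv x x + e * e * dotv y y + 2 * e * dotv x y).
      by rewrite xx yy ee; ring.
    rewrite /dotv !mulr_sumr -!big_split /=; apply: eq_bigr => i _.
    by rewrite !mxE; ring.
  exact: dotv_ge0.
have h1 := h 1 (mulr1 _); have h2 := h (- 1) _; rewrite mulrNN mulr1 in h2.
by have := h2 erefl; rewrite ler_norml => ?; apply/andP; split; lra.
Qed.

Lemma dotv_orthogonal (d : nat) (A : 'M[R]_d) (x y : 'rV[R]_d) :
  orthogonal_mx A -> dotv (x *m A^T) (y *m A^T) = dotv x y.
Proof.
move=> /mulmx1C AA.
have dotE (u v : 'rV[R]_d) : dotv u v = (u *m v^T) 0 0.
  by rewrite mxE; apply: eq_bigr => i _; rewrite mxE.
by rewrite !dotE trmx_mul trmxK mulmxA -(mulmxA x) AA mulmx1.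
Qed.

End ProductChart.

(** * Multiplicity *)

Definition zonal {R : realType} {n : nat} (f : R -> R)
    (p : 'rV[R]_n.+1 * 'rV[R]_n.+1) : R := f (dotv p.1 p.2).

Lemma zonal_solves {R : realType} (n : nat) (delta p lambda : R) (f f1 f2 : R -> R) :
  (2 <= n)%N -> 0 < delta ->
  (forall t : R, is_derive t 1 f (f1 t)) -> (forall t : R, is_derive t 1 f1 (f2 t)) ->
  (forall t, `|t| <= 1 -> (1 - t ^+ 2) * f2 t - n%:R * t * f1 t
     + lambda / (1 + delta^-1) * (f t `^ (p - 1) - f t) = 0) ->
  solves_subcritical delta p lambda (@zonal R n f).
Proof.
move=> hn d0 d1 d2 ode s t z v; rewrite /v (laplace_zonal _ _ _ hn d0 d1 d2).
set tau := dotv _ _.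
have vE : (zonal f \o @prod_chart R n s t) z = f tau by [].
have c0 : 1 + delta^-1 != 0 by rewrite gt_eqF// addr_gt0// invr_gt0.
rewrite vE; have tau1 : `|tau| <= 1.
  by apply: dotv_sphere_le1; exact: stereo_inv_sphere.
have := ode _ tau1; set Z := _ - _; move: (1 + delta^-1) c0 => c c0 odeE.
have -> : lambda * f tau `^ (p - 1) = lambda * f tau
    + c * (lambda / c * (f tau `^ (p - 1) - f tau)).
  by field.
by move/eqP: odeE; rewrite addr_eq0 => /eqP ->; ring.
Qed.

(** The radial analysis asks for q < n / (n - 2), where q = p - 1, whereas
    the critical exponent of dimension 2 n gives the smaller bound
    (n + 1) / (n - 1). *)
Lemma subcritical_exponent {R : realType} (n : nat) (p : R) :
  (2 <= n)%N -> p < crit_exp R (2 * n) -> (p - 1) * (n%:R - 2) < n%:R.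
Proof.
move=> hn; rewrite /crit_exp natrM.
have n2 : 2 <= n%:R :> R by rewrite ler_nat.
rewrite ltr_pdivlMr; last by lra.
by nra.
Qed.

Lemma eigenvalue_of_le {R : realType} (n k l : nat) :
  (0 < n)%N -> (k <= l)%N -> eigenvalue_of n k <= eigenvalue_of n l :> R.
Proof.
move=> n0 kl; rewrite /eigenvalue_of.
have n1 : 1 <= n%:R :> R by rewrite ler1n.
have k0 : 0 <= k%:R :> R by [].
have h : k%:R <= l%:R :> R by rewrite ler_nat.
by apply: ler_pM => //; lra.
Qed.

Theorem theorem1p2 (R : realType) (n : nat) (hn : (2 <= n)%N)
    (delta : R) (hdelta : 0 < delta)
    (p : R) (hp : 2 < p < crit_exp R (2 * n))
    (k : nat) (hk : (1 <= k)%N)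
    (lambda : R)
    (hlambda : lambda_bif n k delta p < lambda <= lambda_bif n k.+1 delta p) :
  exists u : 'I_k -> 'rV[R]_n.+1 * 'rV[R]_n.+1 -> R,
    (forall i : 'I_k,
       [/\ sphere2_C2 (u i),
           sphere2_positive (u i),
           solves_subcritical delta p lambda (u i)
         & diag_invariant (u i)]) /\
    (forall i j : 'I_k, i <> j -> sphere2_distinct (u i) (u j)).
Proof.
have [p2 pcrit] := andP hp; have [hl _] := andP hlambda.
have c0 : 0 < 1 + delta^-1 by rewrite addr_gt0// invr_gt0.
(* Only even degrees bifurcate: k./2 of them, with two branches each, and the
   constant 1 make at least k solutions. *)
pose m := k./2; pose mu := lambda / (1 + delta^-1).
have ev : eigenvalue_of n k < mu * (p - 1 - 1).
  have -> : p - 1 - 1 = p - 2 by ring.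
  by move: hl; rewrite /lambda_bif -ltr_pdivlMr// -/mu ltr_pdivrMr ?subr_gt0//.
have evm : eigenvalue_of n m.*2 < mu * (p - 1 - 1).
  apply: le_lt_trans ev; apply: eigenvalue_of_le; first exact: ltnW.
  by rewrite -[leqRHS]odd_double_half leq_addl.
have mu0 : 0 < mu.
  have := le_lt_trans (eigenvalue_of_ge0 hn k) ev.
  by rewrite pmulr_lgt0//; lra.
have q1 : 1 < p - 1 by lra.
have [A [A_inj hA]] := zonal_solutions hn q1 (subcritical_exponent hn pcrit) mu0 evm.
have [f hf] := choice hA.
have kle : (k <= #|{: option (bool * 'I_m)}|)%N.
  rewrite card_option card_prod card_bool card_ord mul2n.
  by rewrite -[leqLHS]odd_double_half -add1n leq_add2r leq_b1.
exists (fun i => zonal (f (enum_val (widen_ord kle i)))); split=> [i|i j ij].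
  have [f1 [f2 [d1 d2 c2 _ ode]]] := hf (enum_val (widen_ord kle i)).
  split.
  - exact: zonal_C2 d1 d2 c2.
  - move=> x y xS yS; have [] := ode (dotv x y) _ => //.
    exact: dotv_sphere_le1.
  - by apply: (zonal_solves hn hdelta d1 d2) => t /ode[].
  - by move=> B BO x y _ _; rewrite /zonal/= dotv_orthogonal.
(* On the diagonal <x, x> = 1 the solutions take their value at the pole. *)
pose x : 'rV[R]_n.+1 := stereo_inv false (0 : 'rV[R]_n).
have xS : dotv x x = 1 := stereo_inv_sphere _ _.
exists x, x; split=> //; rewrite /zonal/= xS.
have val1 l : f l 1 = A l by have [? [? []]] := hf l.
rewrite !val1 => /A_inj /enum_val_inj /(congr1 val) /= e.
by apply: ij; exact: val_inj.
Qed.
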